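(* Let $\mathcal{A}$ be a finite alphabet and let $H \subset \mathcal{A}^{\mathbb{Z}}$ be a nearest-neighbor subshift of finite type whose Rauzy graph $\mathcal{G}(H)$ does not satisfy condition D, and such that $\mathcal{G}(H)$ either has no attractive and no almost-attractive vertex, or has no repulsive and no almost-repulsive vertex. Let $\tilde{H} \subset \mathcal{A}^{\mathbb{Z}}$ be the nearest-neighbor subshift of finite type obtained by adding a loop to every vertex of the Rauzy graph of $H$. Then $\tilde{H}$ verifies condition D, but there exists a one-dimensional subshift of finite type $V\subset\mathcal{A}^{\mathbb{Z}}$, which can be obtained algorithmically with $H$ as input, such that $h(X_{\tilde{H},V})$ is not computable.
   Context: For one-dimensional subshifts of finite type (SFTs) $H,V\subset\mathcal{A}^{\mathbb{Z}}$, the combined subshift is $$X_{H,V} := \{ x \in \mathcal{A}^{\mathbb{Z}^2} \mid \forall i, j \in \mathbb{Z},\ (x_{k,j})_{k \in \mathbb{Z}} \in H \text{ and } (x_{i,\ell})_{\ell \in \mathbb{Z}} \in V \}.$$ The topological entropy of a (nonempty) two-dimensional subshift $X$ is $h(X)=\lim_{n\to\infty}\frac{\log_2 N_X(n,n)}{n^2}$, where $N_X(n,n)$ is the number of $n\times n$ patterns appearing in configurations of $X$. $H$ is nearest-neighbor if it is defined by a set of forbidden words of length $2$. Its Rauzy graph $\mathcal{G}(H)=(\mathcal{V},\vec{E})$ is the directed graph whose vertices are the letters appearing in configurations of $H$, with $(a,b)\in\vec{E}$ iff the word $ab$ appears in some configuration of $H$; conversely such a graph determines the SFT of its bi-infinite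 paths. The strongly connected components (SCCs) are the maximal sets of mutually reachable vertices; transient vertices (those with no nontrivial path to themselves) do not form SCCs. Attractive vertex: a vertex $v$ with $(c,v)\in\vec{E}$ for all vertices $c$ of the graph; repulsive vertex: a vertex $v$ with $(v,c)\in\vec{E}$ for all vertices $c$. ''Almost-attractive'' (resp. ''almost-repulsive'') means that the only missing edge for $v$ to be attractive (resp. repulsive) is the loop $(v,v)$. Condition D: the graph (equivalently, the SFT it defines) satisfies condition D if all its SCCs have a type in common among the following three (an SCC may have none, one or several types): - $S$ is of reflexive type if $(v,v)\in\vec{E}$ for all $v\in S$; - $S$ is of symmetric type if for all $v\neq w\in S$ with $(v,w)\in\vec{E}$ one has $(w,v)\in\vec{E}$; - $S$ is of state-split cycle type if there are $p\geq 1$ and a partition $S=\bigsqcup_{i=0}^{p-1}V_i$ such that for all $i$, all $v\in V_i$ and all $w\in S$: $(v,w)\in\vec{E}\Leftrightarrow w\in V_{i+1 \bmod p}$. *)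

(* Defs.v *)
From HB Require Import structures.
From mathcomp Require Import all_boot all_order all_algebra.
From mathcomp Require Import all_classical all_reals all_analysis.
Import Order.TTheory GRing.Theory Num.Theory.
Import numFieldNormedType.Exports.

Set Implicit Arguments.
Unset Strict Implicit.
Unset Printing Implicit Defensive.

Local Open Scope ring_scope.

(** * Partial recursive functions *)

Inductive recfun : nat -> Type :=
| RZero : recfun 0
| RSucc : recfun 1
| RProj n (i : 'I_n) : recfun n
| RComp m n (f : recfun m) (g : 'I_m -> recfun n) : recfun n
| RPrec n (f : recfun n) (g : recfun n.+2) : recfun n.+1
| RMu n (f : recfun n.+1) : recfun n.

(* [computes f x y]: the program [f] halts on the arguments [x] with value [y].
   For primitive recursion the first argument is the recursion variable and
   [s] is the sequence of intermediate values; for minimization the searched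
   variable comes first. *)
Fixpoint computes n (f : recfun n) : n.-tuple nat -> nat -> Prop :=
  match f in recfun n return n.-tuple nat -> nat -> Prop with
  | RZero => fun _ y => y = 0%N
  | RSucc => fun x y => y = (thead x).+1
  | RProj _ i => fun x y => y = tnth x i
  | RComp m _ f g => fun x y => exists z : m.-tuple nat,
      (forall i, computes (g i) x (tnth z i)) /\ computes f z y
  | RPrec _ f g => fun x y => exists s : nat -> nat,
      [/\ computes f [tuple of behead x] (s 0%N),
          forall k, (k < thead x)%N ->
            computes g [tuple of k :: s k :: behead x] (s k.+1)
        & y = s (thead x)]
  | RMu _ f => fun x y => computes f [tuple of y :: x] 0%N /\
      forall k, (k < y)%N -> exists v, computes f [tuple of k :: x] v.+1
  end.

Definition computable_fun (f : nat -> nat) : Prop :=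
  exists c : recfun 1, forall n, computes c [tuple n] (f n).

Definition computable_real (R : realType) (x : R) : Prop :=
  exists s a b : nat -> nat,
    [/\ computable_fun s, computable_fun a, computable_fun b &
      forall n, `|x - (-1) ^+ s n * (a n)%:R / (b n).+1%:R| <= 2 ^- n].

(** * One-dimensional subshifts of finite type *)

Definition appears (A : finType) (w : seq A) (x : int -> A) : Prop :=
  exists i : int, mkseq (fun k => x (i + k%:Z)) (size w) = w.

Definition sft (A : finType) (F : seq (seq A)) : set (int -> A) :=
  [set x | forall w, w \in F -> ~ appears w x]%classic.

Definition nearest_neighbor (A : finType) (F : seq (seq A)) : Prop :=
  forall w, w \in F -> size w = 2%N.

(** * Rauzy graphs and condition D *)

Record digraph (A : finType) :=
  Digraph { vertex : {set A}; edge : rel A }.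

Definition rauzy (A : finType) (H : set (int -> A)) : digraph A :=
  Digraph [set a | `[< exists2 x, H x & appears [:: a] x >]]%SET
          (fun a b => `[< exists2 x, H x & appears [:: a; b] x >]).

Definition path_shift (A : finType) (G : digraph A) : set (int -> A) :=
  [set x | forall i, x i \in vertex G /\ edge G (x i) (x (i + 1))]%classic.

Definition add_loops (A : finType) (G : digraph A) : digraph A :=
  Digraph (vertex G)
          (fun a b => edge G a b || (a == b) && (a \in vertex G)).

(* There is a path of length at least one from [v] to [w]. *)
Definition reaches (A : finType) (G : digraph A) (v w : A) : bool :=
  [exists u, edge G v u && connect (edge G) u w].

(* Taking [v = w] below excludes transient vertices. *)
Definition mutually_reachable (A : finType) (G : digraph A) (S : {set A}) :
    bool :=
  (S \subset vertex G) && [forall v in S, forall w in S, reaches G v w].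

Definition scc (A : finType) (G : digraph A) (S : {set A}) : bool :=
  (S != finset.set0) && maxset (mutually_reachable G) S.

Definition reflexive_type (A : finType) (G : digraph A) (S : {set A}) : Prop :=
  forall v, v \in S -> edge G v v.

Definition symmetric_type (A : finType) (G : digraph A) (S : {set A}) : Prop :=
  forall v w, v \in S -> w \in S -> v != w -> edge G v w -> edge G w v.

(* [ordS i] is the successor of [i] modulo [p]. *)
Definition state_split_cycle_type (A : finType) (G : digraph A) (S : {set A}) :
    Prop :=
  exists (p : nat) (V : 'I_p -> {set A}),
    [/\ (1 <= p)%N,
        forall i, V i != finset.set0,
        forall i j, i != j -> [disjoint V i & V j],
        (\bigcup_i V i)%SET = S
      & forall i v w, v \in V i -> w \in S -> edge G v w = (w \in V (ordS i))].

Definition condition_D (A : finType) (G : digraph A) : Prop :=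
  [\/ forall S, scc G S -> reflexive_type G S,
      forall S, scc G S -> symmetric_type G S
    | forall S, scc G S -> state_split_cycle_type G S].

Definition attractive (A : finType) (G : digraph A) (v : A) : Prop :=
  v \in vertex G /\ forall c, c \in vertex G -> edge G c v.

Definition repulsive (A : finType) (G : digraph A) (v : A) : Prop :=
  v \in vertex G /\ forall c, c \in vertex G -> edge G v c.

Definition almost_attractive (A : finType) (G : digraph A) (v : A) : Prop :=
  [/\ v \in vertex G, ~~ edge G v v &
      forall c, c \in vertex G -> c != v -> edge G c v].

Definition almost_repulsive (A : finType) (G : digraph A) (v : A) : Prop :=
  [/\ v \in vertex G, ~~ edge G v v &
      forall c, c \in vertex G -> c != v -> edge G v c].

(** * Two-dimensional subshifts and entropy *)

Definition combined (A : finType) (H V : set (int -> A)) :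
    set (int * int -> A) :=
  [set x | forall i j : int, H (fun k => x (k, j)) /\ V (fun l => x (i, l))]
  %classic.

Definition num_patterns (A : finType) (X : set (int * int -> A)) (n : nat) :
    nat :=
  #|[set P : {ffun 'I_n * 'I_n -> A} |
      `[< exists2 x, X x & exists i j : int, forall k l : 'I_n,
            P (k, l) = x (i + (k : nat)%:Z, j + (l : nat)%:Z) >]]%SET|.

Definition entropy (R : realType) (A : finType) (X : set (int * int -> A)) : R :=
  limn (fun n : nat => ln (num_patterns X n)%:R / ln 2 / n%:R ^+ 2 : R).

(** * Finite descriptions as inputs and outputs of programs *)

(* Letters are numbered by [enum_rank]; [CodeSeq.code] is the Goedel numbering
   of finite sequences of naturals. *)
Definition code_words (A : finType) (F : seq (seq A)) : seq nat :=
  [seq CodeSeq.code [seq (enum_rank a : nat) | a <- w] | w <- F].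

Definition code_sft (A : finType) (F : seq (seq A)) : nat :=
  CodeSeq.code (#|A| :: code_words F).

(* Main.v *)
Require Import Defs.
From HB Require Import structures.
From mathcomp Require Import all_boot all_order all_algebra.
From mathcomp Require Import all_classical all_reals all_analysis.
From mathcomp Require Import zify ring lra.
Import Order.TTheory GRing.Theory Num.Theory.
Import numFieldNormedType.Exports.

Set Implicit Arguments.
Unset Strict Implicit.
Unset Printing Implicit Defensive.

(* If the edge (v, w) of a component of G(H) is not symmetric, a shortest path from
   w to v closes into a directed cycle of length L >= 3 without chords from its
   first vertex c_0 = w. Reading a column of L letters c_v, c_(v+1), ... as the
   value v, adjacent columns in H~ allow exactly the increments 0 and 1 of v. Cells
   made of such columns simulate a clock and, in its slots, tiles of an arbitrary
   finite tile set, one new tile at each tick. The column constraint V checks the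
   tiling rules inside the cells.

   The tile set is fixed once for all. Its tilings are hierarchical, with
   self-similar lattices of corners; rows of lowest level m and next level L carry
   the cell m of a computation at time L, for every m < L. The computation
   enumerates a set K of naturals. Rows of type (k, k + 1) have density
   2 ^ -(k + 2) and carry free bits precisely when k is not in K, so the entropy is
   a constant multiple of the sum of 2 ^ -(k + 2) over k not in K. A tiling is
   determined by little more than its boundary and the free bits, because the
   tile set is deterministic once the kinds of tiles are known. If K contains
   all numbers that are not multiples of 4, approximations of the entropy decide
   K, which can be chosen undecidable. *)

(** Since every letter of H~ may follow itself, nothing forces the clock to tick. Tiles are
    therefore indexed by ticks and not by columns: a window of n columns shows a strip of tiles
    whose width depends on the pattern, and the choice of the ticks costs n bits, negligible against
    n ^ 2. A clock that ticks at every column gives the lower bound. The increments 0 and 1 also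
    keep a slot from changing its tile at once: one row would have to go from one value to another,
    and a second row back. The slot whose number is the current time is an exception: there both row
    values coincide, so it is blank and is refilled at the next tick. As L >= 3, each column still
    shows two consecutive tiles, and V, which sees one column at a time, can check horizontal
    matching inside a cell and vertical matching between stacked cells. The upper bound uses only N
    levels of the hierarchy: they contain a correct computation up to time about N, which for large
    N excludes free bits for all k in K below a given N0. *)

(** * Computable functions *)

(* An environment [e] stands for the list of arguments: [e i] is the [i]-th one. *)
Definition recursive n (f : (nat -> nat) -> nat) : Prop :=
  exists c : recfun n, forall x : n.-tuple nat, computes c x (f (nth 0 x)).

Lemma recursive_ext n f g : (forall e, f e = g e) -> recursive n f -> recursive n g.
Proof. by move=> fg [c cP]; exists c => x; rewrite -fg. Qed.

Lemma recursive_var n i : i < n -> recursive n (fun e => e i).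
Proof.
by move=> lin; exists (RProj (Ordinal lin)) => x /=; rewrite (tnth_nth 0).
Qed.

Lemma recursive_comp m n F (g : 'I_m -> (nat -> nat) -> nat) :
  recursive m F -> (forall i, recursive n (g i)) ->
  recursive n (fun e => F (nth 0 [seq g i e | i <- enum 'I_m])).
Proof.
move=> [c cP] /fin_all_exists[d dP]; exists (RComp c d) => x /=.
exists [tuple of [seq g i (nth 0 x) | i <- ord_tuple m]]; split=> [i|].
  by rewrite tnth_map tnth_ord_tuple.
by rewrite -(val_ord_tuple m).
Qed.

Lemma recursive_comp1 n F a :
  recursive 1 (fun e => F (e 0)) -> recursive n a -> recursive n (fun e => F (a e)).
Proof.
move=> rF ra; have := recursive_comp (m := 1) (g := fun=> a) rF (fun=> ra).
by apply: recursive_ext => e; rewrite enum_ordSl.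
Qed.

Lemma recursive_comp2 n F a b :
  recursive 2 (fun e => F (e 0) (e 1)) -> recursive n a -> recursive n b ->
  recursive n (fun e => F (a e) (b e)).
Proof.
move=> rF ra rb.
have rg (i : 'I_2) : recursive n (if val i is 0 then a else b) by case: i => [[|]].
by have := recursive_comp rF rg; apply: recursive_ext => e; rewrite !enum_ordSl /=.
Qed.

Lemma recursive_comp3 n F a b c :
  recursive 3 (fun e => F (e 0) (e 1) (e 2)) ->
  recursive n a -> recursive n b -> recursive n c ->
  recursive n (fun e => F (a e) (b e) (c e)).
Proof.
move=> rF ra rb rc.
have rg (i : 'I_3) : recursive n (match val i with 0 => a | 1 => b | _ => c end).
  by case: i => [[|[|]]].
by have := recursive_comp rF rg; apply: recursive_ext => e; rewrite !enum_ordSl /=.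
Qed.

Lemma recursive_succ n a : recursive n a -> recursive n (fun e => (a e).+1).
Proof.
move=> ra; apply: (recursive_comp1 (F := succn)) => //.
by exists RSucc => x /=; rewrite /thead (tnth_nth 0).
Qed.

Lemma recursive_const n k : recursive n (fun=> k).
Proof.
elim: k => [|k IH]; last exact: recursive_succ.
exists (RComp RZero (fun i : 'I_0 => RProj (n := n) (match i with Ordinal _ H => False_rect _ (notF H) end))) => x /=.
by exists [tuple]; split=> // -[].
Qed.

Lemma recursive_prec n b g k :
  recursive n b -> recursive n.+2 (fun e => g (e 0) (e 1) (fun i => e i.+2)) ->
  recursive n k ->
  recursive n (fun e => nat_rect (fun=> nat) (b e) (fun i s => g i s e) (k e)).
Proof.
move=> [cb cbP] [cg cgP] [ck ckP].
pose d (i : 'I_n.+1) := if unlift ord0 i is Some j then RProj j else ck.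
exists (RComp (RPrec cb cg) d) => x /=.
exists [tuple of k (nth 0 x) :: x]; split=> [i|].
  rewrite /d; case: unliftP => [j|] -> /=; last by rewrite tnth0; exact: ckP.
  by rewrite tnthS.
exists (nat_rect (fun=> nat) (b (nth 0 x)) (fun i s => g i s (nth 0 x))).
split=> [|i _|]; last by rewrite theadE.
  by have := cbP x; congr computes; apply: val_inj.
have := cgP [tuple of i :: nat_rect (fun=> nat) (b (nth 0 x)) (fun i s => g i s (nth 0 x)) i :: x].
by congr computes; apply: val_inj.
Qed.

Lemma recursive_shift n f : recursive n f -> recursive n.+1 (fun e => f (fun i => e i.+1)).
Proof.
case=> c cP; exists (RComp c (fun i : 'I_n => RProj (lift ord0 i))) => x.
exists [tuple of behead x]; split=> [i|] /=; first by rewrite tnth_behead; congr tnth; apply: val_inj; rewrite /= inordK // ltnS.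
have -> : (fun i => nth 0 x i.+1) = nth 0 [tuple of behead x] by case: x => -[].
exact: cP.
Qed.

Lemma recursive_if n (P : (nat -> nat) -> bool) a b :
  recursive n P -> recursive n a -> recursive n b ->
  recursive n (fun e => if P e then a e else b e).
Proof.
move=> rP ra rb; apply: (@recursive_ext _
  (fun e => nat_rect (fun=> nat) (b e) (fun i s => (fun _ _ e => a e) i s e) (P e))).
  by move=> e; case: (P e).
by apply: recursive_prec => //; exact: (recursive_shift (recursive_shift ra)).
Qed.

Lemma recursive_add n a b : recursive n a -> recursive n b -> recursive n (fun e => a e + b e).
Proof.
move=> ra rb; apply: (@recursive_ext _
  (fun e => nat_rect (fun=> nat) (b e) (fun i s => (fun _ s _ => s.+1) i s e) (a e))).
  by move=> e; elim: (a e) => //= k ->.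
by apply: recursive_prec => //; apply: recursive_succ; apply: recursive_var.
Qed.

Lemma recursive_mul n a b : recursive n a -> recursive n b -> recursive n (fun e => a e * b e).
Proof.
move=> ra rb; apply: (@recursive_ext _
  (fun e => nat_rect (fun=> nat) 0 (fun i s => (fun _ s e => b e + s) i s e) (a e))).
  by move=> e; elim: (a e) => //= k ->.
apply: recursive_prec => //; first exact: recursive_const.
by apply: recursive_add; [exact: (recursive_shift (recursive_shift rb)) | apply: recursive_var].
Qed.

Lemma recursive_exp n a b : recursive n a -> recursive n b -> recursive n (fun e => a e ^ b e).
Proof.
move=> ra rb; apply: (@recursive_ext _
  (fun e => nat_rect (fun=> nat) 1 (fun i s => (fun _ s e => a e * s) i s e) (b e))).
  by move=> e; elim: (b e) => //= k ->; rewrite expnS.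
apply: recursive_prec => //; first exact: recursive_const.
by apply: recursive_mul; [exact: (recursive_shift (recursive_shift ra)) | apply: recursive_var].
Qed.

Lemma recursive_pred n a : recursive n a -> recursive n (fun e => (a e).-1).
Proof.
move=> ra; apply: (@recursive_ext _
  (fun e => nat_rect (fun=> nat) 0 (fun i s => (fun i _ _ => i) i s e) (a e))).
  by move=> e; case: (a e).
by apply: recursive_prec => //; [apply: recursive_const | apply: recursive_var].
Qed.

Lemma recursive_sub n a b : recursive n a -> recursive n b -> recursive n (fun e => a e - b e).
Proof.
move=> ra rb; apply: (@recursive_ext _
  (fun e => nat_rect (fun=> nat) (a e) (fun i s => (fun _ s _ => s.-1) i s e) (b e))).
  by move=> e; elim: (b e) => [|k /= ->]; rewrite ?subn0 ?subnS.
by apply: recursive_prec => //; apply: recursive_pred; apply: recursive_var.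
Qed.

Lemma recursive_iszero n a : recursive n a -> recursive n (fun e => a e == 0).
Proof.
move=> ra; apply: (@recursive_ext _
  (fun e => nat_rect (fun=> nat) 1 (fun i s => (fun _ _ _ => 0) i s e) (a e))).
  by move=> e; case: (a e).
by apply: recursive_prec => //; apply: recursive_const.
Qed.

Lemma recursive_leq n a b : recursive n a -> recursive n b -> recursive n (fun e => a e <= b e).
Proof. by move=> ra rb; apply: recursive_iszero; apply: recursive_sub. Qed.

Lemma recursive_neg n (P : (nat -> nat) -> bool) : recursive n P -> recursive n (fun e => ~~ P e).
Proof. by move=> /recursive_iszero; apply: recursive_ext => e; case: (P e). Qed.

Lemma recursive_and n (P Q : (nat -> nat) -> bool) :
  recursive n P -> recursive n Q -> recursive n (fun e => P e && Q e).
Proof. by move=> rP /(recursive_mul rP); apply: recursive_ext => e; rewrite mulnb. Qed.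

Lemma recursive_or n (P Q : (nat -> nat) -> bool) :
  recursive n P -> recursive n Q -> recursive n (fun e => P e || Q e).
Proof.
move=> /recursive_neg rP /recursive_neg rQ; have /recursive_neg := recursive_and rP rQ.
by apply: recursive_ext => e; rewrite negb_and !negbK.
Qed.

Lemma recursive_impl n (P Q : (nat -> nat) -> bool) :
  recursive n P -> recursive n Q -> recursive n (fun e => P e ==> Q e).
Proof.
move=> /recursive_neg rP /(recursive_or rP).
by apply: recursive_ext => e; rewrite implybE.
Qed.

Lemma recursive_eq n a b : recursive n a -> recursive n b -> recursive n (fun e => a e == b e).
Proof.
move=> ra rb; have := recursive_and (recursive_leq ra rb) (recursive_leq rb ra).
by apply: recursive_ext => e; rewrite eqn_leq.
Qed.

Lemma recursive_count n P k :
  recursive n.+1 (fun e => (P (e 0) (fun i => e i.+1) : bool)) -> recursive n k ->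
  recursive n (fun e => count (P^~ e) (iota 0 (k e))).
Proof.
move=> [c cP] rk; apply: (@recursive_ext _
  (fun e => nat_rect (fun=> nat) 0 (fun i s => (fun i s e => s + P i e) i s e) (k e))).
  move=> e; elim: (k e) => // j IH.
  by rewrite -[in RHS]addn1 iotaD count_cat -IH /= addn0.
apply: recursive_prec => //; first exact: recursive_const.
apply: recursive_add; first exact: recursive_var.
(* The step of the recursion receives the index, the accumulator and the environment; this
   composition drops the accumulator, which [P] does not take. *)
exists (RComp c (fun i : 'I_n.+1 => RProj (if unlift ord0 i is Some j then lift ord0 (lift ord0 j) else ord0))) => x.
case: x => -[//|a [//|b s]] sz /=.
have sz' : size (a :: s) == n.+1 by move: sz.
exists (Tuple sz'); split=> [i|]; last exact: (cP (Tuple sz')).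
by rewrite /= !(tnth_nth 0) /=; case: unliftP => [j|] ->.
Qed.

Lemma recursive_all n P k :
  recursive n.+1 (fun e => (P (e 0) (fun i => e i.+1) : bool)) -> recursive n k ->
  recursive n (fun e => all (P^~ e) (iota 0 (k e))).
Proof.
move=> rP rk; have := recursive_eq (recursive_count rP rk) rk.
by apply: recursive_ext => e; rewrite all_count size_iota.
Qed.

Lemma recursive_has n P k :
  recursive n.+1 (fun e => (P (e 0) (fun i => e i.+1) : bool)) -> recursive n k ->
  recursive n (fun e => has (P^~ e) (iota 0 (k e))).
Proof.
move=> rP rk; have := recursive_leq (recursive_const n 1) (recursive_count rP rk).
by apply: recursive_ext => e; rewrite has_count.
Qed.

Lemma count_iota_ltn q n : count (fun i => i < q) (iota 0 n) = minn q n.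
Proof.
elim: n => [|n IH]; first by rewrite minn0.
by rewrite -[in LHS]addn1 iotaD count_cat IH /= add0n addn0; case: ltnP => /=; lia.
Qed.

(** [a %/ b] counts the positive multiples of [b] that are at most [a]. The divisor 0 is treated
    apart, since then every index would count. *)
Lemma recursive_div n a b : recursive n a -> recursive n b -> recursive n (fun e => a e %/ b e).
Proof.
move=> ra rb; apply: (@recursive_ext _ (fun e => if b e == 0 then 0 else
   count ((fun i e => i.+1 * b e <= a e)^~ e) (iota 0 (a e)))).
  move=> e; have [->|b0] := eqVneq (b e) 0; first by rewrite divn0.
  have bgt : 0 < b e by rewrite lt0n.
  rewrite (@eq_count _ _ (fun i => i < a e %/ b e)) => [|i /=]; last by rewrite leq_divRL.
  by rewrite count_iota_ltn; apply/minn_idPl; rewrite leq_div.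
apply: recursive_if; [exact: recursive_iszero | exact: recursive_const |].
apply: (@recursive_count _ (fun i e => i.+1 * b e <= a e)) => //.
apply: recursive_leq; last exact: (recursive_shift ra).
by apply: recursive_mul; [apply: recursive_succ; apply: recursive_var | exact: (recursive_shift rb)].
Qed.

Lemma recursive_mod n a b : recursive n a -> recursive n b -> recursive n (fun e => a e %% b e).
Proof.
move=> ra rb; have := recursive_sub ra (recursive_mul (recursive_div ra rb) rb).
by apply: recursive_ext => e; rewrite {1}(divn_eq (a e) (b e)) addKn.
Qed.

Ltac rec1 :=
  match goal with
  | |- recursive _ (fun e => e ?i) => apply: recursive_var; done
  | |- recursive _ (fun e => ?c) => exact: recursive_const
  | |- recursive _ (fun e => (@?a e).+1) => apply: (recursive_succ (a := a))
  | |- recursive _ (fun e => (@?a e).-1) => apply: (recursive_pred (a := a))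
  | |- recursive _ (fun e => @?a e + @?b e) => apply: (recursive_add (a := a) (b := b))
  | |- recursive _ (fun e => @?a e - @?b e) => apply: (recursive_sub (a := a) (b := b))
  | |- recursive _ (fun e => @?a e * @?b e) => apply: (recursive_mul (a := a) (b := b))
  | |- recursive _ (fun e => @?a e ^ @?b e) => apply: (recursive_exp (a := a) (b := b))
  | |- recursive _ (fun e => @?a e %/ @?b e) => apply: (recursive_div (a := a) (b := b))
  | |- recursive _ (fun e => @?a e %% @?b e) => apply: (recursive_mod (a := a) (b := b))
  | |- recursive _ (fun e => nat_of_bool (@?a e <= @?b e)) =>
      apply: (recursive_leq (a := a) (b := b))
  | |- recursive _ (fun e => nat_of_bool (@?a e == @?b e)) =>
      apply: (recursive_eq (a := a) (b := b))
  | |- recursive _ (fun e => nat_of_bool (~~ @?P e)) => apply: (recursive_neg (P := P))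
  | |- recursive _ (fun e => nat_of_bool (@?P e && @?Q e)) =>
      apply: (recursive_and (P := P) (Q := Q))
  | |- recursive _ (fun e => nat_of_bool (@?P e || @?Q e)) =>
      apply: (recursive_or (P := P) (Q := Q))
  | |- recursive _ (fun e => nat_of_bool (@?P e ==> @?Q e)) =>
      apply: (recursive_impl (P := P) (Q := Q))
  | |- recursive _ (fun e => nat_of_bool (all (@?P e) (iota 0 (@?k e)))) =>
      refine (recursive_all (P := fun i e => P e i) (k := k) _ _)
  | |- recursive _ (fun e => nat_of_bool (has (@?P e) (iota 0 (@?k e)))) =>
      refine (recursive_has (P := fun i e => P e i) (k := k) _ _)
  | |- recursive _ (fun e => count (@?P e) (iota 0 (@?k e))) =>
      refine (recursive_count (P := fun i e => P e i) (k := k) _ _)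
  | |- recursive _ (fun e => @nat_rect _ (@?b e) (@?g e) (@?k e)) =>
      refine (recursive_prec (b := b) (g := fun i s e => g e i s) (k := k) _ _ _)
  | |- _ => apply: recursive_if
  end.
Ltac rec := repeat (cbv beta; rec1).

(** [CodeSeq.code (x :: s)] is [2 ^ x] times the odd number [(code s).*2.+1], so the head is the
    exponent of 2. For [c = 0] the count is 0, hence reading past the end of a sequence gives 0. *)
Definition code_head c := count (fun i => 2 ^ i.+1 %| c) (iota 0 c).
Definition code_tail c := (c %/ 2 ^ code_head c)./2.
Definition code_nth c i := code_head (iter i code_tail c).

Lemma code_head_cons x m : code_head (2 ^ x * m.*2.+1) = x.
Proof.
rewrite /code_head (@eq_count _ _ (fun i => i < x)) ?count_iota_ltn => [|i].
  apply/minn_idPl; apply: leq_trans (ltnW (ltn_expl x (ltnSn 1))) _.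
  by rewrite leq_pmulr.
have [lt|le] := ltnP i x; first by apply: dvdn_mulr; apply: dvdn_exp2l.
apply/negbTE/negP => dv; have := dvdn_trans (dvdn_exp2l 2 (le : x.+1 <= i.+1)) dv.
rewrite expnSr dvdn_pmul2l ?expn_gt0 // dvdn2 /= odd_double; done.
Qed.

Lemma code_tail_cons x m : code_tail (2 ^ x * m.*2.+1) = m.
Proof. by rewrite /code_tail code_head_cons mulKn ?expn_gt0 // -[RHS](half_bit_double m true) add1n. Qed.

Lemma code_nth_code s i : code_nth (CodeSeq.code s) i = nth 0 s i.
Proof.
have tl t : code_tail (CodeSeq.code t) = CodeSeq.code (behead t).
  by case: t => // x t; rewrite /CodeSeq.code /= -/(CodeSeq.code t) code_tail_cons.
rewrite /code_nth; have -> : iter i code_tail (CodeSeq.code s) = CodeSeq.code (drop i s).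
  elim: i => [|i IH]; first by rewrite drop0.
  by rewrite iterS IH tl -drop1 drop_drop add1n.
rewrite -[i in RHS]addn0 -nth_drop; case: (drop i s) => // x t.
by rewrite /CodeSeq.code /= code_head_cons.
Qed.

Lemma recursive_code_head n a : recursive n a -> recursive n (fun e => code_head (a e)).
Proof.
move=> ra; apply: (recursive_comp1 (F := code_head)) => //; rewrite /code_head.
apply: (@recursive_ext _ (fun e => count (fun i => e 0 %% 2 ^ i.+1 == 0) (iota 0 (e 0)))) => //.
by rec.
Qed.

Lemma recursive_half n a : recursive n a -> recursive n (fun e => (a e)./2).
Proof.
move=> ra; have : recursive n (fun e => a e %/ 2) by rec.
by apply: recursive_ext => e; rewrite divn2.
Qed.

Lemma recursive_code_nth n a i : recursive n a -> recursive n i ->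
  recursive n (fun e => code_nth (a e) (i e)).
Proof.
move=> ra ri; apply: (recursive_comp2 (F := code_nth)) => //.
apply: recursive_code_head.
apply: (@recursive_ext _ (fun e => nat_rect (fun=> nat) (e 0) (fun _ s => code_tail s) (e 1))).
  by move=> e; elim: (e 1) => //= j ->.
rec; rewrite /code_tail; apply: recursive_half; rec; apply: recursive_code_head; rec.
Qed.

Lemma recursive_code_cons n a b : recursive n a -> recursive n b ->
  recursive n (fun e => 2 ^ a e * ((b e).*2).+1).
Proof.
move=> ra rb; have : recursive n (fun e => 2 ^ a e * (b e + b e).+1) by rec.
by apply: recursive_ext => e; rewrite addnn.
Qed.

(** * Register machines *)

(* [Jeq a b f k] jumps [f] instructions forward and [k] backward when the
   registers [a] and [b] agree, so that code is position independent. *)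
Inductive instr := Zero of nat | Inc of nat | Jeq of nat & nat & nat & nat.

Definition upd (r : nat -> nat) a v := fun c => if c == a then v else r c.

Definition exec i (s : nat * (nat -> nat)) :=
  let: (pc, r) := s in
  match i with
  | Zero a => (pc.+1, upd r a 0)
  | Inc a => (pc.+1, upd r a (r a).+1)
  | Jeq a b f k => (if r a == r b then pc + f - k else pc.+1, r)
  end.

Definition step (P : seq instr) s := if drop s.1 P is i :: _ then exec i s else s.

(** Correctness of a block inside any surrounding program. The last clause says that the counter
    does not reach the end of the block early; it is what later makes the time of the check
    instruction unique in each cycle of [main_program]. *)
Definition executes (c : seq instr) (r : nat -> nat) (Q : (nat -> nat) -> Prop) :=
  forall P0 P1, exists t r',
    [/\ iter t (step (P0 ++ c ++ P1)) (size P0, r) = (size P0 + size c, r'), Q r' &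
      forall u, u < t -> (iter u (step (P0 ++ c ++ P1)) (size P0, r)).1 < size P0 + size c].

Lemma executes_weaken c r (Q Q' : (nat -> nat) -> Prop) :
  executes c r Q -> (forall r', Q r' -> Q' r') -> executes c r Q'.
Proof. by move=> ex QQ' P0 P1; have [t [r' [? /QQ' ? ?]]] := ex P0 P1; exists t, r'. Qed.

Lemma executes_cat c1 c2 r (Q Q' : (nat -> nat) -> Prop) :
  executes c1 r Q -> (forall r', Q r' -> executes c2 r' Q') -> executes (c1 ++ c2) r Q'.
Proof.
move=> ex1 ex2 P0 P1; have [t [r' [e1 /ex2 ex lt1]]] := ex1 P0 (c2 ++ P1).
have [t' [r2 [e2 Qr2 lt2]]] := ex (P0 ++ c1) P1.
rewrite -!catA size_cat in e1 e2 lt1 lt2; rewrite -catA.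
exists (t' + t), r2; split=> //; first by rewrite iterD e1 size_cat addnA.
move=> u ut; rewrite size_cat addnA; have [/lt1 lt|le] := ltnP u t.
  exact: ltn_addr.
by rewrite -(subnK le) iterD e1 lt2 //; lia.
Qed.

Lemma executes_nil r (Q : (nat -> nat) -> Prop) : Q r -> executes [::] r Q.
Proof. by move=> Qr P0 P1; exists 0, r; rewrite addn0. Qed.

Lemma step_at P0 i P1 r : step (P0 ++ i :: P1) (size P0, r) = exec i (size P0, r).
Proof. by rewrite /step drop_size_cat. Qed.

Lemma executes_zero a r : executes [:: Zero a] r (eq (upd r a 0)).
Proof.
move=> P0 P1; exists 1, (upd r a 0); split=> [|//|[|//] _]; last by rewrite /= addn1.
by rewrite /= step_at addn1.
Qed.

Lemma executes_inc a r : executes [:: Inc a] r (eq (upd r a (r a).+1)).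
Proof.
move=> P0 P1; exists 1, (upd r a (r a).+1); split=> [|//|[|//] _]; last by rewrite /= addn1.
by rewrite /= step_at addn1.
Qed.

(** The first jump skips the whole block. The closing jump compares a register with itself, so it
    always returns to the first one. *)
Definition loop a b (c : seq instr) :=
  Jeq a b (size c).+2 0 :: c ++ [:: Jeq a a 0 (size c).+1].

(** [I k] is the invariant with [k] rounds left, so its index also proves termination. *)
Lemma executes_loop a b c (I : nat -> (nat -> nat) -> Prop) n r :
  (forall k r', I k.+1 r' -> r' a <> r' b /\ executes c r' (I k)) ->
  (forall r', I 0 r' -> r' a = r' b) -> I n r ->
  executes (loop a b c) r (I 0).
Proof.
move=> Istep Iend; elim: n r => [|n IH] r Ir P0 P1.
  exists 1, r; split=> // [|[|//] _]; last by rewrite /= addnS ltnS leq_addr.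
  by rewrite /= step_at /= (Iend _ Ir) eqxx subn0 size_cat /= addn1.
have [/eqP/negPf rab ex] := Istep _ _ Ir.
have [t [r' [e1 Ir' lt1]]] :=
  ex (P0 ++ [:: Jeq a b (size c).+2 0]) (Jeq a a 0 (size c).+1 :: P1).
have [t' [r2 [e2 Ir2 lt2]]] := IH _ Ir' P0 P1.
have eP : P0 ++ loop a b c ++ P1 =
  (P0 ++ [:: Jeq a b (size c).+2 0]) ++ c ++ Jeq a a 0 (size c).+1 :: P1.
  by rewrite /loop -!catA /= -catA.
have s1 : step (P0 ++ loop a b c ++ P1) (size P0, r) =
    (size (P0 ++ [:: Jeq a b (size c).+2 0]), r).
  by rewrite step_at /= rab size_cat addn1.
have s2 : step (P0 ++ loop a b c ++ P1) (size (P0 ++ [:: Jeq a b (size c).+2 0]) + size c, r') =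
    (size P0, r').
  rewrite eP catA -size_cat step_at /= eqxx.
  by congr pair; rewrite !size_cat /=; lia.
rewrite -eP in e1 lt1.
have s3 : iter t.+2 (step (P0 ++ loop a b c ++ P1)) (size P0, r) = (size P0, r').
  by rewrite iterS iterSr s1 e1 s2.
have szl : size (loop a b c) = (size c).+2 by rewrite /= size_cat addn1.
exists (t' + t.+2), r2; split=> // [|u ut]; first by rewrite iterD s3.
have [lt|le] := ltnP u t.+2; last first.
  by rewrite -(subnK le) iterD s3 lt2 //; lia.
case: u lt {ut} => [|u] lt; first by rewrite szl /=; lia.
rewrite iterSr s1; move: lt; rewrite !ltnS leq_eqVlt => /predU1P[->|/lt1 lt].
  by rewrite szl e1 /= size_cat /=; lia.
by apply: leq_trans lt _; rewrite size_cat szl /=; lia.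
Qed.

Definition copy a b := Zero b :: loop a b [:: Inc b].

Lemma executes_copy a b r : a != b ->
  executes (copy a b) r (fun r' => r' b = r a /\ forall c, c != b -> r' c = r c).
Proof.
move=> ab; apply: (@executes_cat [:: Zero b]) (executes_zero _ _) _ => _ <-.
pose I k r' := r' b + k = r a /\ forall c, c != b -> r' c = r c.
apply: (executes_weaken (@executes_loop a b [:: Inc b] I (r a) _ _ _ _)) => [k r' [e1 e2]|r' [e1 e2]||r' [e1 e2]].
- split; first by rewrite e2 // -e1; lia.
  apply: executes_weaken (executes_inc _ _) _ => _ <-; split; first by rewrite /upd eqxx -e1; lia.
  by move=> c cb; rewrite /upd (negPf cb) e2.
- by rewrite e2 // -e1 addn0.
- by split=> [|c cb]; rewrite /upd ?eqxx // (negPf cb).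
- by split=> //; rewrite -e1 addn0.
Qed.

Definition icons a (ins : nat -> nat) i := if i is j.+1 then ins j else a.

(** Arguments are read from the registers [ins i], and the registers from [base] on are scratch
    space. For primitive recursion [base] holds the accumulator and [base.+1] the counter; for
    minimization [base] holds the candidate, [base.+1] the value there and [base.+2] the constant
    0. *)
Fixpoint compile n (f : recfun n) (ins : nat -> nat) (out base : nat) : seq instr :=
  match f with
  | RZero => [:: Zero out]
  | RSucc => copy (ins 0) out ++ [:: Inc out]
  | RProj _ i => copy (ins i) out
  | RComp m _ f g =>
      flatten [seq compile (g i) ins (base + i) (base + m) | i <- enum 'I_m]
      ++ compile f (addn base) out (base + m)
  | RPrec _ f g =>
      compile f (fun i => ins i.+1) base base.+3 ++ [:: Zero base.+1]
      ++ loop base.+1 (ins 0)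
        (compile g (icons base.+1 (icons base (fun i => ins i.+1))) base.+2 base.+3
         ++ copy base.+2 base ++ [:: Inc base.+1])
      ++ copy base out
  | RMu _ f =>
      [:: Zero base; Zero base.+2]
      ++ compile f (icons base ins) base.+1 base.+3
      ++ loop base.+1 base.+2 (Inc base :: compile f (icons base ins) base.+1 base.+3)
      ++ copy base out
  end.

Definition compile_post (r : nat -> nat) out base y (r' : nat -> nat) :=
  r' out = y /\ forall c, c < base -> c != out -> r' c = r c.

Lemma compileP n (f : recfun n) (x : n.-tuple nat) y ins out base r :
  computes f x y ->
  (forall i, i < n -> [/\ ins i < base, ins i != out & r (ins i) = nth 0 x i]) ->
  out < base -> executes (compile f ins out base) r (compile_post r out base y).
Proof.
elim: n / f x y ins out base r => /=.
- move=> x y ins out base r -> _ ob.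
  apply: executes_weaken (executes_zero _ _) _ => _ <-.
  by split=> [|c _ /negPf cb]; rewrite /upd ?eqxx // cb.
- move=> x y ins out base r -> /(_ 0 isT) [lt0 ne0 e0] ob.
  apply: executes_cat (executes_copy _ ne0) _ => r' [e1 e2].
  apply: executes_weaken (executes_inc _ _) _ => _ <-.
  split=> [|c _ cb]; first by rewrite /upd eqxx e1 e0 /thead (tnth_nth 0).
  by rewrite /upd (negPf cb) e2.
- move=> n i x y ins out base r -> /(_ _ (ltn_ord i)) [lt0 ne0 e0] ob.
  apply: executes_weaken (executes_copy _ ne0) _ => r' [e1 e2].
  by split=> [|c _ /e2//]; rewrite e1 e0 (tnth_nth 0).
- move=> m n f IHf g IHg x y ins out base r [z [gz fz]] insP ob.
  apply: (@executes_cat _ _ _ (fun r' => (forall i, i < m -> r' (base + i) = nth 0 z i)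
      /\ forall c, c < base -> r' c = r c)).
    (* Results already stored above [base] must survive the evaluation of the later arguments,
       whence a statement for any duplicate-free list of arguments. *)
    have gen (s : seq 'I_m) r0 : (forall c, c < base -> r0 c = r c) -> uniq s ->
      executes (flatten [seq compile (g i) ins (base + i) (base + m) | i <- s]) r0
        (fun r' => (forall i : 'I_m, i \in s -> r' (base + i) = tnth z i) /\
           forall c, c < base + m -> (forall i : 'I_m, i \in s -> c != base + i) -> r' c = r0 c).
      elim: s r0 => [|i s IHs] r0 r0P /=; first by move=> _; apply: executes_nil; split.
      case/andP=> nis us.
      have := IHg i x (tnth z i) ins (base + i) (base + m) r0 (gz i).
      move=> /(_ _ _)/executes_cat; apply.
      + move=> k /insP[lt ne e]; split; [lia | lia | by rewrite r0P].
      + by have := ltn_ord i; lia.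
      move=> r1 [e1 e2].
      apply: executes_weaken (IHs r1 _ us) _ => [c cb|r2 [h1 h2]].
        by rewrite e2 ?r0P //; lia.
      split=> [j|c cb ci].
        rewrite inE => /predU1P[->|/h1//].
        rewrite h2 ?e1 //; first by have := ltn_ord i; lia.
        by move=> k ks; apply: contraNneq nis => /addnI/val_inj->.
      rewrite h2 ?e2 // ?ci ?mem_head // => k ks; first by rewrite ci // inE ks orbT.
    apply: executes_weaken (gen (enum 'I_m) r _ (enum_uniq _)) _ => // r' [h1 h2].
    split=> [i im|c cb]; first by rewrite (h1 (Ordinal im)) ?mem_enum // (tnth_nth 0).
    by apply: h2 => [|i _]; lia.
  move=> r' [h1 h2]; apply: executes_weaken (IHf _ _ _ _ _ _ fz _ _) _.
  + by move=> i im; rewrite h1 //; split=> //; lia.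
  + by lia.
  by move=> r2 [k1 k2]; split=> // c cb co; rewrite k2 ?h2 //; lia.
- move=> n f IHf g IHg x y ins out base r [s [fs gs ->]] insP ob.
  have xS i : nth 0 (behead x) i = nth 0 x i.+1 by rewrite nth_behead.
  apply: executes_cat (IHf _ _ _ _ _ _ fs _ _) _; last 2 first.
  + by lia.
  + move=> r1 [e1 e2]; apply: (@executes_cat [:: _]) (executes_zero _ _) _ => _ <-.
    pose I k r' := [/\ r' base = s (thead x - k), r' base.+1 + k = thead x &
       forall c, c < base -> r' c = r c].
    have x0 : r (ins 0) = thead x by rewrite /thead (tnth_nth 0); case: (insP 0).
    apply: (executes_cat (@executes_loop _ _ _ I (thead x) _ _ _ _)).
    * move=> k r' [h1 h2 h3]; have [l0 n0 i0] := insP 0 isT.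
      split; first by rewrite (h3 _ l0) x0; lia.
      have lt : r' base.+1 < thead x by lia.
      have ga := gs _ lt.
      apply: executes_cat (IHg _ _ _ _ _ _ ga _ _) _ => [[|[|i]] im /=||r2 [k1 k2]].
      - by split=> //; lia.
      - by split=> //; [lia | lia | rewrite h1; congr s; lia].
      - by have [a b c] := insP i.+1 im; rewrite xS h3 //; split=> //; lia.
      - by lia.
      apply: executes_cat (executes_copy _ _) _ => [|r3 [l1 l2]]; first by lia.
      apply: executes_weaken (executes_inc _ _) _ => _ <-; split.
      - by rewrite /upd ifN ?l1 ?k1; [congr s; lia | lia].
      - by rewrite /upd eqxx l2 ?k2; lia.
      - by move=> c cb; rewrite /upd ifN ?l2 ?k2 ?h3 //; lia.
    * by move=> r' [h1 h2 h3]; have [l0 n0 i0] := insP 0 isT; rewrite (h3 _ l0) x0; lia.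
    * split; rewrite /upd; first by rewrite ifN ?subnn //; lia.
      - by rewrite eqxx.
      - by move=> c cb; rewrite ifN ?e2; lia.
    move=> r' [h1 h2 h3].
    apply: executes_weaken (executes_copy _ _) _ => [|r2 [k1 k2]]; first by lia.
    split; first by rewrite k1 h1 subn0.
    by move=> c cb co; rewrite k2 // h3.
  + by move=> i im; have [a b c] := insP i.+1 im; rewrite /= xS; split=> //; lia.
- move=> n f IHf x y ins out base r [fy fk] insP ob.
  apply: (@executes_cat [:: _]) (executes_zero _ _) _ => _ <-.
  apply: (@executes_cat [:: _]) (executes_zero _ _) _ => _ <-.
  pose val k v := computes f [tuple of k :: x] v.
  pose I k r' := [/\ r' base + k = y, val (r' base) (r' base.+1),
     r' base.+2 = 0 & forall c, c < base -> r' c = r c].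
  have body r' : r' base <= y -> (forall c, c < base -> r' c = r c) -> r' base.+2 = 0 ->
    executes (compile f (icons base ins) base.+1 base.+3) r' (fun r2 =>
      [/\ r2 base = r' base, val (r2 base) (r2 base.+1), r2 base.+2 = 0 &
        (r2 base < y -> 0 < r2 base.+1) /\ (r2 base = y -> r2 base.+1 = 0) /\ forall c, c < base -> r2 c = r c]).
    move=> lb h3 z0.
    have [v [fv lv]] : exists v, val (r' base) v /\ ((r' base < y -> 0 < v) /\ (r' base = y -> v = 0)).
      have [lt|ge] := ltnP (r' base) y; first by have [v ?] := fk _ lt; exists v.+1; split=> //; split=> //; lia.
      have e : r' base = y by apply/eqP; rewrite eqn_leq lb.
      by exists 0; rewrite e; split; [exact: fy | split=> //; lia].
    apply: executes_weaken (IHf _ _ _ _ _ _ fv _ _) _ => [[|i] im /=||r2 [k1 k2]].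
    + by split=> //; lia.
    + by have [a b c] := insP i im; rewrite h3 //; split=> //; lia.
    + by lia.
    have eb : r2 base = r' base by rewrite k2 //; lia.
    split=> //; rewrite ?eb ?k1 ?k2 //; try lia.
    by split; [case: lv | split; [case: lv | move=> c cb; rewrite k2 ?h3 //; lia]].
  apply: executes_cat (body _ _ _ _) _; rewrite /upd ?eqxx //.
  + by rewrite ifN //; lia.
  + by move=> c cb; rewrite !ifN //; lia.
  move=> r1 [e1 e2 e3 [e4 [e5 e6]]].
  have r1b : r1 base = 0 by rewrite e1 ifN //; lia.
  pose J k r' := I k r' /\ ((r' base < y -> 0 < r' base.+1) /\ (r' base = y -> r' base.+1 = 0)).
  set body_code := Inc base :: compile f (icons base ins) base.+1 base.+3.
  apply: (@executes_cat (loop base.+1 base.+2 body_code) (copy base out)).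
    apply: (@executes_loop _ _ _ J y).
  + move=> k r' [[h1 h2 h3 h4] [h5 h6]]; have gt0 : 0 < r' base.+1 by apply: h5; lia.
    split; first by lia.
    apply: (@executes_cat [:: _]) (executes_inc _ _) _ => _ <-.
    apply: executes_weaken (body _ _ _ _) _; rewrite /upd ?eqxx //.
    * by lia.
    * by move=> c cb; rewrite ifN ?h4 //; lia.
    * by rewrite ifN //; lia.
    move=> r2 [k1 k2 k3 [k4 [k5 k6]]].
    by split=> //; split=> //; rewrite k1; lia.
  + by move=> r' [[h1 h2 h3 h4] [h5 h6]]; rewrite h3 h6 //; lia.
  + by split=> //; split=> //; lia.
  move=> r' [[h1 h2 h3 h4] _].
  apply: executes_weaken (executes_copy _ _) _ => [|r2 [k1 k2]]; first by lia.
  by split=> [|c cb co]; [rewrite k1; lia | rewrite k2 ?h4].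
Qed.

(** * An undecidable set *)

(** Opcodes are nonzero: an opcode 0, which is what [code_nth] returns past the end, means that the
    program has halted. *)
Definition fields i :=
  match i with
  | Zero a => [:: 1; a; 0; 0; 0]
  | Inc a => [:: 2; a; 0; 0; 0]
  | Jeq a b f k => [:: 3; a; b; f; k]
  end.

Definition init k c : nat := if c == 0 then k else 0.

Definition prog_code P := CodeSeq.code (flatten [seq fields i | i <- P]).

Lemma prog_code_nth P p j : j < 5 ->
  code_nth (prog_code P) (5 * p + j) = if drop p P is i :: _ then nth 0 (fields i) j else 0.
Proof.
move=> j5; rewrite code_nth_code; elim: P p => [|i P IH] [|p] //=; rewrite ?nth_nil //.
  by rewrite nth_cat muln0 add0n; case: i => *; rewrite /= j5.
have sz : size (fields i) = 5 by case: i.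
by rewrite nth_cat sz ltnNge mulnS -addnA leq_addr /= addKn IH.
Qed.

(* A number [n] with [history n] encodes a program [k], a number of registers, a
   number of steps, and then all states of a halting run of [k] on input [k]. *)
Definition state n t i := code_nth n (3 + t * (code_nth n 1).+1 + i).
Definition field n p j := code_nth (code_nth n 0) (5 * p + j).

Opaque code_nth.
Arguments prog_code : simpl never.
Arguments init : simpl never.
Arguments state : simpl never.
Arguments field : simpl never.

Definition valid_step n t :=
  [&& 0 < field n (state n t 0) 0,
      field n (state n t 0) 1 < code_nth n 1, field n (state n t 0) 2 < code_nth n 1,
      state n t.+1 0 ==
        if (field n (state n t 0) 0 == 3) &&
           (state n t (field n (state n t 0) 1).+1 == state n t (field n (state n t 0) 2).+1)
        then state n t 0 + field n (state n t 0) 3 - field n (state n t 0) 4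
        else (state n t 0).+1 &
      all (fun c => state n t.+1 c.+1 ==
        if c == field n (state n t 0) 1 then
          if field n (state n t 0) 0 == 1 then 0
          else if field n (state n t 0) 0 == 2 then (state n t c.+1).+1
          else state n t c.+1
        else state n t c.+1) (iota 0 (code_nth n 1))].

Definition history n :=
  [&& state n 0 0 == 0,
      all (fun c => state n 0 c.+1 == if c == 0 then code_nth n 0 else 0)
          (iota 0 (code_nth n 1)),
      all (fun t => valid_step n t) (iota 0 (code_nth n 2)) &
      field n (state n (code_nth n 2) 0) 0 == 0].

Ltac rec1' :=
  match goal with
  | |- recursive _ (fun e => code_nth (@?a e) (@?b e)) =>
      apply: (recursive_code_nth (a := a) (i := b))
  | |- _ => rec1
  end.
Ltac rec' := repeat (cbv beta; rec1').

Lemma recursive_history : recursive 1 (fun e => history (e 0)).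
Proof. by rewrite /history /valid_step /state /field; rec'. Qed.

Definition halts_on_itself k := exists2 n, history n & code_nth n 0 = k.

Lemma history_sound P n : history n -> code_nth n 0 = prog_code P ->
  exists t, size P <= (iter t (step P) (0, init (prog_code P))).1.
Proof.
case/and4P=> /eqP s0 /allP r0 /allP st /eqP fin eP; exists (code_nth n 2).
suff run t : t <= code_nth n 2 -> let s := iter t (step P) (0, init (prog_code P)) in
    s.1 = state n t 0 /\ forall c, c < code_nth n 1 -> s.2 c = state n t c.+1.
  have [e _] := run _ (leqnn _); rewrite e leqNgt; apply: contra_eqN fin => lt.
  rewrite /field eP prog_code_nth // (drop_nth (Zero 0) lt).
  by case: (nth (Zero 0) _ _).
elim: t => [_|t IH lt] /=.
  by split=> // c cD; rewrite /init; apply/esym/eqP; rewrite -eP r0 // mem_iota.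
have [e1 e2] := IH (ltnW lt).
have /and5P[op aD bD /eqP pc /allP rg] : valid_step n t by rewrite st // mem_iota.
move: op aD bD pc rg; case: (iter t _ _) e1 e2 => p r; rewrite [(_, _).1]/= [(_, _).2]/= => -> e2.
rewrite /step /=; set q := state n t 0.
have fE j : j < 5 -> field n q j = if drop q P is i :: _ then nth 0 (fields i) j else 0.
  by move=> j5; rewrite /field eP prog_code_nth.
rewrite !fE //; case: (drop q P) => // i s _ aD bD -> rg.
split; first by case: i aD bD {rg} => //= a b f k aD bD; rewrite !e2.
move=> c cD; have := rg c; rewrite mem_iota => /(_ cD)/eqP ->.
by case: i aD bD {rg} => [a|a|a b f k] //= aD bD; rewrite /upd; case: eqP => [ec|_]; rewrite -?ec ?e2.
Qed.

(** Fields 1 and 2 hold the registers of an instruction, so a history needs to record only the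
    registers up to this bound. *)
Definition max_reg P := \max_(i <- P) maxn (nth 0 (fields i) 1) (nth 0 (fields i) 2).

Lemma max_regP P p i s : drop p P = i :: s ->
  nth 0 (fields i) 1 <= max_reg P /\ nth 0 (fields i) 2 <= max_reg P.
Proof.
move=> e; rewrite /max_reg -[P](cat_take_drop p) e big_cat big_cons /=.
by split; lia.
Qed.

Lemma history_complete P t : size P <= (iter t (step P) (0, init (prog_code P))).1 ->
  halts_on_itself (prog_code P).
Proof.
pose run t := iter t (step P) (0, init (prog_code P)).
move=> halt; have ex : exists t, size P <= (run t).1 by exists t.
(* Minimality of the halting time puts all earlier counters inside the program, as [valid_step]
   demands. *)
case: (ex_minnP ex) => S haltS minS {t halt ex}.
pose D := (max_reg P).+1.
pose cell x := if x %% D.+1 is c.+1 then (run (x %/ D.+1)).2 c else (run (x %/ D.+1)).1.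
pose n := CodeSeq.code (prog_code P :: D :: S :: mkseq cell (S.+1 * D.+1)).
have n0 : code_nth n 0 = prog_code P by rewrite code_nth_code.
have n1 : code_nth n 1 = D by rewrite code_nth_code.
have n2 : code_nth n 2 = S by rewrite code_nth_code.
have nE t i : t <= S -> i <= D -> state n t i = if i is c.+1 then (run t).2 c else (run t).1.
  move=> tS iD; rewrite /state n1 code_nth_code -addnA /= nth_mkseq; last by nia.
  by rewrite /cell modnMDl divnMDl // modn_small // divn_small // addn0.
have fE t j : t <= S -> j < 5 ->
    field n (state n t 0) j = if drop (run t).1 P is i :: _ then nth 0 (fields i) j else 0.
  by move=> tS j5; rewrite nE // /field n0 prog_code_nth.
exists n => //; apply/and4P; split.
- by rewrite nE.
- by apply/allP => c; rewrite n1 n0 mem_iota => cD; rewrite nE.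
- apply/allP => t; rewrite n2 mem_iota => /= tS.
  have tS' := ltnW tS.
  have lt : (run t).1 < size P.
    by rewrite ltnNge; apply: contraL tS => /minS; rewrite -leqNgt.
  case e : (drop (run t).1 P) => [|i s].
    by move: lt; rewrite -subn_gt0 -size_drop e.
  have F j : j < 5 -> field n (state n t 0) j = nth 0 (fields i) j.
    by move=> j5; rewrite fE // e.
  have [m1 m2] := max_regP e.
  have a1 : nth 0 (fields i) 1 < D by [].
  have b1 : nth 0 (fields i) 2 < D by [].
  have S0 : state n t 0 = (run t).1 by rewrite nE.
  have Sc c : c < D -> state n t c.+1 = (run t).2 c by move=> cD; rewrite nE.
  have rE : run t.+1 = exec i (run t) by rewrite -[LHS]/(step P (run t)) /step e.
  have S0' : state n t.+1 0 = (exec i (run t)).1 by rewrite nE // rE.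
  have Sc' c : c < D -> state n t.+1 c.+1 = (exec i (run t)).2 c.
    by move=> cD; rewrite nE // rE.
  rewrite /valid_step n1 !F // a1 b1 S0' S0 (Sc _ a1) (Sc _ b1).
  apply/and5P; split=> //; first by case: (i).
    by case: (i) (run t) => [a|a|a b f k] [p r].
  apply/allP => c; rewrite mem_iota add0n => /andP[_ cD]; rewrite Sc' // Sc //; apply/eqP.
  case: (i) (run t) => [a|a|a b f k] [p r] //=; rewrite /upd ?if_same //.
  by case: eqP => [->|_].
- rewrite n2 fE //; case e : (drop _ P) => [|i s] //.
  by have := congr1 size e; rewrite size_drop (eqP (_ : _ - _ == 0)) // subn_eq0.
Qed.

Lemma code_nth0 i : code_nth 0 i = 0.
Proof. by rewrite (code_nth_code [::]) nth_nil. Qed.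

(** Everything read from the number 0 is 0: an empty program that halts at once. This makes 0 a
    legitimate default value in [enum_halting]. *)
Lemma history0 : history 0.
Proof. by rewrite /history /state /field !code_nth0. Qed.

Definition enum_halting n := if history n then code_nth n 0 else 0.

Lemma enum_haltingP k : (exists n, enum_halting n = k) <-> halts_on_itself k.
Proof.
split=> [[n]|[n hn <-]]; last by exists n; rewrite /enum_halting hn.
rewrite /enum_halting; case: ifP => [hn <-|_ <-]; first by exists n.
by exists 0; rewrite ?history0 // code_nth0.
Qed.

(** Diagonal argument: [P] computes [d] at its own code, and its last instruction jumps to itself as
    long as the answer is 0, that is, if the answer claims that [P] halts. *)
Lemma halting_undecidable d : recursive 1 (fun e => d (e 0)) ->
  ~ forall k, (exists n, enum_halting n = k) <-> d k = 0.
Proof.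
case=> c cP H.
pose body := compile c (fun=> 0) 1 2.
pose P := body ++ [:: Zero 2; Jeq 1 2 0 0].
have ex : executes body (init (prog_code P)) (compile_post (init (prog_code P)) 1 2 (d (prog_code P))).
  by apply: compileP (cP [tuple prog_code P]) _ _ => // -[].
have [t [r [run [r1 _] _]]] := ex [::] [:: Zero 2; Jeq 1 2 0 0].
rewrite [size [::]]/= add0n [_ ++ _]/= -/P in run.
have run2 : iter t.+1 (step P) (0, init (prog_code P)) = ((size body).+1, upd r 2 0).
  by rewrite iterS run step_at.
have eP : P = (body ++ [:: Zero 2]) ++ [:: Jeq 1 2 0 0] by rewrite -catA.
have sb : (size body).+1 = size (body ++ [:: Zero 2]) by rewrite size_cat addn1.
have run3 : step P ((size body).+1, upd r 2 0) =
    (if d (prog_code P) == 0 then (size body).+1 else (size body).+2, upd r 2 0).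
  by rewrite {1}eP sb step_at -sb /= addn0 subn0 {1 2}/upd /= r1.
have szP : size P = (size body).+2 by rewrite size_cat addn2.
have {H}[H1 H2] := H (prog_code P).
have [d0|dn0] := eqVneq (d (prog_code P)) 0; last first.
  have := dn0; rewrite H1 ?eqxx //; apply/enum_haltingP.
  by apply: (@history_complete _ t.+2); rewrite iterS run2 run3 (negPf dn0) szP.
have [n hn en] : halts_on_itself (prog_code P) by apply/enum_haltingP/H2.
have [t'] := history_sound hn en; apply/negP; rewrite -ltnNge szP.
have [lt|ge] := ltnP t t'.
  have -> : iter t' (step P) (0, init (prog_code P)) = ((size body).+1, upd r 2 0) => //.
  rewrite -(subnK lt) iterD run2; elim: (_ - _) => // j IH.
  by rewrite iterS IH run3 d0.
rewrite ltnNge; apply/negP => le.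
have stay j : iter (j + t') (step P) (0, init (prog_code P)) = iter t' (step P) (0, init (prog_code P)).
  elim: j => // j IH; rewrite addSn iterS IH /step.
  by rewrite drop_oversize // szP.
have := stay (t.+1 - t'); rewrite subnK ?(leqW ge) // run2 => e.
by move: le; rewrite -e /= ltnn.
Qed.

(* The enumerated set contains all numbers that are not multiples of 4, which
   leaves room between the significant binary digits of the entropy below. *)
Lemma undecidable_enumeration : exists enum : nat -> nat,
  [/\ recursive 1 (fun e => enum (e 0)),
      forall j, ~~ (4 %| j) -> exists n, enum n = j &
      forall d, recursive 1 (fun e => d (e 0)) ->
        ~ forall k, (exists n, enum n = 4 * k) <-> d k = 0].
Proof.
(* Odd indices list the numbers that are not multiples of 4; where an odd index would give a
   multiple of 4, it repeats 1, which belongs to the set anyway. *)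
exists (fun n => if n %% 2 == 0 then 4 * enum_halting (n %/ 2)
                 else if (n %/ 2) %% 4 == 0 then 1 else n %/ 2); split.
- have rE : recursive 1 (fun e => enum_halting (e 0 %/ 2)).
    apply: (recursive_comp1 (F := enum_halting)); last by rec.
    apply: recursive_if; [exact: recursive_history | |]; first by rec'.
    exact: recursive_const.
  apply: recursive_if; first by rec.
    by apply: recursive_mul => //; rec.
  by rec.
- move=> j j4; exists (2 * j).+1.
  rewrite (_ : (2 * j).+1 %/ 2 = j); last by lia.
  by rewrite (_ : (2 * j).+1 %% 2 = 1) /= -?[_ == 0]/(4 %| j) ?(negPf j4) //; lia.
- move=> d rd H; apply: (halting_undecidable rd) => k; rewrite -H; split=> [[n <-]|[n]].
    by exists (2 * n); rewrite (_ : 2 * n %% 2 = 0) ?mulKn //; lia.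
  case: ifP => _ e; first by exists (n %/ 2); lia.
  by move: e; case: ifP => h e; [lia | move: h; rewrite e mulnC modnMl].
Qed.

(** * Space-time diagrams on an octant *)

Section Octant.
Variables (label : Type) (hor ver : rel label) (lok bot diag : pred label).

Definition octant_ok N (f : nat -> nat -> label) := forall m L, m < L <= N ->
  [/\ lok (f m L), bot (f m L) = (m == 0), diag (f m L) = (m.+1 == L),
      m.+1 < L -> hor (f m L) (f m.+1 L) & L < N -> ver (f m L) (f m L.+1)].
End Octant.

(** * The enumeration as an endless program *)

Definition main_body (c : recfun 1) := compile c (fun=> 0) 1 2.

(** Register 0 runs through the inputs. The instruction [Inc 0], at position [size (main_body c)],
    also marks the times when register 1 holds an enumerated value. *)
Definition main_program c := main_body c ++ [:: Inc 0; Jeq 0 0 0 (size (main_body c)).+1].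

Section MainProgram.
Variables (c : recfun 1) (enum : nat -> nat).
Hypothesis cP : forall n, computes c [tuple n] (enum n).
Let P := main_program c.
Let run t := iter t (step P) (0, fun=> 0).

Lemma main_program_cycle n r : r 0 = n -> exists t r1 r2,
  [/\ iter t (step P) (0, r) = (size (main_body c), r1), r1 1 = enum n,
      iter t.+2 (step P) (0, r) = (0, r2), r2 0 = n.+1 &
      forall u, u < t.+2 -> (iter u (step P) (0, r)).1 = size (main_body c) -> u = t].
Proof.
move=> r0.
have ex : executes (main_body c) r (compile_post r 1 2 (enum n)).
  by apply: (compileP (cP n)) => // -[].
have [t [r1 [run1 [r11 r1c] lt]]] := ex [::] [:: Inc 0; Jeq 0 0 0 (size (main_body c)).+1].
rewrite [[::] ++ _]/= -/P add0n [size [::]]/= in run1 lt.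
have P1 : P = (main_body c ++ [:: Inc 0]) ++ [:: Jeq 0 0 0 (size (main_body c)).+1].
  by rewrite -catA.
have s1 : step P (size (main_body c), r1) = ((size (main_body c)).+1, upd r1 0 (r1 0).+1).
  by rewrite /P step_at.
have s2 r' : step P ((size (main_body c)).+1, r') = (0, r').
  rewrite P1 (_ : (size (main_body c)).+1 = size (main_body c ++ [:: Inc 0])); last by rewrite size_cat addn1.
  by rewrite step_at /= eqxx addn0 subnn.
exists t, r1, (upd r1 0 (r1 0).+1); split=> //.
- by rewrite !iterS run1 s1 s2.
- by rewrite /upd eqxx r1c ?r0.
move=> u; rewrite ltnS leq_eqVlt => /predU1P[->|].
  by rewrite iterS run1 s1 /= => /eqP; rewrite -[X in _ == X]addn0 -addn1 eqn_add2l.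
rewrite ltnS leq_eqVlt => /predU1P[->//|/lt lt' e].
by rewrite e ltnn in lt'.
Qed.

Lemma main_program_loop m : exists t r, [/\ m <= t, run t = (0, r), r 0 = m &
  forall u, u < t -> (run u).1 = size (main_body c) -> exists n, (run u).2 1 = enum n].
Proof.
elim: m => [|m [t [r [le e r0 chk]]]]; first by exists 0, (fun=> 0).
have [t1 [r1 [r2 [e1 r11 e2 r20 chk1]]]] := main_program_cycle r0.
exists (t1.+2 + t), r2; rewrite /run iterD -/(run t) e; split=> //; first lia.
move=> u ut; have [/chk//|le'] := ltnP u t.
rewrite -(subnK le') iterD -/(run t) e => /chk1 -> //; last by lia.
by rewrite e1; exists m.
Qed.

Lemma main_program_enumerates n : exists t,
  (run t).1 = size (main_body c) /\ (run t).2 1 = enum n.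
Proof.
have [t [r [_ e r0 _]]] := main_program_loop n.
have [t1 [r1 [_ [e1 r11 _ _ _]]]] := main_program_cycle r0.
by exists (t1 + t); rewrite /run iterD -/(run t) e e1.
Qed.

Lemma main_program_enumerated t : (run t).1 = size (main_body c) ->
  exists n, (run t).2 1 = enum n.
Proof. by have [t' [r [le _ _ chk]]] := main_program_loop t.+1; apply: chk. Qed.

Lemma main_program_pc t : (run t).1 < size P.
Proof.
rewrite ltnNge; apply/negP => le.
(* A halted machine stays where it is, whereas the counter is back at 0 at arbitrarily late
   times. *)
have stay j : run (j + t) = run t.
  elim: j => // j IH; rewrite addSn /run iterS -/(run _) IH /step.
  by rewrite drop_oversize.
have [t' [r [le' e _ _]]] := main_program_loop t.
by move: le; rewrite -(stay (t' - t)) subnK // e /P /main_program size_cat addn2.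
Qed.
End MainProgram.

(** At time [L - 1] the register values are thus positions of row [L], which has [L] cells; this is
    why the octant is wide enough. *)
Lemma run_reg_le P t c : (iter t (step P) (0, fun=> 0)).2 c <= t.
Proof.
elim: t => //= t; case: (iter t _ _) => p r /= le; rewrite /step /=.
by case: (drop p P) => [|[a|a|a b f k] s] /=; rewrite /upd ?(leqW le) //; case: (c =P a) => [e|_]; rewrite -?e ?(leqW le).
Qed.

(** * Local rules for the run of the program *)

Section OctantLabels.
Variables (c : recfun 1) (enum : nat -> nat).
Hypothesis cP : forall n, computes c [tuple n] (enum n).
Let P := main_program c.
Let run t := iter t (step P) (0, fun=> 0).
Let D := (maxn 1 (max_reg P)).+1.

(* The label at position [m] of row [L] of the octant 0 <= m < L describes the
   machine after [L - 1] steps: the program counter, the result of the current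
   comparison, for each register [v] the bits [m < v] and [m <= v], the oracle
   bit at [m], and whether [m = 0] and whether [m + 1 = L]. *)
Definition label : finType :=
  ('I_(size P) * 'I_3 * ({ffun 'I_D -> bool} * {ffun 'I_D -> bool}) * (bool * bool * bool))%type.
Implicit Types x y : label.
Definition pc x : nat := x.1.1.1.
Definition cmp x : nat := x.1.1.2.
Definition above x a := if insub a is Some i then x.1.2.1 i else false.
Definition reach x a := if insub a is Some i then x.1.2.2 i else false.
Definition oracle x : bool := x.2.1.1.
Definition bot x : bool := x.2.1.2.
Definition diag x : bool := x.2.2.
Definition current x := nth (Zero 0) P (pc x).

(** The result of a comparison is guessed in [cmp] and checked at each position. At the position
    equal to a register value, [reach] holds and [above] does not, so the guesses 1 and 2 force
    strict inequalities. The second clause is the only link with the enumeration: at a check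
    instruction, the oracle bit at the position given by register 1 is false. *)
Definition label_ok x :=
  [&& match current x with
      | Jeq a b _ _ =>
        if cmp x == 0 then above x a == above x b
        else if cmp x == 1 then reach x a ==> above x b
        else reach x b ==> above x a
      | _ => true
      end,
      [&& pc x == size (main_body c), reach x 1 & ~~ above x 1] ==> ~~ oracle x,
      bot x ==> [forall i : 'I_D, reach x i],
      diag x ==> [forall i : 'I_D, ~~ above x i] &
      bot x && diag x ==> (pc x == 0)].

(** Along a row, [m + 1 <= v] iff [m < v]. Keeping both bits makes an increment local in [ver],
    since [m < v + 1] iff [m <= v]. *)
Definition hor x y := [&& pc x == pc y, cmp x == cmp y & [forall i : 'I_D, reach y i == above x i]].

Definition next_pc x :=
  if current x is Jeq _ _ f k then if cmp x == 0 then pc x + f - k else (pc x).+1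
  else (pc x).+1.

Definition next_above x a :=
  match current x with
  | Zero b => if a == b then false else above x a
  | Inc b => if a == b then reach x a else above x a
  | _ => above x a
  end.

Definition ver x y :=
  [&& pc y == next_pc x, oracle y == oracle x & [forall i : 'I_D, above y i == next_above x i]].

Definition reward x := diag x && oracle x.

Lemma run_next t : (run t.+1).1 = if nth (Zero 0) P (run t).1 is Jeq a b f k then
   if (run t).2 a == (run t).2 b then (run t).1 + f - k else (run t).1.+1 else (run t).1.+1.
Proof.
rewrite [run _]/= -/(run t) /step (drop_nth (Zero 0)); last exact: main_program_pc cP t.
by case: (run t) => p r /=; case: (nth _ _ _).
Qed.

Lemma run_next_reg t a : (run t.+1).2 a = match nth (Zero 0) P (run t).1 with
  | Zero b => if a == b then 0 else (run t).2 a
  | Inc b => if a == b then ((run t).2 a).+1 else (run t).2 a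
  | _ => (run t).2 a end.
Proof.
rewrite [run _]/= -/(run t) /step (drop_nth (Zero 0)); last exact: main_program_pc cP t.
by case: (run t) => p r /=; case: (nth _ _ _) => //= b; rewrite /upd; case: eqP => // ->.
Qed.

Lemma instr_reg_lt p : p < size P ->
  match nth (Zero 0) P p with
  | Zero a => a < D | Inc a => a < D | Jeq a b _ _ => (a < D) && (b < D) end.
Proof.
move=> lt; have := max_regP (drop_nth (Zero 0) lt).
by case: (nth (Zero 0) P p) => [a|a|a b f k] /= [h1 h2]; rewrite ?ltnS; lia.
Qed.

Lemma forallD (Q : nat -> bool) : reflect (forall a, a < D -> Q a) [forall i : 'I_D, Q i].
Proof.
apply: (iffP forallP) => [h a aD|h i]; [exact: h (Ordinal aD) | exact: h].
Qed.

Lemma hor_reach x y a : hor x y -> a < D -> reach y a = above x a.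
Proof. by case/and3P=> _ _ /(forallD (fun a => reach y a == above x a)) h /h/eqP. Qed.

Lemma ver_above x y a : ver x y -> a < D -> above y a = next_above x a.
Proof. by case/and3P=> _ _ /(forallD (fun a => above y a == next_above x a)) h /h/eqP. Qed.

(** Induction on the time. The only new cell without a cell below it is the last one of its row;
    there [diag] makes all bits [above] false, as it should be by [run_reg_le]. *)
Lemma octant_ok_run N f : octant_ok hor ver label_ok bot diag N f -> forall L, 0 < L <= N -> forall m, m < L ->
  [/\ pc (f m L) = (run L.-1).1,
      forall a, a < D -> above (f m L) a = (m < (run L.-1).2 a),
      forall a, a < D -> reach (f m L) a = (m <= (run L.-1).2 a) &
      oracle (f m L) = oracle (f m m.+1)].
Proof.
move=> ok; case=> // L /=; elim: L => [|L IH] LN m mL.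
  have m0 : m = 0 by lia.
  have [/and5P[_ _ hb hd hbd] eb ed _ _] := ok m 1 ltac:(lia).
  subst m; split=> //.
  - by move: hbd; rewrite eb ed /= => /eqP.
  - by move=> a aD; move: hd; rewrite ed => /(forallD (fun a => ~~ above _ a)) /(_ a aD) /negPf.
  - by move=> a aD; move: hb; rewrite eb => /(forallD (reach _)) /(_ a aD).
have {}IH := IH ltac:(lia).
have ok1 m' : m' <= L -> _ := fun le => ok m' L.+1 ltac:(lia).
have cmp0 m' : m' <= L -> cmp (f m' L.+1) = cmp (f 0 L.+1).
  elim: m' => // m' IHm le; have [_ _ _ /(_ ltac:(lia)) h _] := ok1 m' ltac:(lia).
  by rewrite -IHm ?(ltnW le) //; case/and3P: h => _ /eqP->.
have cmpE m' a b g k : m' <= L -> current (f m' L.+1) = Jeq a b g k ->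
    (cmp (f m' L.+1) == 0) = ((run L).2 a == (run L).2 b).
  move=> le cur; have [pcE _ _ _] := IH m' le.
  have /andP[aD bD] : (a < D) && (b < D).
    have := instr_reg_lt (main_program_pc cP L).
    by move: cur; rewrite /current pcE => ->.
  have test m2 : m2 <= L -> if cmp (f 0 L.+1) == 0 then (m2 < (run L).2 a) == (m2 < (run L).2 b)
       else if cmp (f 0 L.+1) == 1 then (m2 <= (run L).2 a) ==> (m2 < (run L).2 b)
       else (m2 <= (run L).2 b) ==> (m2 < (run L).2 a).
    move=> le2; have [/and5P[h _ _ _ _] _ _ _ _] := ok1 m2 le2.
    have [pcE2 ab re _] := IH m2 le2.
    move: h; have -> : current (f m2 L.+1) = Jeq a b g k by rewrite /current pcE2 -pcE.
    by rewrite cmp0 // !ab // !re.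
  (* Both register values are positions of this row, and the test at these two positions decides the
     comparison. *)
  have := run_reg_le P L a; have := run_reg_le P L b; rewrite -/(run L) => lb la.
  rewrite cmp0 //; move: (test _ la) (test _ lb).
  by case: eqP => _; [|case: eqP => _]; rewrite ?ltnn ?leqnn; case: ltngtP => //; lia.
have vers m' : m' <= L -> ver (f m' L.+1) (f m' L.+2).
  by move=> le; have [_ _ _ _ h] := ok1 m' le; apply: h; lia.
have pcS m' : m' <= L -> pc (f m' L.+2) = (run L.+1).1.
  move=> le; have /and3P[/eqP-> _ _] := vers m' le.
  rewrite run_next /next_pc; have [pcE _ _ _] := IH m' le.
  case cur: (current _) => [a|a|a b g k]; move: (cur); rewrite /current pcE => -> //.
  by rewrite (cmpE _ _ _ _ _ le cur).
have ok2 m' : m' < L.+2 -> _ := fun le => ok m' L.+2 ltac:(lia).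
have abS m' a : m' < L.+2 -> a < D -> above (f m' L.+2) a = (m' < (run L.+1).2 a).
  rewrite ltnS leq_eqVlt => /predU1P[->|le] aD.
    have [/and5P[_ _ _ hd _] _ ed _ _] := ok2 L.+1 ltac:(lia).
    move: hd; rewrite ed eqxx => /(forallD (fun a => ~~ above _ a)) /(_ a aD) /negPf->.
    by have := run_reg_le P L.+1 a; rewrite -/(run _) ltnNge => ->.
  have [pcE ab re _] := IH m' le; rewrite (ver_above (vers m' le)) // /next_above run_next_reg.
  rewrite /current pcE; case: (nth _ _ _) => [b|b|b b' g k]; rewrite ?ab ?re //.
    by case: (a == b).
  by case: (a == b); rewrite ?ltnS.
split.
- move: mL; rewrite ltnS leq_eqVlt => /predU1P[->|le]; last exact: pcS.
  have [_ _ _ /(_ ltac:(lia)) /and3P[/eqP<- _ _] _] := ok2 L ltac:(lia).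
  exact: pcS.
- by move=> a; apply: abS.
- move=> a aD; case: m mL => [|m] mL.
    have [/and5P[_ _ hb _ _] eb _ _ _] := ok2 0 isT.
    by move: hb; rewrite eb => /(forallD (reach _)) /(_ a aD).
  have [_ _ _ h _] := ok2 m (ltnW mL).
  by rewrite (hor_reach (h mL)) // abS // ltnW.
- move: mL; rewrite ltnS leq_eqVlt => /predU1P[->//|le].
  by have /and3P[_ /eqP-> _] := vers m le; have [_ _ _ ->] := IH m le.
Qed.

(** The oracle bit at a position is constant in time. Being false when [enum n] is found, it is
    false already on the diagonal, where the reward is read. *)
Lemma octant_sound n : exists N, enum n < N /\
  forall f, octant_ok hor ver label_ok bot diag N f -> ~~ reward (f (enum n) (enum n).+1).
Proof.
have [t [e r1]] := main_program_enumerates cP n.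
have lt : enum n <= t by rewrite -r1; apply: run_reg_le.
exists t.+1; split=> // f ok.
have [pcE ab re orE] := octant_ok_run ok (L := t.+1) ltac:(lia) (m := enum n) ltac:(lia).
have [/and5P[_ h _ _ _] _ _ _ _] := ok (enum n) t.+1 ltac:(lia).
have D1 : 1 < D by rewrite ltnS leq_maxl.
move: h; rewrite pcE -/(run t) e eqxx ab // re // r1 leqnn ltnn orE => /negPf.
by rewrite /reward => ->; rewrite andbF.
Qed.

Section Complete.
Variable g : nat -> bool.
Hypothesis gP : forall n, ~~ g (enum n).

Definition comparison t : nat :=
  if nth (Zero 0) P (run t).1 is Jeq a b _ _ then
    if (run t).2 a == (run t).2 b then 0 else if (run t).2 a < (run t).2 b then 1 else 2
  else 0.

Definition run_label m L : label :=
  let t := L.-1 in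
  (Ordinal (main_program_pc cP t), inord (comparison t),
   ([ffun i : 'I_D => m < (run t).2 i], [ffun i : 'I_D => m <= (run t).2 i]),
   (g m, m == 0, m.+1 == L)).

Lemma run_label_cmp m L : cmp (run_label m L) = comparison L.-1.
Proof.
rewrite /cmp /= inordK // /comparison; case: (nth _ _ _) => // a b _ _.
by do 2!case: ifP => // _.
Qed.

Lemma run_label_above m L a : a < D -> above (run_label m L) a = (m < (run L.-1).2 a).
Proof. by move=> aD; rewrite /above insubT /= ffunE. Qed.

Lemma run_label_reach m L a : a < D -> reach (run_label m L) a = (m <= (run L.-1).2 a).
Proof. by move=> aD; rewrite /reach insubT /= ffunE. Qed.

Lemma run_label_ok m L : m < L -> label_ok (run_label m L).
Proof.
case: L => // L mL; have D1 : 1 < D by rewrite ltnS leq_maxl.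
apply/and5P; split.
- rewrite /current run_label_cmp /pc /= /comparison.
  have := instr_reg_lt (main_program_pc cP L).
  case: (nth _ _ _) => // a b _ _ /andP[aD bD].
  rewrite !run_label_above // !run_label_reach //.
  case: ((run L).2 a =P (run L).2 b) => [->|ne]; first by rewrite eqxx.
  by case: ltnP => ab /=; apply/implyP; lia.
- rewrite run_label_above // run_label_reach // -leqNgt -eqn_leq.
  apply/implyP => /andP[/eqP e /eqP ->].
  by have [n eg] := main_program_enumerated cP (e : (run L).1 = _); rewrite /oracle /= -/(run L) eg.
- apply/implyP => /eqP m0; apply/(forallD (reach _)) => a aD.
  by rewrite run_label_reach // m0.
- apply/implyP => /eqP[mE]; apply/(forallD (fun a => ~~ above _ a)) => a aD.
  by rewrite run_label_above // mE /= -leqNgt run_reg_le.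
- by apply/implyP => /andP[/eqP m0 /eqP[mE]]; rewrite /pc /= -mE m0.
Qed.

Lemma run_label_hor m L : hor (run_label m L) (run_label m.+1 L).
Proof.
apply/and3P; split; rewrite ?run_label_cmp ?eqxx //.
apply/(forallD (fun a => reach (run_label m.+1 L) a == above (run_label m L) a)) => a aD.
by rewrite run_label_above // run_label_reach.
Qed.

Lemma run_label_ver m L : 0 < L -> ver (run_label m L) (run_label m L.+1).
Proof.
case: L => // L _; apply/and3P; split=> //.
  have -> : pc (run_label m L.+2) = (run L.+1).1 by [].
  rewrite run_next /next_pc run_label_cmp /current /pc /= /comparison.
  rewrite -/(run L); case: (nth _ _ _) => // a b f k.
  by case: ((run L).2 a == (run L).2 b) => //; case: (_ < _).
apply/(forallD (fun a => above (run_label m L.+2) a == next_above (run_label m L.+1) a)) => a aD.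
rewrite run_label_above // (run_next_reg L a : (run L.+2.-1).2 a = _) /next_above /current /pc /=.
by case: (nth _ _ _) => [b|b|b b' f k]; rewrite run_label_above // ?run_label_reach //; case: (a == b).
Qed.

Lemma octant_complete N : octant_ok hor ver label_ok bot diag N run_label.
Proof.
move=> m L /andP[mL LN]; split=> // [|_|_]; first exact: run_label_ok.
  exact: run_label_hor.
by apply: run_label_ver; lia.
Qed.

Lemma run_label_reward k : reward (run_label k k.+1) = g k.
Proof. by rewrite /reward /diag /= eqxx. Qed.
End Complete.
End OctantLabels.

(** * Hierarchical tilings *)

Section Tiles.
Variables (label : finType) (hor ver : rel label) (lok bot diag reward : pred label).

(** On the edge following column [i] of a row [j] of level [l], [hR] and [hp] are meant to be the
    binary digits [l] and [l + 1] of [i], and [hq] the digit [l + 1] of [j] (see [hedge]). [hpay]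
    remembers the bit [vU] of the last vertical line that was crossed and is reset by a cross. *)
Definition hcolor : finType := (bool * bool * bool * bool)%type.
Definition hR (c : hcolor) := c.1.1.1.
Definition hp (c : hcolor) := c.1.1.2.
Definition hq (c : hcolor) := c.1.2.
Definition hpay (c : hcolor) := c.2.

(** The same for columns, with a richer payload taken from the last row where the column met a cross
    or a [Hori] tile: its label, and in the second case its bits [hR] and [hp]. *)
Definition vcolor : finType := (bool * bool * bool * (label * bool * bool))%type.
Definition vU (c : vcolor) := c.1.1.1.
Definition vp (c : vcolor) := c.1.1.2.
Definition vq (c : vcolor) := c.1.2.
Definition vlab (c : vcolor) := c.2.1.1.
Definition vR (c : vcolor) := c.2.1.2.
Definition vpp (c : vcolor) := c.2.2.

Definition tile : finType :=
  (option bool * hcolor * vcolor * (label * label) * (bool * bool * bool))%type.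
Definition kind (t : tile) := t.1.1.1.1.
Definition west (t : tile) := t.1.1.1.2.
Definition south (t : tile) := t.1.1.2.
Definition rowlab (t : tile) := t.1.2.1.
Definition collab (t : tile) := t.1.2.2.
Definition xpar (t : tile) := t.2.1.1.
Definition ypar (t : tile) := t.2.1.2.
Definition bit (t : tile) := t.2.2.

Definition Cross : option bool := None.
Definition Vert := Some true.
Definition Hori := Some false.

Definition east t : hcolor :=
  match kind t with
  | None => (true, hp (west t), hq (west t), false)
  | Some true => (false, ~~ hp (west t), hq (west t), vU (south t))
  | Some false => west t
  end.

Definition north t : vcolor :=
  match kind t with
  | None => (true, hp (west t), hq (west t), (rowlab t, false, false))
  | Some true => south t
  | Some false => (false, vp (south t), ~~ vq (south t), (rowlab t, hR (west t), hp (west t)))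
  end.

(** The payloads describe the tile to the south-west. They select the two transfers of labels:
    equality where a row and a column have the same type [(m, L)], and [ver] where the row has type
    [(m, L)] and the column type [(m, L + 1)]; see [label_eq] and [label_ver]. *)
Definition cross_ok t :=
  [&& ~~ hR (west t), ~~ vU (south t), hp (west t) == vp (south t), hq (west t) == vq (south t),
      diag (rowlab t) == hq (west t),
      hpay (west t) && vR (south t) ==> (rowlab t == collab t) &
      [&& hpay (west t), ~~ vR (south t) & vpp (south t)] ==> ver (rowlab t) (collab t)].

(** The conditional clauses of [vert_ok] and [hori_ok] produce the self-similarity: next to a cross
    of parity false they prescribe the state of the line passing through, which constrains the kind
    of the neighbouring tile of the next lattice. *)
Definition vert_ok t := hR (west t) && (~~ hp (west t) ==> (vU (south t) == hq (west t))).

Definition hori_ok t :=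
  vU (south t) &&
  (~~ vq (south t) ==> (hR (west t) == vp (south t)) && hor (vlab (south t)) (rowlab t)).

Definition tile_ok t :=
  [&& match kind t with None => cross_ok t | Some true => vert_ok t | Some false => hori_ok t end,
      xpar t && ypar t ==> (kind t == Cross), ~~ xpar t && ypar t ==> (kind t == Vert),
      xpar t && ~~ ypar t ==> (kind t == Hori), bot (rowlab t) == ypar t, lok (rowlab t) &
      bit t ==> reward (rowlab t)].

Definition hmatch t t' :=
  [&& west t' == east t, rowlab t' == rowlab t, xpar t' == ~~ xpar t & ypar t' == ypar t].
Definition vmatch t t' :=
  [&& south t' == north t, collab t' == collab t, xpar t' == xpar t & ypar t' == ~~ ypar t].

Lemma cross_okP t : tile_ok t -> kind t = Cross -> cross_ok t.
Proof. by case/andP=> + _ e; rewrite e. Qed.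
Lemma vert_okP t : tile_ok t -> kind t = Vert -> vert_ok t.
Proof. by case/andP=> + _ e; rewrite e. Qed.
Lemma hori_okP t : tile_ok t -> kind t = Hori -> hori_ok t.
Proof. by case/andP=> + _ e; rewrite e. Qed.

Definition oddz (b : int) := odd `|b|%N.

Lemma oddzS (b : int) : oddz (b + 1)%R = ~~ oddz b.
Proof. by rewrite /oddz; lia. Qed.

Lemma oddzB1 (b : int) : oddz (b - 1)%R = ~~ oddz b.
Proof. by rewrite /oddz; lia. Qed.

Lemma oddz_double (b : int) : oddz (2 * b)%R = false.
Proof. by rewrite /oddz; lia. Qed.

Lemma oddzP (b : int) : exists b' : int, b = (2 * b' + oddz b)%R.
Proof. exists (b %/ 2)%Z; rewrite /oddz; lia. Qed.

Lemma int_step_ind (Q : int -> Prop) : Q 0%R -> (forall b, Q b <-> Q (b + 1)%R) -> forall b, Q b.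
Proof.
move=> Q0 QS; elim/int_ind => // n; first by rewrite QS -addn1 PoszD.
by rewrite (QS (- n.+1%:Z)%R); congr Q; lia.
Qed.

(* [X] is a sublattice of a tiling, in the coordinates where the odd lines are
   the lines of lowest level, restricted to the columns up to [W]. *)
Definition lattice (X : nat -> int -> tile) W :=
  [/\ forall a b, a <= W -> tile_ok (X a b),
      forall a b, a < W -> west (X a.+1 b) = east (X a b),
      forall a b, a <= W -> south (X a (b + 1)%R) = north (X a b) &
      forall a b, a <= W -> [/\ odd a -> oddz b -> kind (X a b) = Cross,
         ~~ odd a -> oddz b -> kind (X a b) = Vert &
         odd a -> ~~ oddz b -> kind (X a b) = Hori]].

(** Crosses carry the parities of their indices in the next lattice. The rules fix these bits only
    up to a global flip in each direction, which a shift of the origin removes. *)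
Definition oriented (X : nat -> int -> tile) W := forall a b, a.*2.+1 <= W ->
  hp (west (X a.*2.+1 (2 * b + 1)%R)) = odd a /\
  hq (west (X a.*2.+1 (2 * b + 1)%R)) = oddz b.

(** * From one lattice to the next *)

Section Step.
Variables (X : nat -> int -> tile) (W : nat).
Hypothesis latX : lattice X W.

Lemma lattice_ok a b : a <= W -> tile_ok (X a b).
Proof. by case: latX => h _ _ _; apply: h. Qed.
Lemma lattice_west a b : a < W -> west (X a.+1 b) = east (X a b).
Proof. by case: latX => _ h _ _; apply: h. Qed.
Lemma lattice_south a b : a <= W -> south (X a (b + 1)%R) = north (X a b).
Proof. by case: latX => _ _ h _; apply: h. Qed.

Lemma lattice_cross a b : odd a -> oddz b -> a <= W ->
  kind (X a b) = Cross /\ cross_ok (X a b).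
Proof.
case: latX => ok _ _ h oa ob aW; have [h1 _ _] := h a b aW.
by have e := h1 oa ob; split=> //; apply: cross_okP (ok _ _ aW) e.
Qed.

Lemma lattice_vert a b : ~~ odd a -> oddz b -> a <= W ->
  kind (X a b) = Vert /\ vert_ok (X a b).
Proof.
case: latX => ok _ _ h oa ob aW; have [_ h1 _] := h a b aW.
by have e := h1 oa ob; split=> //; apply: vert_okP (ok _ _ aW) e.
Qed.

Lemma lattice_hori a b : odd a -> ~~ oddz b -> a <= W ->
  kind (X a b) = Hori /\ hori_ok (X a b).
Proof.
case: latX => ok _ _ h oa ob aW; have [_ _ h1] := h a b aW.
by have e := h1 oa ob; split=> //; apply: hori_okP (ok _ _ aW) e.
Qed.

Lemma cross_east a b : odd a -> oddz b -> a < W -> 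
  west (X a.+1 b) = (true, hp (west (X a b)), hq (west (X a b)), false).
Proof.
move=> oa ob aW; rewrite lattice_west // /east.
by have [-> _] := lattice_cross oa ob (ltnW aW).
Qed.

Lemma vert_east a b : ~~ odd a -> oddz b -> a < W ->
  west (X a.+1 b) = (false, ~~ hp (west (X a b)), hq (west (X a b)), vU (south (X a b))).
Proof.
move=> oa ob aW; rewrite lattice_west // /east.
by have [-> _] := lattice_vert oa ob (ltnW aW).
Qed.

Lemma hori_east a b : odd a -> ~~ oddz b -> a < W -> west (X a.+1 b) = west (X a b).
Proof.
move=> oa ob aW; rewrite lattice_west // /east.
by have [-> _] := lattice_hori oa ob (ltnW aW).
Qed.

Lemma cross_north a b : odd a -> oddz b -> a <= W ->
  south (X a (b + 1)%R) =
    (true, hp (west (X a b)), hq (west (X a b)), (rowlab (X a b), false, false)).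
Proof.
move=> oa ob aW; rewrite lattice_south // /north.
by have [-> _] := lattice_cross oa ob aW.
Qed.

Lemma vert_north a b : ~~ odd a -> oddz b -> a <= W -> south (X a (b + 1)%R) = south (X a b).
Proof.
move=> oa ob aW; rewrite lattice_south // /north.
by have [-> _] := lattice_vert oa ob aW.
Qed.

Lemma hori_north a b : odd a -> ~~ oddz b -> a <= W ->
  south (X a (b + 1)%R) = (false, vp (south (X a b)), ~~ vq (south (X a b)),
    (rowlab (X a b), hR (west (X a b)), hp (west (X a b)))).
Proof.
move=> oa ob aW; rewrite lattice_south // /north.
by have [-> _] := lattice_hori oa ob aW.
Qed.

Lemma orientation_up a b : odd a -> oddz b -> a <= W ->
  hp (west (X a (b + 1 + 1)%R)) = hp (west (X a b)) /\
  hq (west (X a (b + 1 + 1)%R)) = ~~ hq (west (X a b)).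
Proof.
move=> oa ob aW; have ob1 : ~~ oddz (b + 1)%R by rewrite oddzS ob.
have ob2 : oddz (b + 1 + 1)%R by rewrite oddzS ob1.
have [_ /and5P[_ _ /eqP-> /eqP-> _]] := lattice_cross oa ob2 aW.
by rewrite hori_north // /vp /vq /= cross_north.
Qed.

Lemma orientation_right a b : odd a -> oddz b -> a.+2 <= W ->
  hp (west (X a.+2 b)) = ~~ hp (west (X a b)) /\ hq (west (X a.+2 b)) = hq (west (X a b)).
Proof.
move=> oa ob aW; rewrite vert_east ?negbK //= /hp /hq /=.
by rewrite cross_east // ltnW.
Qed.

Let P0 : bool := hp (west (X 1 1%R)).
Let Q0 : bool := hq (west (X 1 1%R)).

Lemma orientation a b : a.*2.+1 <= W ->
  hp (west (X a.*2.+1 (2 * b + 1)%R)) = P0 (+) odd a /\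
  hq (west (X a.*2.+1 (2 * b + 1)%R)) = Q0 (+) oddz b.
Proof.
have ob c : oddz (2 * c + 1)%R by rewrite oddzS oddz_double.
have oa c : odd c.*2.+1 by rewrite /= odd_double.
elim: a b => [|a IH] b aW; last first.
  have [-> ->] := orientation_right (oa a) (ob b) aW.
  by have [-> ->] := IH b ltac:(lia); split=> //=; rewrite addbN.
elim/int_step_ind: b => [|b]; first by rewrite /= !addbF.
have -> : (2 * (b + 1) + 1 = 2 * b + 1 + 1 + 1)%R by lia.
have [-> ->] := orientation_up (a := 1) isT (ob b) aW.
by rewrite oddzS addbN; split=> -[-> h]; split=> //; [rewrite h | exact: negb_inj].
Qed.

(** Shifts that make the parity bits agree with the coordinates. Without a flip, the horizontal
    shift is 2 and not 0, so that the column to the left of the new origin exists. *)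
Let e := if P0 then 1 else 2.
Let f : int := if Q0 then 1%R else 0%R.
Let Y (a : nat) (b : int) := X (a.*2 + e.*2) (2 * b + 2 * f)%R.

Lemma sublattice_cross_west a b : a.*2.+1 + e.*2 <= W ->
  hp (west (X (a.*2.+1 + e.*2) (2 * b + 2 * f + 1)%R)) = odd a /\
  hq (west (X (a.*2.+1 + e.*2) (2 * b + 2 * f + 1)%R)) = oddz b.
Proof.
have -> : a.*2.+1 + e.*2 = (a + e).*2.+1 by rewrite doubleD addSn.
move=> aW; have -> : (2 * b + 2 * f + 1 = 2 * (b + f) + 1)%R by lia.
have [-> ->] := orientation (b + f)%R aW; rewrite oddD; split.
  by rewrite /e; case: (P0) => /=; rewrite ?addbT ?addbF ?negbK.
by rewrite /f; case: (Q0); rewrite /= ?oddzS ?negbK ?addr0.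
Qed.

(** The crosses around an even-even tile give the parities, and the clauses of the four adjacent
    tiles then tell whether [hR] and [vU] hold on its sides. A [Vert] tile needs [hR] to its west
    and a [Hori] tile needs [vU] to its south, so two false bits leave only a cross; moreover only
    [Vert] switches [hR] off and only [Hori] switches [vU] off. *)
Lemma sublattice_lattice W' : W'.*2.+1 + e.*2 <= W -> lattice Y W'.
Proof.
move=> W'W.
have oe c : odd (c.*2 + e.*2) = false by rewrite -doubleD odd_double.
have oz c : oddz (2 * c + 2 * f)%R = false by rewrite -mulrDr oddz_double.
have oe1 c : odd (c.*2 + e.*2).+1 by rewrite /= oe.
have oz1 c : oddz (2 * c + 2 * f + 1)%R by rewrite oddzS oz.
split.
- by move=> a b aW; apply: lattice_ok; lia.
- move=> a b aW; rewrite /Y doubleS !addSn.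
  by rewrite hori_east ?oe1 ?oz //; [rewrite lattice_west //; lia | lia].
- move=> a b aW; rewrite /Y (_ : 2 * (b + 1) + 2 * f = 2 * b + 2 * f + 1 + 1)%R; last by lia.
  by rewrite vert_north ?oe ?oz1 //; [rewrite lattice_south //; lia | lia].
move=> a b aW; rewrite /Y.
set a0 := a.*2 + e.*2; set b0 := (2 * b + 2 * f)%R.
have e0 : 0 < e by rewrite /e; case: (P0).
have a00 : a0 = a0.-1.+1 by rewrite prednK // /a0 addn_gt0 !double_gt0 e0 orbT.
have oa : odd a0.-1 by rewrite -[odd _]negbK -/(odd a0.-1.+1) -a00 oe.
have b0E : b0 = (b0 - 1 + 1)%R by rewrite subrK.
have ob : oddz (b0 - 1)%R by rewrite -[oddz _]negbK -oddzS -b0E oz.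
have [pSW qSW] : hp (west (X a0.-1 (b0 - 1)%R)) = ~~ odd a /\
                 hq (west (X a0.-1 (b0 - 1)%R)) = ~~ oddz b.
  have -> : a0.-1 = (a + e).-1.*2.+1 by rewrite /a0; lia.
  have -> : (b0 - 1 = 2 * (b + f - 1) + 1)%R by rewrite /b0; lia.
  have [-> ->] := orientation (b + f - 1)%R (a := (a + e).-1) ltac:(lia); split.
    by rewrite /e; case: (P0); rewrite ?addn1 ?addn2 /= ?addbT ?addbF.
  by rewrite /f; case: (Q0); rewrite /= ?addrK // addr0 oddzB1.
have a0W : a0 < W by clear - aW W'W; rewrite /a0; lia.
have a1W : a0.-1 < W by rewrite (leq_ltn_trans (leq_pred _)).
have sHL : south (X a0.-1 b0) = (true, ~~ odd a, ~~ oddz b, (rowlab (X a0.-1 (b0 - 1)%R), false, false)).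
  by rewrite {1}b0E cross_north // ?pSW ?qSW // ltnW.
have [_ /andP[_ hHL]] : kind (X a0.-1 b0) = Hori /\ hori_ok (X a0.-1 b0).
  by apply: lattice_hori; rewrite ?oz // ltnW.
have wX : west (X a0 b0) = west (X a0.-1 b0).
  by rewrite {1}a00 hori_east ?oz.
have sVB : south (X a0 b0) = south (X a0 (b0 - 1)%R).
  by rewrite {1}b0E vert_north ?oe // ltnW.
have [_ /andP[_ hVB]] : kind (X a0 (b0 - 1)%R) = Vert /\ vert_ok (X a0 (b0 - 1)%R).
  by apply: lattice_vert; rewrite ?oe // ltnW.
have wVB : west (X a0 (b0 - 1)%R) = (true, ~~ odd a, ~~ oddz b, false).
  by rewrite {1}a00 cross_east // ?pSW ?qSW.
have okX : tile_ok (X a0 b0) by apply: lattice_ok; apply: ltnW.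
rewrite sHL in hHL; rewrite wVB in hVB.
split=> [oda odb|oda odb|oda odb].
- move: hHL hVB; rewrite oda odb /vq /hp /hq /= => /andP[/eqP hHL _] /eqP hVB.
  case k : (kind _) => [[]|] //.
    by case/andP: (vert_okP okX k); rewrite wX hHL.
  by case/andP: (hori_okP okX k); rewrite sVB hVB.
- have [pSE qSE] : hp (west (X a0.+1 (b0 - 1)%R)) = ~~ hp (west (X a0.-1 (b0 - 1)%R)) /\
      hq (west (X a0.+1 (b0 - 1)%R)) = hq (west (X a0.-1 (b0 - 1)%R)).
    by rewrite {1 3}a00; apply: orientation_right; rewrite // -a00.
  have oa1 : odd a0.+1 by rewrite /= oe.
  have sHR : south (X a0.+1 b0) = (true, odd a, ~~ oddz b, (rowlab (X a0.+1 (b0 - 1)%R), false, false)).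
    by rewrite {1}b0E cross_north // ?pSE ?qSE ?pSW ?qSW ?negbK.
  have [_ /andP[_]] : kind (X a0.+1 b0) = Hori /\ hori_ok (X a0.+1 b0).
    by apply: lattice_hori; rewrite ?oz.
  move: hHL; rewrite sHR lattice_west // (negPf oda) odb /vq /= => /andP[/eqP hHL _] /andP[/eqP hHR _].
  by move: hHR; rewrite /east; case k : (kind _) => [[]|] //; rewrite ?wX ?hHL.
- have [pNW qNW] : hp (west (X a0.-1 (b0 + 1)%R)) = hp (west (X a0.-1 (b0 - 1)%R)) /\
      hq (west (X a0.-1 (b0 + 1)%R)) = ~~ hq (west (X a0.-1 (b0 - 1)%R)).
    by rewrite {1 3}b0E; apply: orientation_up; rewrite // ltnW.
  have ob1 : oddz (b0 + 1)%R by rewrite oddzS oz.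
  have wVT : west (X a0 (b0 + 1)%R) = (true, ~~ odd a, oddz b, false).
    by rewrite {1}a00 cross_east // ?pNW ?qNW ?pSW ?qSW ?negbK.
  have [_ /andP[_]] : kind (X a0 (b0 + 1)%R) = Vert /\ vert_ok (X a0 (b0 + 1)%R).
    by apply: lattice_vert; rewrite ?oe // ltnW.
  move: hVB; rewrite wVT lattice_south ?(ltnW a0W) // oda (negPf odb) /hp /hq /= => /eqP hVB /eqP.
  by rewrite /north; case k : (kind _) => [[]|] //; rewrite sVB hVB.
Qed.
End Step.

Lemma lattice_ext X X' W : (forall a b, X a b = X' a b) -> lattice X W -> lattice X' W.
Proof.
by move=> e [h1 h2 h3 h4]; split=> a b aW; rewrite -!e; [apply: h1 | apply: h2 | apply: h3 | apply: h4].
Qed.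

Lemma oriented_ext X X' W : (forall a b, X a b = X' a b) -> oriented X W -> oriented X' W.
Proof. by move=> e h a b aW; rewrite -!e; apply: h. Qed.

Lemma lattice_shift X W W' c (d : int) : lattice X W -> W' + c.*2 <= W ->
  lattice (fun a b => X (a + c.*2) (b + 2 * d)%R) W'.
Proof.
move=> [h1 h2 h3 h4] le; split=> a b aW.
- by apply: h1; lia.
- by rewrite addSn; apply: h2; lia.
- by rewrite addrAC; apply: h3; lia.
have [k1 k2 k3] := h4 (a + c.*2) (b + 2 * d)%R ltac:(lia).
have oe : odd (a + c.*2) = odd a by rewrite oddD odd_double addbF.
have oz : oddz (b + 2 * d)%R = oddz b by rewrite /oddz; lia.
by rewrite oe oz in k1 k2 k3.
Qed.

Lemma oriented_shift X W W' c (d : int) : oriented X W -> W' + c.*2.*2 <= W ->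
  oriented (fun a b => X (a + c.*2.*2) (b + 4 * d)%R) W'.
Proof.
move=> h le a b aW.
have -> : a.*2.+1 + c.*2.*2 = (a + c.*2).*2.+1 by rewrite doubleD addSn.
have -> : (2 * b + 1 + 4 * d = 2 * (b + 2 * d) + 1)%R by lia.
have [-> ->] := h (a + c.*2) (b + 2 * d)%R ltac:(lia).
by split; [rewrite oddD odd_double addbF | rewrite /oddz; lia].
Qed.

(** * The hierarchy in an arbitrary tiling of a strip *)

Section Tiling.
Variables (y : nat -> int -> tile) (w : nat).
Hypothesis y_ok : forall i j, i <= w -> tile_ok (y i j).
Hypothesis y_hor : forall i j, i < w -> hmatch (y i j) (y i.+1 j).
Hypothesis y_ver : forall i j, i <= w -> vmatch (y i j) (y i (j + 1)%R).

Definition view ox (oy : int) l (a : nat) (b : int) := y (ox + 2 ^ l * a) (oy + (2 ^ l)%:Z * b)%R.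

Lemma rowlabE i j : i <= w -> rowlab (y i j) = rowlab (y 0 j).
Proof. by elim: i => // i IH lt; case/and4P: (y_hor j lt) => _ /eqP-> _ _; rewrite IH // ltnW. Qed.

Lemma collabE i j : i <= w -> collab (y i j) = collab (y i 0%R).
Proof.
move=> iw; elim/int_step_ind: j => // j.
by case/and4P: (y_ver j iw) => _ /eqP-> _ _.
Qed.

Lemma yparE i j : i <= w -> ypar (y i j) = ypar (y 0 0%R) (+) oddz j.
Proof.
move=> iw; have -> : ypar (y i j) = ypar (y 0 j).
  by elim: i iw => // i IH lt; case/and4P: (y_hor j lt) => _ _ _ /eqP->; rewrite IH // ltnW.
elim/int_step_ind: j => [|j]; first by rewrite addbF.
case/and4P: (y_ver j (leq0n w)) => _ _ _ /eqP->; rewrite oddzS addbN.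
by split=> [->//|]; exact: negb_inj.
Qed.

Lemma xparE i j : i <= w -> xpar (y i j) = xpar (y 0 0%R) (+) odd i.
Proof.
move=> iw; have -> : xpar (y i j) = xpar (y i 0%R).
  by elim/int_step_ind: j => // j; case/and4P: (y_ver j iw) => _ _ /eqP-> _.
elim: i iw => [|i IH] lt; first by rewrite addbF.
by case/and4P: (y_hor 0%R lt) => _ _ /eqP-> _; rewrite IH ?(ltnW lt) //= addbN.
Qed.

(** Passing from level [l] to the next moves the origin by at most [4 * 2 ^ l], whence the bound
    [2 ^ N.+2]. The margin of [2 ^ N] columns is lost because the kind of a tile is also inferred
    from its right neighbours. *)
Definition hierarchical N ox oy :=
  [/\ ox <= 2 ^ N.+2 /\ (0 <= oy <= (2 ^ N.+2)%:Z)%R,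
      forall i j, i <= w -> ypar (y i (oy + j)%R) = oddz j,
      forall W, ox + 2 ^ N * W + 2 ^ N <= w -> lattice (view ox oy N) W &
      forall l W, l < N -> ox + 2 ^ l * W + 2 ^ N <= w ->
        lattice (view ox oy l) W /\ oriented (view ox oy l) W].

Lemma hierarchical0 : exists ox oy, hierarchical 0 ox oy.
Proof.
pose ox := nat_of_bool (xpar (y 0 0%R)).
pose oy : int := (ypar (y 0 0%R) : nat)%:Z.
exists ox, oy.
have yp i j : i <= w -> ypar (y i (oy + j)%R) = oddz j.
  by move=> iw; rewrite yparE // /oy; case: (ypar _); rewrite /= ?add0r // addrC oddzS negbK.
split=> // [|W WW]; first by rewrite /ox /oy; case: (xpar _); case: (ypar _).
have xp a b : a <= W -> xpar (view ox oy 0 a b) = odd a.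
  move=> aW; rewrite /view xparE; last by move: WW; rewrite !expn0 !mul1n; lia.
  by rewrite mul1n oddD /ox; case: (xpar _); rewrite //= negbK.
have bd a : a <= W -> ox + 2 ^ 0 * a + 1 <= w by move: WW; rewrite !expn0 !mul1n; lia.
have yp' a b : a <= W -> ypar (view ox oy 0 a b) = oddz b.
  by move=> aW; rewrite /view mul1r yp //; have := bd _ aW; lia.
have vS b a : view ox oy 0 a (b + 1)%R = y (ox + 2 ^ 0 * a) (oy + (2 ^ 0)%:Z * b + 1)%R.
  by rewrite /view !mul1r addrA.
have hS a b : view ox oy 0 a.+1 b = y (ox + 2 ^ 0 * a).+1 (oy + (2 ^ 0)%:Z * b)%R.
  by rewrite /view !mul1n addnS.
split=> a b aW.
- by apply: y_ok; have := bd _ aW; lia.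
- have lt : ox + 2 ^ 0 * a < w by have := bd _ (ltnW aW); lia.
  by rewrite hS; case/and4P: (y_hor (oy + (2 ^ 0)%:Z * b)%R lt) => /eqP-> _ _ _.
- have lt : ox + 2 ^ 0 * a <= w by have := bd _ aW; lia.
  by rewrite vS; case/and4P: (y_ver (oy + (2 ^ 0)%:Z * b)%R lt) => /eqP-> _ _ _.
have : tile_ok (view ox oy 0 a b) by apply: y_ok; have := bd _ aW; lia.
case/and5P=> _ h1 h2 h3 _; move: h1 h2 h3; rewrite xp // yp' //.
by split=> oa ob; [move: h1 | move: h2 | move: h3]; rewrite oa ob => /eqP.
Qed.

Lemma hierarchicalS N ox oy : hierarchical N ox oy -> exists ox oy, hierarchical N.+1 ox oy.
Proof.
move=> [[oxN oyN] yp latN lat].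
pose e := if hp (west (view ox oy N 1 1%R)) then 1 else 2.
pose f : int := if hq (west (view ox oy N 1 1%R)) then 1%R else 0%R.
have e2 : e <= 2 by rewrite /e; case: ifP.
have vE l : l <= N ->
    forall a b, view (ox + 2 ^ N * e.*2) (oy + (2 ^ N)%:Z * (2 * f))%R l a b =
    view ox oy l (a + 2 ^ (N - l) * e.*2) (b + (2 ^ (N - l))%:Z * (2 * f))%R.
  move=> lN a b; rewrite /view -(subnKC lN) addKn expnD.
  by congr y; lia.
exists (ox + 2 ^ N * e.*2), (oy + (2 ^ N)%:Z * (2 * f))%R; split.
- split; first by move: oxN; rewrite !expnS; nia.
  by move: oyN; rewrite /f !expnS; case: ifP => _; lia.
- by move=> i j iw; rewrite -addrA yp // /oddz; lia.
- move=> W WW.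
  have latW : lattice (view ox oy N) (W.*2.+1 + e.*2).
    by apply: latN; move: WW; rewrite expnS; nia.
  apply: lattice_ext (sublattice_lattice latW (leqnn _)) => a b.
  rewrite /view -/e -/f expnS; congr y; lia.
move=> l W; rewrite ltnS leq_eqVlt => /predU1P[->|lN] WW.
  have latW : lattice (view ox oy N) (W + e.*2).
    by apply: latN; move: WW; rewrite expnS; nia.
  split.
    apply: lattice_ext (lattice_shift f latW (leqnn _)) => a b.
    by rewrite vE // subnn !mul1n !mul1r.
  move=> a b aW; rewrite vE // subnn !mul1n mul1r.
  have -> : (2 * b + 1 + 2 * f = 2 * b + 2 * f + 1)%R by lia.
  by apply: (sublattice_cross_west latW); lia.
have eN : 2 ^ (N - l) = (2 ^ (N - l).-1).*2.
  by rewrite -mul2n -expnS prednK // subn_gt0.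
have bd : ox + 2 ^ l * (W + 2 ^ (N - l) * e.*2) + 2 ^ N <= w.
  move: WW; rewrite mulnDr mulnA -expnD subnKC ?(ltnW lN) // expnS; lia.
have [latW oriW] := lat l _ lN bd.
split.
  apply: lattice_ext (lattice_shift (c := 2 ^ (N - l) * e) ((2 ^ (N - l))%:Z * f)%R latW _) => [a b|].
    by rewrite vE ?(ltnW lN) //; congr view; lia.
  by lia.
apply: oriented_ext (oriented_shift (c := (2 ^ (N - l).-1) * e) ((2 ^ (N - l).-1)%:Z * f)%R oriW _) => [a b|].
  by rewrite vE ?(ltnW lN) // eN; congr view; lia.
by rewrite eN; lia.
Qed.

Lemma hierarchicalP N : exists ox oy, hierarchical N ox oy.
Proof.
elim: N => [|N [ox [oy]]]; [exact: hierarchical0 | exact: hierarchicalS].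
Qed.
(** The lines from [t] to the cross [C] turn through exactly one [Vert] and one [Hori] tile, which
    write the bits of [t] into the payloads tested at [C]. *)
Lemma lattice_crossing X W a (b : int) : lattice X W -> a.*2.+1 <= W ->
  let C := X a.*2.+1 (2 * b + 1)%R in let t := X a.*2 (2 * b)%R in
  [/\ vU (north t) -> hR (east t) -> rowlab C = collab C,
      vU (north t) -> ~~ hR (east t) -> hp (east t) -> ver (rowlab C) (collab C) &
      diag (rowlab C) = hq (west C)].
Proof.
move=> latX aW C t.
have oa : odd a.*2.+1 by rewrite /= odd_double.
have ob : oddz (2 * b + 1)%R by rewrite oddzS oddz_double.
have [_ /and5P[_ _ _ _ /and3P[/eqP dg r1 r2]]] := lattice_cross latX oa ob aW.
have sC : south C = (false, vp (south (X a.*2.+1 (2 * b)%R)), ~~ vq (south (X a.*2.+1 (2 * b)%R)),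
    (rowlab (X a.*2.+1 (2 * b)%R), hR (east t), hp (east t))).
  by rewrite (hori_north latX) ?oddz_double // (lattice_west latX).
have wC : hpay (west C) = vU (north t).
  by rewrite (vert_east latX) ?odd_double // (lattice_south latX) // ltnW.
move: r1 r2; rewrite -/C wC sC /vR /vpp /=.
move=> r1 r2; split=> // [u r|u r p].
  by apply/eqP; apply: (implyP r1); rewrite u r.
by apply: (implyP r2); rewrite u r p.
Qed.

Lemma lattice_climb X W (b : int) : lattice X W -> 0 < W ->
  ~~ hq (west (X 1 (2 * b + 1)%R)) ->
  hor (rowlab (X 1 (2 * b + 1)%R)) (rowlab (X 1 (2 * b + 2)%R)).
Proof.
move=> latX W0 q0.
have ob : oddz (2 * b + 1)%R by rewrite oddzS oddz_double.
have e2 : (2 * b + 2 = 2 * b + 1 + 1)%R by lia.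
have oz : ~~ oddz (2 * b + 2)%R by rewrite e2 oddzS ob.
have [_ /andP[_]] := lattice_hori latX (a := 1) isT oz W0.
have sE := cross_north latX (a := 1) isT ob W0; rewrite -e2 in sE.
by rewrite sE /vq /= q0 => /andP[_].
Qed.

Let rl j := rowlab (y 0 j).
Let cl i := collab (y i 0%R).

(** * Labels of the rows of each type *)

Section Rows.
Variables (N ox : nat) (oy : int).
Hypothesis hier : hierarchical N ox oy.
(** Of these [8 * 2 ^ N] columns, 4 parts allow for the origin, 3 for the tiles inspected below and
    1 for the margin of [hierarchical]. *)
Hypothesis wN : 2 ^ N.+3 <= w.

Lemma hierarchical_lattice l W : l < N -> 2 ^ l * W <= 3 * 2 ^ N ->
  lattice (view ox oy l) W /\ oriented (view ox oy l) W.
Proof.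
case: hier => -[oxN _] _ _ lat lN le; apply: lat => //.
by move: oxN wN; rewrite !expnS; lia.
Qed.

Lemma view_le l W : l < N -> 2 ^ l * W <= 3 * 2 ^ N -> ox + 2 ^ l * W <= w.
Proof. by case: hier => -[oxN _] _ _ _ lN le; move: oxN wN; rewrite !expnS; lia. Qed.

Lemma view_rowlab l a b : l < N -> 2 ^ l * a <= 3 * 2 ^ N ->
  rowlab (view ox oy l a b) = rl (oy + (2 ^ l)%:Z * b)%R.
Proof. by move=> lN le; rewrite /view rowlabE ?view_le. Qed.

Lemma view_collab l a b : l < N -> 2 ^ l * a <= 3 * 2 ^ N ->
  collab (view ox oy l a b) = cl (ox + 2 ^ l * a).
Proof. by move=> lN le; rewrite /view collabE ?view_le. Qed.

(** Representatives of type [(m, L)]: counted from the corner, the lowest binary digit 1 is at [m]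
    and the next one at [L]. *)
Definition rowpos m L (b : int) : int := (oy + (2 ^ L)%:Z * (2 * b + 1) + (2 ^ m)%:Z)%R.
Definition colpos m L a := ox + 2 ^ L * a.*2.+1 + 2 ^ m.

Lemma rowpos_view m L b : m < L ->
  rowpos m L b = (oy + (2 ^ m)%:Z * (2 * ((2 ^ (L - m).-1)%:Z * (2 * b + 1)) + 1))%R.
Proof.
move=> mL; rewrite /rowpos -{1}(subnKC (ltnW mL)) expnD.
have -> : 2 ^ (L - m) = 2 * 2 ^ (L - m).-1 by rewrite -expnS prednK // subn_gt0.
by lia.
Qed.

Lemma colpos_view m L a : m < L ->
  colpos m L a = ox + 2 ^ m * (2 ^ (L - m).-1 * a.*2.+1).*2.+1.
Proof.
move=> mL; rewrite /colpos -{1}(subnKC (ltnW mL)) expnD.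
have -> : 2 ^ (L - m) = 2 * 2 ^ (L - m).-1 by rewrite -expnS prednK // subn_gt0.
by lia.
Qed.

Lemma view_corner m L a b : m < L ->
  view ox oy m (2 ^ (L - m).-1 * a).*2 (2 * ((2 ^ (L - m).-1)%:Z * b))%R = view ox oy L a b.
Proof.
move=> mL; rewrite /view -{3 4}(subnKC (ltnW mL)) expnD.
have -> : 2 ^ (L - m) = 2 * 2 ^ (L - m).-1 by rewrite -expnS prednK // subn_gt0.
by congr y; lia.
Qed.

(** South-west of the crossing of the row and the column there is a cross of level [L], whose
    outgoing sides carry [vU] and [hR]. All rows of type [(m, L)] are compared with one column,
    hence they have the same label. *)
Lemma label_eq m L b : m < L < N -> rl (rowpos m L b) = cl (colpos m L 0).
Proof.
move=> /andP[mL LN]; have mN := ltn_trans mL LN.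
set a := 2 ^ (L - m).-1 * 0.*2.+1; set b' := ((2 ^ (L - m).-1)%:Z * (2 * b + 1))%R.
have aE : 2 ^ m * a.*2.+1 <= 3 * 2 ^ N.
  have := colpos_view 0 mL; rewrite /colpos -/a; have := leq_pexp2l (ltn0Sn 1) (ltnW LN).
  by have := leq_pexp2l (ltn0Sn 1) (ltnW mN); lia.
have [lat _] := hierarchical_lattice mN aE.
have LE : 2 ^ L * 2 <= 3 * 2 ^ N by have := leq_pexp2l (ltn0Sn 1) (ltnW LN); lia.
have [latL _] := hierarchical_lattice LN LE.
have [h _ _] := lattice_crossing b' lat (leqnn _).
rewrite rowpos_view // colpos_view // -/a -/b'.
rewrite view_rowlab // view_collab // in h; apply: h.
all: have ob : oddz (2 * b + 1)%R by rewrite oddzS oddz_double.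
all: have [e _] := lattice_cross latL (a := 1) isT ob isT.
all: by rewrite view_corner // /north /east e.
Qed.

Lemma label_rowpos m L b : m < L < N -> rl (rowpos m L b) = rl (rowpos m L 0%R).
Proof. by move=> mLN; rewrite !label_eq. Qed.

Lemma label_ver m L : m < L -> L.+1 < N -> ver (rl (rowpos m L 0%R)) (rl (rowpos m L.+1 0%R)).
Proof.
move=> mL LN; have mN : m < N by lia.
(* The corner is now a [Vert] tile on a row of level [L]. The row with [b = 1] has parity bit [hq]
   true, so the clause of [vert_ok] yields the bit [vU] that triggers [ver]. *)
rewrite -(label_rowpos 1%R); last by rewrite mL ltnW.
rewrite (label_eq (L := L.+1)); last by lia.
have mL1 : m < L.+1 by lia.
set a := 2 ^ (L.+1 - m).-1 * 0.*2.+1; set b' := ((2 ^ (L - m).-1)%:Z * (2 * 1 + 1))%R.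
have aE : 2 ^ m * a.*2.+1 <= 3 * 2 ^ N.
  have := colpos_view 0 mL1; rewrite /colpos -/a; have := leq_pexp2l (ltn0Sn 1) (ltnW LN).
  by have := leq_pexp2l (ltn0Sn 1) (ltnW mN); lia.
have [lat _] := hierarchical_lattice mN aE.
have LE : 2 ^ L * 3 <= 3 * 2 ^ N by have := leq_pexp2l (ltn0Sn 1) (ltnW (ltnW LN)); lia.
have [latL oriL] := hierarchical_lattice (ltnW LN) LE.
have [_ h _] := lattice_crossing b' lat (leqnn _).
rewrite rowpos_view // colpos_view // -/a -/b'.
rewrite view_rowlab // view_collab // in h.
have -> : a.*2 = (2 ^ (L - m).-1 * 2).*2.
  by rewrite /a muln1 subSn ?(ltnW mL) //= -{1}[L - m]prednK ?subn_gt0 // expnSr.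
rewrite (_ : a.*2 = (2 ^ (L - m).-1 * 2).*2) in h; last first.
  by rewrite /a muln1 subSn ?(ltnW mL) //= -{1}[L - m]prednK ?subn_gt0 // expnSr.
rewrite view_corner // in h.
have ob : oddz (2 * 1 + 1)%R by [].
have wX := cross_east latL (a := 1) isT ob isT.
have [/= p1 q1] := oriL 0 1%R isT.
rewrite p1 q1 /= in wX.
have [e /andP[_ ]] := lattice_vert latL (a := 2) isT ob isT.
rewrite wX /= => /eqP uX.
by apply: h; rewrite /north /east e // wX.
Qed.

Lemma label_diag (m : nat) (b : int) : m < N -> diag (rl (oy + (2 ^ m)%:Z * (2 * b + 1))%R) = oddz b.
Proof.
move=> mN; have le : 2 ^ m * 0.*2.+1 <= 3 * 2 ^ N by have := leq_pexp2l (ltn0Sn 1) (ltnW mN); lia.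
have [lat ori] := hierarchical_lattice mN le.
have [_ _] := lattice_crossing b lat (leqnn _).
by have [_ ->] := ori 0 b isT; rewrite view_rowlab.
Qed.

(** For even [b] these two rows have levels [m] and [m + 1] and the same next level. The label
    climbs along a column of level [m] from its cross to the [Hori] tile above. *)
Lemma label_hor (m : nat) (b : int) : m < N -> ~~ oddz b ->
  hor (rl (oy + (2 ^ m)%:Z * (2 * b + 1))%R) (rl (oy + (2 ^ m)%:Z * (2 * b + 2))%R).
Proof.
move=> mN ob; have le : 2 ^ m * 1 <= 3 * 2 ^ N by have := leq_pexp2l (ltn0Sn 1) (ltnW mN); lia.
have [lat ori] := hierarchical_lattice mN le.
have := lattice_climb (b := b) lat isT; have [_ ->] := ori 0 b isT.
by rewrite !view_rowlab //; apply.
Qed.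

Lemma label_base j : bot (rl (oy + j)%R) = oddz j /\ lok (rl (oy + j)%R).
Proof.
have [_ yp _ _] := hier.
case/and5P: (y_ok (oy + j)%R (leq0n w)) => _ _ _ _ /and3P[/eqP bE lE _].
by rewrite /rl bE yp.
Qed.

Lemma hierarchical_octant : octant_ok hor ver lok bot diag N.-1 (fun m L => rl (rowpos m L 0%R)).
Proof.
move=> m L /andP[mL LN]; have LN' : L < N by lia.
have [bE lE] := label_base ((2 ^ L)%:Z * (2 * 0 + 1) + (2 ^ m)%:Z)%R.
rewrite addrA -/(rowpos m L 0) in bE lE.
have e1 : (L - m).-1 = 0 <-> m.+1 = L by lia.
split=> //.
- rewrite bE /oddz; case: m mL {bE lE e1} => [|m] mL.
    by case: L mL {LN LN'} => // L _; rewrite expnS; lia.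
  by case: L mL {LN LN'} => // L _; rewrite !expnS; lia.
- rewrite rowpos_view // label_diag; last by lia.
  rewrite mulr0 add0r mulr1 /oddz /=; case: eqP => [/e1->//|ne].
  by rewrite -[_.-1]prednK ?expnS; lia.
- move=> mL1.
  have eE : rowpos m.+1 L 0 = (oy + (2 ^ m)%:Z * (2 * ((2 ^ (L - m).-1)%:Z * (2 * 0 + 1)) + 2))%R.
    have := rowpos_view 0%R mL; rewrite /rowpos expnS; lia.
  rewrite eE rowpos_view //; apply: label_hor; first by lia.
  rewrite mulr0 add0r mulr1 /oddz /=.
  by have -> : (L - m).-1 = (L - m).-1.-1.+1 by [lia]; rewrite expnS; lia.
- by move=> LN1; apply: label_ver => //; lia.
Qed.
Lemma binary_split n (j : int) :
  (exists m b, m < n /\ j = ((2 ^ m)%:Z * (2 * b + 1))%R) \/ exists b, j = ((2 ^ n)%:Z * b)%R.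
Proof.
elim: n => [|n [[m [b [mn ->]]]|[b ->]]]; first by right; exists j; rewrite mul1r.
  by left; exists m, b; split=> //; apply: ltnW.
have [b' ->] := oddzP b; case: (oddz b).
  by left; exists n, b'; rewrite ltnSn.
by right; exists b'; rewrite expnS; lia.
Qed.

(** Used for rewarded rows: they have a known type [(k, k + 1)], except at multiples of [2 ^ N.-1],
    where the first [N] levels do not give the type. *)
Lemma hierarchical_diag j : diag (rl j) ->
  (exists k b, k.+1 < N /\ j = (oy + (2 ^ k)%:Z * (4 * b + 3))%R /\ rl j = rl (rowpos k k.+1 0%R))
  \/ exists b, j = (oy + (2 ^ N.-1)%:Z * b)%R.
Proof.
have -> : j = (oy + (j - oy))%R by lia.
have [[m [b [mN ->]]]|[b ->]] := binary_split N.-1 (j - oy)%R; last by right; exists b.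
rewrite label_diag ?(leq_trans mN) ?leq_pred // => ob; left.
have [b' bE] := oddzP b; rewrite ob in bE.
have pE : (oy + (2 ^ m)%:Z * (2 * b + 1) = rowpos m m.+1 b')%R.
  by rewrite /rowpos bE expnS /=; lia.
exists m, b'; split; first by lia.
split; first by rewrite bE /=; lia.
by rewrite pE label_rowpos // ltnSn; lia.
Qed.

(* The kind of a tile at distance [(x, z)] from a corner of the hierarchy, with
   a junk value when both distances are multiples of [2 ^ n]. *)
Fixpoint hierarchy_kind n (x : nat) (z : int) : option bool :=
  if n is n'.+1 then
    if odd x then if oddz z then Cross else Hori
    else if oddz z then Vert else hierarchy_kind n' x./2 (z %/ 2)%Z
  else None.

Lemma hierarchical_kind (x : nat) (z : int) : ox + x + 2 ^ N <= w ->
  kind (y (ox + x) (oy + z)%R) = hierarchy_kind N x z \/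
  exists a b, x = 2 ^ N * a /\ z = ((2 ^ N)%:Z * b)%R.
Proof.
move=> xN; have [_ _ _ lats] := hier.
suff : forall n l a b, l + n = N -> ox + 2 ^ l * a + 2 ^ N <= w ->
    kind (view ox oy l a b) = hierarchy_kind n a b \/
    exists a' b', a = 2 ^ n * a' /\ b = ((2 ^ n)%:Z * b')%R.
  by move/(_ N 0 x z (add0n N)); rewrite /view expn0 !mul1n mul1r; apply.
elim=> [|n IH] l a b lN le; first by right; exists a, b; rewrite mul1n mul1r.
have [lat _] := lats l a ltac:(lia) le.
rewrite /=; case: (boolP (odd a)) => oa; case: (boolP (oddz b)) => ob.
- by left; case: (lattice_cross lat oa ob (leqnn _)).
- by left; case: (lattice_hori lat oa ob (leqnn _)).
- by left; case: (lattice_vert lat oa ob (leqnn _)).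
have aE : a = a./2.*2 by rewrite -[LHS]odd_double_half (negPf oa).
have bE : b = (2 * (b %/ 2)%Z)%R by have := ob; rewrite /oddz; lia.
have vE : view ox oy l a b = view ox oy l.+1 a./2 (b %/ 2)%Z.
  by rewrite /view {1}aE {1}bE expnS; congr y; lia.
rewrite vE; case: (IH l.+1 a./2 (b %/ 2)%Z); [by rewrite addSnnS | | by left |].
  by rewrite expnS; lia.
move=> [a' [b' [ea eb]]]; right; exists a', b'.
by rewrite aE ea bE eb expnS; split; lia.
Qed.
End Rows.
End Tiling.
End Tiles.

(** * A hierarchical tiling from the 2-adic odometer *)

(* If [u] is 3 times a 2-adic integer, [odometer_tail u] is 3 times the integer
   obtained by deleting its lowest binary digit. *)
Definition odometer_tail (u : int) : int := if oddz u then ((u - 3) %/ 2)%Z else (u %/ 2)%Z.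
Definition odometer_digit u l := oddz (iter l odometer_tail u).

Lemma odometer_tail_mod3 u : (u %% 3)%Z != 0%R -> (odometer_tail u %% 3)%Z != 0%R.
Proof. by rewrite /odometer_tail /oddz; case: ifP => h; lia. Qed.

(** As long as the digits are 0, the tail halves [u], which is nonzero since 3 does not divide
    it. *)
Lemma odometer_has_digit u : (u %% 3)%Z != 0%R -> exists l, odometer_digit u l.
Proof.
have [n] := ubnP `|u|%N; elim: n u => // n IH u un u3.
case: (boolP (oddz u)) => ou; first by exists 0.
have [||l dl] := IH (odometer_tail u); last by exists l.+1; rewrite /odometer_digit iterSr.
  by rewrite /odometer_tail (negPf ou); move: ou u3 un; rewrite /oddz; lia.
exact: odometer_tail_mod3.
Qed.

Lemma odometer_tail_pred u : odometer_tail (u - 3)%R =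
  if oddz u then odometer_tail u else (odometer_tail u - 3)%R.
Proof. by rewrite /odometer_tail /oddz; do 3?case: ifP => ?; lia. Qed.

Lemma odometer_prefix (s : seq bool) u : exists t : nat, t < 2 ^ size s /\
  forall l, l < size s -> odometer_digit (u + 3 * t%:Z)%R l = nth false s l.
Proof.
elim: s u => [|b s IH] u; first by exists 0.
have [t0 [t01 ob]] : exists t0 : nat, t0 <= 1 /\ oddz (u + 3 * t0%:Z)%R = b.
  by exists (oddz u != b : nat); case: b; case e : (oddz u); move: e; rewrite /oddz /=; lia.
pose u' := (u + 3 * t0%:Z)%R; rewrite -/u' in ob.
have [t [ts tP]] := IH (odometer_tail u').
exists (t0 + 2 * t); split; first by rewrite /= expnS; lia.
have uE : (u + 3 * (t0 + 2 * t)%:Z = u' + 2 * (3 * t%:Z))%R by rewrite /u'; lia.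
case=> [_|l lt]; rewrite uE /odometer_digit; first by rewrite /= -ob /oddz; lia.
rewrite iterSr (_ : odometer_tail _ = (odometer_tail u' + 3 * t%:Z)%R); first exact: tP.
by rewrite /odometer_tail /oddz; do 2!case: ifP => ?; lia.
Qed.

Section Odometer.
(** Three times the 2-adic integer [i + 1/3]. Its digits run like those of a counter, but as it is
    never a natural number it has infinitely many digits 1, so that [odo_val] and [nxt] are always
    defined. *)
Definition odo (i : int) := (3 * i + 1)%R.

Lemma odo_mod3 l i : (iter l odometer_tail (odo i) %% 3)%Z != 0%R.
Proof. by elim: l => [|l IH]; [rewrite /odo /=; lia | apply: odometer_tail_mod3]. Qed.

Definition dig i l := odometer_digit (odo i) l.

Lemma dig_next i l : exists n, dig i (l + n).
Proof.
have [n dn] := odometer_has_digit (odo_mod3 l i); exists n.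
by rewrite /dig /odometer_digit addnC iterD.
Qed.

Definition odo_val i := ex_minn (dig_next i 0).
Definition nxt i l := l.+1 + ex_minn (dig_next i l.+1).

Lemma dig_val i : dig i (odo_val i).
Proof. by rewrite /odo_val; case: ex_minnP. Qed.

Lemma dig_lt_val i l : l < odo_val i -> dig i l = false.
Proof.
rewrite /odo_val; case: ex_minnP => n _ h lt; apply/negP => dl.
by have := h l dl; rewrite leqNgt lt.
Qed.

Lemma val_le i l : dig i l -> odo_val i <= l.
Proof. by rewrite leqNgt; apply: contraL => /dig_lt_val->. Qed.

Lemma nxt_gt i l : l < nxt i l.
Proof. by rewrite /nxt addSn ltnS leq_addr. Qed.

Lemma dig_nxt i l : dig i (nxt i l).
Proof. by rewrite /nxt; case: ex_minnP. Qed.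

Lemma nxt_le i l n : l < n -> dig i n -> nxt i l <= n.
Proof.
rewrite /nxt => ln dn; case: ex_minnP => m _ h.
by rewrite -(subnKC ln) leq_add2l h // subnKC.
Qed.

Lemma nxt_eq i l n : l < n -> dig i n -> (forall k, l < k -> k < n -> dig i k = false) -> nxt i l = n.
Proof.
move=> ln dn h; apply/eqP; rewrite eqn_leq nxt_le // leqNgt; apply/negP => lt.
by have := h _ (nxt_gt i l) lt; rewrite dig_nxt.
Qed.

Lemma val_eq i n : dig i n -> (forall k, k < n -> dig i k = false) -> odo_val i = n.
Proof.
move=> dn h; apply/eqP; rewrite eqn_leq val_le // leqNgt; apply/negP => lt.
by have := h _ lt; rewrite dig_val.
Qed.

(** Subtraction of 1 with borrow: the zeros below the lowest digit 1 become ones, and this digit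
    becomes 0. *)
Lemma dig_pred i l : dig (i - 1)%R l =
  if l < odo_val i then true else if l == odo_val i then false else dig i l.
Proof.
suff main m : forall u l, odometer_digit u m -> (forall k, k < m -> odometer_digit u k = false) ->
    odometer_digit (u - 3)%R l =
    if l < m then true else if l == m then false else odometer_digit u l.
  have := main (odo_val i) (odo i) l (dig_val i) (fun k => @dig_lt_val i k).
  by rewrite (_ : odo i - 3 = odo (i - 1))%R // /odo; lia.
elim: m => [|m IH] {}u [|k] d0 dl; rewrite /odometer_digit.
- by move: d0; rewrite /odometer_digit /= /oddz; lia.
- by move: d0; rewrite !iterSr odometer_tail_pred /odometer_digit /= => ->.
- by have := dl 0 isT; rewrite /odometer_digit /= /oddz; lia.
have := dl 0 isT; rewrite !iterSr odometer_tail_pred {1}/odometer_digit /= => ->.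
have := IH (odometer_tail u) k; rewrite /odometer_digit => -> //.
  by move: d0; rewrite /odometer_digit iterSr.
by move=> n nm; have := dl n.+1 nm; rewrite /odometer_digit iterSr.
Qed.

Lemma dig_pred_gt i l : odo_val i < l -> dig (i - 1)%R l = dig i l.
Proof. by move=> lt; rewrite dig_pred ltnNge (ltnW lt) /= gtn_eqF. Qed.

Lemma nxt_pred i l : odo_val i <= l -> nxt (i - 1)%R l = nxt i l.
Proof.
move=> le; apply: nxt_eq; first exact: nxt_gt.
  by rewrite dig_pred_gt ?dig_nxt // (leq_ltn_trans le) ?nxt_gt.
move=> k lk kn; rewrite dig_pred_gt ?(leq_ltn_trans le) //.
by apply/negP => dk; have := nxt_le lk dk; rewrite leqNgt kn.
Qed.

Lemma nxt_val i l : l < odo_val i -> nxt i l = odo_val i.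
Proof. by move=> lt; apply: nxt_eq => // [|k _]; [exact: dig_val | exact: dig_lt_val]. Qed.

Lemma odometer_block j k : exists t : nat, t < 2 ^ k.+2 /\
  odo_val (j + t%:Z)%R = k /\ nxt (j + t%:Z)%R k = k.+1.
Proof.
have [t [tlt tP]] := odometer_prefix (rcons (rcons (nseq k false) true) true) (odo j).
rewrite !size_rcons size_nseq in tlt tP; exists t; split=> //.
have dE l : l < k.+2 -> dig (j + t%:Z)%R l = (k <= l).
  move=> lk; have := tP _ lk; rewrite /dig (_ : odo (j + t%:Z) = odo j + 3 * t%:Z)%R; last by rewrite /odo; lia.
  move=> ->; rewrite nth_rcons size_rcons nth_rcons size_nseq nth_nseq.
  by case: ltngtP lk => // ? ?; repeat case: ifP; lia.
by split; [apply: val_eq | apply: nxt_eq] => // *; rewrite dE //; lia.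
Qed.
End Odometer.

(** * The tiling given by the odometer and a family of labels *)

Section Existence.
Variables (label : finType) (hor ver : rel label) (lok bot diag reward : pred label).
Variable lam : nat -> nat -> label.
Hypothesis lamP : forall N, octant_ok hor ver lok bot diag N lam.
Variable free : int -> int -> bool.

Definition line_label i := lam (odo_val i) (nxt i (odo_val i)).

Hypothesis freeP : forall i j, free i j -> reward (line_label j).

Definition hedge (i j : int) : hcolor :=
  let l := odo_val j in (dig i l, dig i l.+1, dig j l.+1, ~~ dig i l && dig j (nxt i l)).

(** If digit [l] of [j] is 1, the last tile other than [Vert] below this edge is a cross, on a row
    of type [(l, n)]; otherwise it is a [Hori] tile on a row whose level is the next digit 1 of
    [j]. *)
Definition vedge (i j : int) : vcolor label :=
  let l := odo_val i in let n := nxt j l in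
  (dig j l, dig i l.+1, dig j l.+1,
   (if dig j l then lam l n else lam n (nxt j n), ~~ dig j l && dig i n, ~~ dig j l && dig i n.+1)).

Definition odo_tile (i j : int) : tile label :=
  (if odo_val i == odo_val j then Cross else if odo_val j < odo_val i then Vert else Hori,
   hedge (i - 1)%R j, vedge i (j - 1)%R, (line_label j, line_label i), (dig i 0, dig j 0, free i j)).

Lemma lam_label m L : m < L ->
  [/\ lok (lam m L), bot (lam m L) = (m == 0), diag (lam m L) = (m.+1 == L),
      m.+1 < L -> hor (lam m L) (lam m.+1 L) & ver (lam m L) (lam m L.+1)].
Proof.
move=> mL; have [h1 h2 h3 h4 h5] := lamP (N := L.+1) (m := m) (L := L) ltac:(lia).
by split=> //; apply: h5.
Qed.

Lemma dig_next_diag j m : dig j m.+1 = (m.+1 == nxt j m).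
Proof.
apply/idP/eqP => [d|->]; last exact: dig_nxt.
by apply/esym/nxt_eq => // k mk km; lia.
Qed.

Lemma odo_tile_east i j : east (odo_tile i j) = hedge i j.
Proof.
rewrite /east /odo_tile /kind /west /south /=; case: (ltngtP (odo_val i) (odo_val j)) => [lt|lt|e] /=.
- by rewrite /hedge !dig_pred_gt ?nxt_pred //; lia.
- rewrite /hedge /hp /hq /vU /= (dig_lt_val lt) (nxt_val lt) (dig_pred_gt lt) /=.
  congr (_, _, _, _); rewrite dig_pred.
  case: (ltngtP (odo_val j).+1 (odo_val i)) => [h|h|h]; first by rewrite (dig_lt_val h).
    by move: (leq_ltn_trans lt h); rewrite ltnn.
  by rewrite h dig_val.
- by rewrite /hedge /hp /hq /= -e dig_val (dig_pred_gt (leqnn _)).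
Qed.

Lemma odo_tile_north i j : north (odo_tile i j) = vedge i j.
Proof.
rewrite /north /odo_tile /kind /west /south /rowlab /=; case: (ltngtP (odo_val i) (odo_val j)) => [lt|lt|e] /=.
- rewrite /vedge /hR /hp /vp /vq /= (dig_lt_val lt) (nxt_val lt) /=.
  rewrite !(dig_pred_gt (i := i)) ?(leqW lt) // -/(line_label j); congr (_, _, _, _).
  rewrite dig_pred; case: (ltngtP (odo_val i).+1 (odo_val j)) => [h|h|h]; first by rewrite (dig_lt_val h).
    by move: (leq_ltn_trans lt h); rewrite ltnn.
  by rewrite h dig_val.
- rewrite /vedge !(dig_pred_gt lt) !(dig_pred_gt (ltnW lt : odo_val j < (odo_val i).+1)) (nxt_pred (ltnW lt)).
  rewrite [nxt (j - 1)%R (nxt _ _)]nxt_pred //; apply: leq_trans (ltnW lt) (ltnW (nxt_gt _ _)).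
- rewrite /vedge /hp /hq /= e dig_val /= -e (dig_pred_gt (leqnn _)) e.
  by [].
Qed.

Lemma odo_tile_ok i j : tile_ok hor ver lok bot diag reward (odo_tile i j).
Proof.
have [lE bE dE hE vE] := lam_label (nxt_gt j (odo_val j)).
apply/and5P; split.
- rewrite /odo_tile /kind /=; case: (ltngtP (odo_val i) (odo_val j)) => [lt|lt|e] /=.
  + rewrite /hori_ok /south /west /vU /vq /vp /hR /vlab /rowlab /= dig_pred lt /=.
    apply/implyP; rewrite dig_pred; case: (ltngtP (odo_val i).+1 (odo_val j)) => [//|h|h].
      by move: (leq_ltn_trans lt h); rewrite ltnn.
    move=> _; rewrite (dig_pred_gt lt) -h eqxx /=.
    have -> : nxt (j - 1)%R (odo_val i) = nxt j (odo_val j).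
      apply: nxt_eq; first by rewrite (ltn_trans lt) ?nxt_gt.
        by rewrite dig_pred_gt ?nxt_gt ?dig_nxt.
      move=> k ik kn; rewrite dig_pred ltnNge -h ik /=; case: eqP => // /eqP kj.
      have jk : odo_val j < k by rewrite -h ltn_neqAle eq_sym kj.
      by apply/negP => dk; have := nxt_le jk dk; rewrite leqNgt kn.
    have lt2 : (odo_val i).+1 < nxt j (odo_val j) by rewrite h nxt_gt.
    have [_ _ _ hE' _] := lam_label (ltn_trans (ltnSn _) lt2).
    by rewrite /line_label -h in hE' *; apply: hE'; rewrite h nxt_gt.
  + rewrite /vert_ok /west /south /hR /hp /hq /vU /= dig_pred lt /=; apply/implyP.
    rewrite dig_pred; case: (ltngtP (odo_val j).+1 (odo_val i)) => [//|h|h _].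
      by move: (leq_ltn_trans lt h); rewrite ltnn.
    by rewrite (dig_pred_gt lt) h.
  + rewrite /cross_ok /west /south /rowlab /collab /hR /hp /hq /hpay /vU /vp /vq /vR /vpp /=.
    have di : dig (i - 1)%R (odo_val j) = false by rewrite dig_pred e ltnn eqxx.
    have dj : dig (j - 1)%R (odo_val i) = false by rewrite dig_pred e ltnn eqxx.
    have ni : nxt (i - 1)%R (odo_val j) = nxt i (odo_val i) by rewrite nxt_pred e.
    have nj : nxt (j - 1)%R (odo_val i) = nxt j (odo_val j) by rewrite nxt_pred e.
    rewrite di dj ni nj -{1}e dig_pred_gt ?e // eqxx dig_pred_gt ?e // eqxx /=.
    rewrite {1}/line_label dE -dig_next_diag eqxx /=.
    have nle a b : dig a (nxt b (odo_val j)) -> odo_val j < nxt b (odo_val j) -> nxt a (odo_val j) <= nxt b (odo_val j).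
      by move=> d lt; apply: nxt_le.
    rewrite /line_label e; apply/andP; split; apply/implyP.
      case/andP=> d1 d2; have h1 := nle _ _ d1 (nxt_gt _ _); have h2 := nle _ _ d2 (nxt_gt _ _).
      by rewrite (_ : nxt i (odo_val j) = nxt j (odo_val j)) //; apply/eqP; rewrite eqn_leq h1 h2.
    (* Let [n] be the next digit 1 of [j]. The next digit 1 of [i] is at least [n] by [d1],
       different from [n] by [d2] and at most [n + 1] by [d3]. *)
    case/and3P=> d1 d2 d3; have h1 := nle _ _ d1 (nxt_gt _ _).
    have h2 : nxt i (odo_val j) <= (nxt j (odo_val j)).+1 by apply: nxt_le d3; rewrite ltnW // ltnS nxt_gt.
    have h3 : nxt i (odo_val j) != nxt j (odo_val j) by apply: contraNneq d2 => <-; exact: dig_nxt.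
    rewrite (_ : nxt i (odo_val j) = (nxt j (odo_val j)).+1) //.
    by apply/eqP; rewrite eqn_leq h2 ltn_neqAle eq_sym h3.
- rewrite /xpar /ypar /=; apply/implyP => /andP[d1 d2].
  have i0 : odo_val i = 0 by apply/eqP; rewrite -leqn0 val_le.
  have j0 : odo_val j = 0 by apply/eqP; rewrite -leqn0 val_le.
  by rewrite /kind /= i0 j0.
- rewrite /xpar /ypar /=; apply/implyP => /andP[d1 d2].
  have j0 : odo_val j = 0 by apply/eqP; rewrite -leqn0 val_le.
  have i0 : 0 < odo_val i by rewrite lt0n; apply: contraNneq d1 => <-; exact: dig_val.
  by rewrite /kind /= j0 i0 gtn_eqF.
- rewrite /xpar /ypar /=; apply/implyP => /andP[d1 d2].
  have i0 : odo_val i = 0 by apply/eqP; rewrite -leqn0 val_le.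
  have j0 : 0 < odo_val j by rewrite lt0n; apply: contraNneq d2 => <-; exact: dig_val.
  by rewrite /kind /= i0 ltn_eqF.
apply/and3P; split=> //; last by apply/implyP => /freeP.
rewrite /rowlab /ypar /= bE; apply/eqP; apply/eqP/idP => [<-|d]; first exact: dig_val.
by apply/eqP; rewrite -leqn0 val_le.
Qed.

Lemma dig0S i : dig (i + 1)%R 0 = ~~ dig i 0.
Proof. by rewrite /dig /odometer_digit /= /odo -oddzS /oddz; lia. Qed.

Lemma odo_tile_hmatch i j : hmatch (odo_tile i j) (odo_tile (i + 1)%R j).
Proof.
apply/and4P; split; rewrite ?eqxx //; first by rewrite odo_tile_east /west /= addrK.
by rewrite /xpar /= dig0S.
Qed.

Lemma odo_tile_vmatch i j : vmatch (odo_tile i j) (odo_tile i (j + 1)%R).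
Proof.
apply/and4P; split; rewrite ?eqxx //; first by rewrite odo_tile_north /south /= addrK.
by rewrite /ypar /= dig0S.
Qed.
End Existence.

(** * Coding tilings by configurations *)

Lemma divn_shift (m a k : nat) (J r : int) :
  (m%:Z * J + a%:Z - r + k%:Z = m%:Z * (J + ((a + k) %/ m)%:Z) + ((a + k) %% m)%:Z - r)%R.
Proof.
have := divn_eq (a + k) m; move: (_ %/ _) (_ %% _) => d e eq.
have {}eq : (a%:Z + k%:Z = d%:Z * m%:Z + e%:Z)%R by rewrite -PoszD eq PoszD PoszM.
rewrite mulrDr [(m%:Z * d%:Z)%R]mulrC; move: (m%:Z * J)%R (d%:Z * m%:Z)%R eq => x y; lia.
Qed.

Section CellLayout.
Variables (L q : nat) (hc vc : nat -> nat -> bool).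

Definition cyc_succ v := if v.+1 == L then 0 else v.+1.

Definition cell_data := (L * q).+1 * L.
(** Two header letters [c_2], then data letters, each with a letter [c_0] before and after it. Two
    consecutive header letters thus occur only at the start of a cell, and the odd height serves in
    [column_align]. *)
Definition cell_height := cell_data.*2 + 3.

(* A cell encodes the time [tau] of the clock and a tile for each of the [L]
   slots. Its logical row 0 has value [tau]; its logical row [1 + theta * q + y]
   has value [theta] if [y] is the tile in slot [theta], and [tau] otherwise, so
   that slot [tau] carries no information. *)
Definition logical_row tau (sigma : nat -> nat) r :=
  if r == 0 then tau
  else if sigma (r.-1 %/ q) == r.-1 %% q then r.-1 %/ q else tau.

Definition cell_row tau sigma rho :=
  if rho < 2 then 2
  else if odd rho then
    logical_row tau sigma ((rho - 3)./2 %/ L) + (rho - 3)./2 %% L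
  else 0.

Definition state_ok tau (sigma : nat -> nat) :=
  all (fun theta => (theta != tau) ==> (sigma theta < q) &&
        ((cyc_succ theta != tau) ==> hc (sigma theta) (sigma (cyc_succ theta)))) (iota 0 L).

Definition stack_ok tau (sigma sigma' : nat -> nat) :=
  all (fun theta => (theta != tau) ==> vc (sigma theta) (sigma' theta)) (iota 0 L).

Lemma state_okP tau sigma : reflect
  (forall theta, theta < L -> theta != tau -> sigma theta < q /\
     (cyc_succ theta != tau -> hc (sigma theta) (sigma (cyc_succ theta)))) (state_ok tau sigma).
Proof.
apply: (iffP allP) => h theta.
  move=> lt ne; have := h theta; rewrite mem_iota lt ne => /(_ isT) /andP[-> /implyP]; by [].
rewrite mem_iota => /andP[_ lt]; apply/implyP => /(h _ lt)[-> k]; exact/implyP.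
Qed.

Lemma stack_okP tau sigma sigma' : reflect
  (forall theta, theta < L -> theta != tau -> vc (sigma theta) (sigma' theta))
  (stack_ok tau sigma sigma').
Proof.
apply: (iffP allP) => h theta.
  by move=> lt ne; have := h theta; rewrite mem_iota lt ne; apply.
by rewrite mem_iota => /andP[_ lt]; apply/implyP; apply: h.
Qed.

End CellLayout.

(** * Columns made of cells *)

Section Cells.
Variables (A : eqType) (E : rel A) (L q : nat) (c : nat -> A) (hc vc : nat -> nat -> bool).
Hypotheses (L3 : 2 < L) (q0 : 0 < q).
Hypothesis c_periodic : forall k, c (k + L) = c k.
Hypothesis E_refl : forall k, E (c k) (c k).
Hypothesis E_succ : forall k, E (c k) (c k.+1).
Hypothesis rigid : forall d, 1 < d < L -> ~~ E (c 0) (c d).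

Let M := cell_height L q.
Let cell tau sigma rho := c (cell_row L q tau sigma rho).
Let succ := cyc_succ L.

Lemma succ_lt v : v < L -> succ v < L.
Proof. by rewrite /succ /cyc_succ; case: eqP; lia. Qed.

Lemma c_mul n k : c (k + n * L) = c k.
Proof. by elim: n => [|n IH]; rewrite ?addn0 // mulSn addnCA addnC c_periodic IH. Qed.

Lemma c_modn k : c (k %% L) = c k.
Proof. by rewrite [in RHS](divn_eq k L) addnC c_mul. Qed.

Lemma c_succ v k : v < L -> c (succ v + k) = c (v + k).+1.
Proof.
rewrite /succ /cyc_succ; case: eqP => [e _|_ _]; last by rewrite addSn.
by rewrite -addSn e add0n addnC c_periodic.
Qed.

(** [rigid] speaks only of edges leaving [c_0], but a reading of a full turn meets [c_0] at index
    [L - v], where it faces the letter with index [v' - v]. *)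
Lemma rigid_rows v v' : v < L -> v' < L -> (forall k, k < L -> E (c (v + k)) (c (v' + k))) ->
  v' = v \/ v' = succ v.
Proof.
move=> vL v'L h; have h' k : E (c (v + k)) (c (v' + k)).
  have := h _ (ltn_pmod k (ltnW (ltnW L3))).
  by rewrite -[c (v + _)]c_modn -[c (v' + _)]c_modn !modnDmr !c_modn.
pose d := (v' + (L - v)) %% L.
have dL : d < L by rewrite ltn_mod; lia.
have vd : forall k, c (v' + k) = c (v + k + d).
  move=> k; rewrite -[RHS]c_modn /d modnDmr (_ : v + k + _ = v' + k + L); last by lia.
  by rewrite modnDr c_modn.
have [d1|d1] := leqP d 1.
  have dE : d = if v <= v' then v' - v else v' + L - v.
    rewrite /d; case: leqP => le; last by rewrite modn_small; lia.
    by rewrite (_ : v' + (L - v) = v' - v + L) ?modnDr ?modn_small; lia.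
  by move: d1; rewrite dE /succ /cyc_succ; case: (leqP v v') => ? ?; case: (v.+1 =P L) => ?; lia.
have := rigid (d := d) ltac:(lia); have := h' (L - v); rewrite vd subnKC ?(ltnW vL) //.
by rewrite addnC c_periodic -[L in c L]add0n c_periodic => ->.
Qed.

(** Reflexivity of [E] reduces this to [rigid_rows] in both directions; two increments by 1 would
    make 2 a multiple of [L]. *)
Lemma eq_rows v v' : v < L -> v' < L -> (forall k, k < L -> c (v + k) = c (v' + k)) -> v = v'.
Proof.
move=> vL v'L h.
have [//|e1] : v' = v \/ v' = succ v by apply: rigid_rows => // k /h->.
have [//|e2] : v = v' \/ v = succ v' by apply: rigid_rows => // k /h->.
by move: e1 e2; rewrite /succ /cyc_succ; do 2!case: eqP; lia.
Qed.

Lemma header_neq : c 0 != c 2.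
Proof. by apply: contraNneq (rigid (d := 2) L3) => <-. Qed.

Lemma logical_row_lt tau sigma r : tau < L -> r < (L * q).+1 ->
  logical_row q tau sigma r < L.
Proof.
move=> tL; rewrite /logical_row ltnS; case: r => //= r rL; case: ifP => // _.
by rewrite ltn_divLR.
Qed.

Lemma cell_logical tau sigma r k : r < (L * q).+1 -> k < L ->
  cell tau sigma (2 * (r * L + k) + 3) = c (logical_row q tau sigma r + k).
Proof.
move=> rL kL; rewrite /cell /cell_row addn3 /= mul2n odd_double /=.
by rewrite !subSS subn0 doubleK divnMDl ?modnMDl ?(divn_small kL) ?(modn_small kL) ?addn0 //; lia.
Qed.

Lemma cell_index r k : r < (L * q).+1 -> k < L -> 2 * (r * L + k) + 3 < M.
Proof. by move=> rL kL; rewrite /M /cell_height /cell_data; nia. Qed.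

Definition agree tau (sigma sigma' : nat -> nat) :=
  forall theta, theta < L -> theta != tau -> sigma theta = sigma' theta.

Lemma row_index theta y : theta < L -> y < q -> (theta * q + y).+1 < (L * q).+1.
Proof. by move=> tL yq; rewrite ltnS; nia. Qed.

Lemma logical_slot tau sigma theta y : theta < L -> y < q ->
  logical_row q tau sigma (theta * q + y).+1 = if sigma theta == y then theta else tau.
Proof.
move=> tL yq; rewrite /logical_row /= divnMDl // divn_small // addn0 modnMDl modn_small //.
Qed.

Lemma cell_inj tau tau' sigma sigma' : tau < L -> tau' < L ->
  state_ok L q hc tau sigma -> state_ok L q hc tau' sigma' ->
  (forall rho, rho < M -> cell tau sigma rho = cell tau' sigma' rho) ->
  tau = tau' /\ agree tau sigma sigma'.
Proof.
move=> tL tL' /state_okP ok /state_okP ok' h.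
have rowE r : r < (L * q).+1 -> logical_row q tau sigma r = logical_row q tau' sigma' r.
  move=> rL; apply: eq_rows; rewrite ?logical_row_lt // => k kL.
  by rewrite -!cell_logical // h // cell_index.
have tE : tau = tau' by have := rowE 0 isT.
subst tau'; split=> // theta thL ne; have [lt _] := ok _ thL ne; have [lt' _] := ok' _ thL ne.
have := rowE _ (row_index thL lt); rewrite !logical_slot // eqxx.
by case: eqP => // _ e; rewrite e eqxx in ne.
Qed.

(** Without a tick, a new tile in slot [theta] would send one row from [theta] to [tau] and another
    back, hence [L] would divide 2. With a tick, the row of the old tile could only go from [theta]
    to [tau + 1], which is excluded if [theta] is neither [tau] nor [tau + 1]. *)
Lemma cell_step tau tau' sigma sigma' : tau < L -> tau' < L ->
  state_ok L q hc tau sigma -> state_ok L q hc tau' sigma' ->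
  (forall rho, rho < M -> E (cell tau sigma rho) (cell tau' sigma' rho)) ->
  (tau' = tau /\ agree tau sigma sigma') \/
  (tau' = succ tau /\ forall theta, theta < L -> theta != tau -> theta != succ tau ->
     sigma theta = sigma' theta).
Proof.
move=> tL tL' /state_okP ok /state_okP ok' h.
have rowE r : r < (L * q).+1 -> logical_row q tau' sigma' r = logical_row q tau sigma r \/
    logical_row q tau' sigma' r = succ (logical_row q tau sigma r).
  move=> rL; apply: rigid_rows; rewrite ?logical_row_lt // => k kL.
  by rewrite -!cell_logical // h // cell_index.
have [tE|tE] : tau' = tau \/ tau' = succ tau by have := rowE 0 isT.
  left; split=> //; subst tau' => theta thL ne.
  have [lt _] := ok _ thL ne; have [lt' _] := ok' _ thL ne.
  have := rowE _ (row_index thL lt); have := rowE _ (row_index thL lt').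
  have [//|ne2] := eqVneq (sigma theta) (sigma' theta).
  rewrite !logical_slot // !eqxx (negPf ne2) eq_sym (negPf ne2).
  by move: ne; rewrite /succ /cyc_succ; case: (theta.+1 =P L); case: (tau.+1 =P L); lia.
right; split=> // theta thL ne ne'; have [lt _] := ok _ thL ne.
have [lt' _] := ok' _ thL ltac:(by rewrite tE).
have := rowE _ (row_index thL lt); rewrite !logical_slot // !eqxx eq_sym; case: eqP => // _; rewrite tE.
by move: ne ne'; rewrite /succ /cyc_succ; case: (theta.+1 =P L); case: (tau.+1 =P L); lia.
Qed.

Let h := c 2.
Let w := c 0.

Lemma M_gt2 : 2 < M.
Proof. by rewrite /M /cell_height addn3. Qed.

Lemma M_odd : odd M.
Proof. by rewrite /M /cell_height oddD odd_double. Qed.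

Lemma cell_header tau sigma rho : rho < 2 -> cell tau sigma rho = h.
Proof. by rewrite /cell /cell_row => ->. Qed.

Lemma cell_even tau sigma rho : 1 < rho -> ~~ odd rho -> cell tau sigma rho = w.
Proof. by move=> lt /negPf o; rewrite /cell /cell_row o ltnNge lt. Qed.

Lemma header_row tau sigma tau' sigma' rho : rho < M ->
  cell tau sigma rho = h -> cell tau' sigma' (rho.+1 %% M) = h -> rho = 0.
Proof.
move=> lt h1 h2; have [le1|lt1] := leqP rho 1.
  case: rho le1 {h1} lt h2 => [|[|//]] // _ _; rewrite modn_small ?M_gt2 // cell_even // => wh.
  by move: header_neq; rewrite -/w wh eqxx.
case: (boolP (odd rho)) => o; last first.
  by move: h1 header_neq; rewrite cell_even // -/w => ->; rewrite eqxx.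
have lt2 : rho.+1 < M.
  rewrite ltn_neqAle lt andbT; apply: contraTneq M_odd => <-; by rewrite /= o.
move: h2 header_neq; rewrite modn_small // cell_even; [|lia|by rewrite /= o].
by rewrite -/w => ->; rewrite eqxx.
Qed.

Definition column (x : int -> A) r tau (sigma : int -> nat -> nat) :=
  [/\ r < M, tau < L, forall J, state_ok L q hc tau (sigma J),
      forall J, stack_ok L vc tau (sigma J) (sigma (J + 1)%R) &
      forall J rho, rho < M -> x (M%:Z * J + rho%:Z - r%:Z)%R = cell tau (sigma J) rho].

(** Length [2 * M] shows two whole cells when the word starts at a cell; in general position it
    meets three cells, whence three states. *)
Definition good_word (u : nat -> A) := exists r tau s0 s1 s2,
  [/\ r < M /\ tau < L,
      [/\ state_ok L q hc tau s0, state_ok L q hc tau s1 & state_ok L q hc tau s2],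
      stack_ok L vc tau s0 s1, stack_ok L vc tau s1 s2 &
      forall k, k < M.*2 -> u k =
        cell tau (nth s0 [:: s0; s1; s2] ((r + k) %/ M)) ((r + k) %% M)].

Lemma column_good x r tau sigma i : column x r tau sigma -> good_word (fun k => x (i + k%:Z)%R).
Proof.
move=> [rM tL ok st xE]; have M0 : 0 < M by exact: ltn_trans M_gt2.
pose J := ((i + r%:Z) %/ M%:Z)%Z; pose r' := `|((i + r%:Z) %% M%:Z)%Z|%N.
have M0' : (M%:Z != 0)%R by lia.
have r'E : (r'%:Z = (i + r%:Z) %% M%:Z)%Z by rewrite /r' abszE ger0_norm // modz_ge0.
have iE : (i = M%:Z * J + r'%:Z - r%:Z)%R.
  by rewrite r'E /J mulrC -divz_eq; lia.
have r'M : r' < M by have := ltz_pmod (i + r%:Z)%R (_ : 0 < M%:Z)%R; rewrite -r'E; lia.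
exists r', tau, (sigma J), (sigma (J + 1)%R), (sigma (J + 1 + 1)%R); split=> //.
move=> k kM; rewrite iE; have lt3 : (r' + k) %/ M < 3 by rewrite ltn_divLR //; lia.
rewrite divn_shift xE ?ltn_mod //.
by case: (_ %/ M) lt3 => [|[|[|//]]] _ /=; rewrite ?addr0 // -addrA.
Qed.

(** Each window has its own decoding. Headers synchronize the offsets of consecutive windows, and a
    cell read as second in one window and as first in the next has the same content by
    [cell_inj]. *)
Lemma column_decode x : (forall i, good_word (fun k => x (i + k%:Z)%R)) ->
  exists r tau sigma, column x r tau sigma.
Proof.
move=> good; have M0 : 0 < M by exact: ltn_trans M_gt2.
have M2 := M_gt2.
pose P i (p : nat * nat * (nat -> nat) * (nat -> nat)) :=
  [/\ p.1.1.1 < M /\ p.1.1.2 < L, state_ok L q hc p.1.1.2 p.1.2, state_ok L q hc p.1.1.2 p.2,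
      stack_ok L vc p.1.1.2 p.1.2 p.2 &
      exists s2, forall k, k < M.*2 -> x (i + k%:Z)%R =
        cell p.1.1.2 (nth p.1.2 [:: p.1.2; p.2; s2] ((p.1.1.1 + k) %/ M)) ((p.1.1.1 + k) %% M)].
have [p pP] : {p & forall i, P i (p i)}.
  apply: choice => i; have [r [tau [s0 [s1 [s2 [h1 [h2 h3 _] h4 _ h5]]]]]] := good i.
  by exists (r, tau, s0, s1); split=> //; exists s2.
pose r i := (p i).1.1.1.
have rM i : r i < M by case: (pP i) => [[]].
have r_step i : r (i + 1)%R = if (r i).+1 == M then 0 else (r i).+1.
  have [_ _ _ _ [s2 e]] := pP i; have [_ _ _ _ [s2' e']] := pP (i + 1)%R.
  have rMi := rM i; have rMi' := rM (i + 1)%R.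
  (* The distance from [i] to the next header. *)
  pose k := M - r i.
  have k1 : k.-1.+1 = k by rewrite prednK // subn_gt0.
  have rk : r i + k = M by rewrite subnKC // ltnW.
  have x0 : x (i + k%:Z)%R = h.
    by rewrite e; [rewrite -/(r i) rk modnn cell_header | rewrite /k; lia].
  have x1 : x (i + k.+1%:Z)%R = h.
    rewrite e; last by rewrite /k; lia.
    by rewrite -/(r i) addnS rk -addn1 modnDl modn_small ?cell_header // ltnW.
  have y0 := e' k.-1 ltac:(lia); have y1 := e' k ltac:(rewrite /k; lia).
  rewrite (_ : i + 1 + k.-1%:Z = i + k%:Z)%R ?x0 in y0; last by lia.
  rewrite (_ : i + 1 + k%:Z = i + k.+1%:Z)%R ?x1 in y1; last by lia.
  move: y0 y1; rewrite -/(r (i + 1)%R); set r' := r (i + 1)%R => y0 y1.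
  have eM : (r' + k) %% M = ((r' + k.-1) %% M).+1 %% M.
    by rewrite -addn1 modnDml addn1 -addnS k1.
  rewrite eM in y1.
  have := header_row (ltn_pmod _ M0) (esym y0) (esym y1).
  move/eqP; rewrite -/(_ %| _) => /dvdnP[n nE].
  have rM' : r' < M by [].
  have : n < 2 by move: nE; rewrite /k; nia.
  by case: eqP => ?; case: n nE => [|[|//]] nE _; move: nE; rewrite /k; lia.
have rE i : exists n : int, (i + (r 0%R)%:Z = M%:Z * n + (r i)%:Z)%R.
  elim/int_step_ind: i => [|i]; first by exists 0%R; rewrite mulr0.
  rewrite r_step; case: eqP => [e|ne]; split=> -[n nE].
  - by exists (n + 1)%R; rewrite mulrDr; lia.
  - by exists (n - 1)%R; rewrite mulrBr; lia.
  - by exists n; lia.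
  - by exists n; lia.
pose start J := (M%:Z * J - (r 0%R)%:Z)%R.
have rs J : r (start J) = 0.
  have [n nE] := rE (start J); rewrite /start subrK in nE.
  have := rM (start J); rewrite -/(start J) in nE; move: (r _) nE => a nE aM.
  have {}nE : (M%:Z * (J - n) = a%:Z)%R by rewrite mulrBr; lia.
  have [e|ne] := eqVneq (J - n)%R 0%R; first by rewrite e mulr0 in nE; lia.
  move: nE ne; move: (J - n)%R => d nE ne; exfalso.
  by have [lt|gt] : (d <= -1)%R \/ (1 <= d)%R; [lia | nia | nia].
have win J k : k < M.*2 -> x (start J + k%:Z)%R =
    cell (p (start J)).1.1.2 (if k < M then (p (start J)).1.2 else (p (start J)).2) (k %% M).
  move=> kM; have [_ _ _ _ [s2 e]] := pP (start J).
  rewrite e // -/(r _) rs add0n; case: ltnP => kM'; first by rewrite divn_small.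
  by rewrite (_ : k %/ M = 1) //; apply/eqP; rewrite eqn_leq leq_divRL // mul1n kM' andbT -ltnS ltn_divLR //; lia.
pose tau J := (p (start J)).1.1.2.
have next J : tau J = tau (J + 1)%R /\ agree (tau J) (p (start J)).2 (p (start (J + 1)%R)).1.2.
  have [[_ t1] _ ok1 _ _] := pP (start J); have [[_ t2] ok2 _ _ _] := pP (start (J + 1)%R).
  apply: cell_inj => // rho rM'.
  have := win J (M + rho) ltac:(lia); rewrite ltnNge leq_addr /= modnDl modn_small // => <-.
  have := win (J + 1)%R rho ltac:(lia); rewrite rM' modn_small // => <-.
  by congr x; rewrite /start mulrDr mulr1 PoszD; lia.
have tauE J : tau J = tau 0%R.
  elim/int_step_ind: J => // J; by rewrite (next J).1.
exists (r 0%R), (tau 0%R), (fun J => (p (start J)).1.2); split.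
- exact: rM.
- by have [[]] := pP (start 0%R).
- by move=> J; rewrite -(tauE J); have [] := pP (start J).
- move=> J; have [_ _ _ st _] := pP (start J); rewrite -/(tau J) tauE in st.
  apply/stack_okP => theta tL ne; have [_ <- //] := next J; rewrite ?tauE //.
  by move/stack_okP: st; apply.
- move=> J rho rM'; have := win J rho ltac:(lia).
  by rewrite rM' modn_small // -/(tau J) tauE => <-; congr x; rewrite /start; lia.
Qed.

(** If the offsets differ by [d], one of the two header rows on the right lies at a positive even
    row on the left, and (c_0, c_2) is not an edge. For odd [d] this is the second header row, still
    inside the cell because [M] is odd. *)
Lemma column_align x x' r r' tau tau' sigma sigma' : column x r tau sigma ->
  column x' r' tau' sigma' -> (forall k, E (x k) (x' k)) -> r = r'.
Proof.
move=> [rM _ _ _ xE] [rM' _ _ _ xE'] Exx; have M2 := M_gt2.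
pose d := if r' <= r then r - r' else r + M - r'.
pose J : int := if r' <= r then 0%R else (-1)%R.
have dM : d < M by rewrite /d; case: (leqP r' r); lia.
have posE rho : (M%:Z * 0 + rho%:Z - r'%:Z = M%:Z * J + (d + rho)%:Z - r%:Z)%R.
  by rewrite /J /d; case: (leqP r' r) => le; rewrite ?mulr0 ?mulrN1; lia.
have key rho : rho < 2 -> d + rho < M -> 1 < d + rho -> ~~ odd (d + rho) -> False.
  move=> r2 lt gt ev; have := Exx (M%:Z * 0 + rho%:Z - r'%:Z)%R.
  rewrite xE'; last by lia.
  by rewrite cell_header // posE xE // cell_even // (negPf (rigid (d := 2) L3)).
have d0 : d = 0.
  case: (posnP d) => // dpos; exfalso; case: (boolP (odd d)) => od; last first.
    by apply: (key 0) => //; rewrite ?addn0 //; case: d dpos od {dM posE key} => [|[]].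
  apply: (key 1) => //; rewrite ?addn1 /= ?od //; have := M_odd; have := dM.
  by rewrite leq_eqVlt => /predU1P[<-|//]; rewrite /= od.
by move: d0; rewrite /d; case: (leqP r' r); lia.
Qed.

(** [theta - tau - 1] modulo [L]: the oldest visible tile is in slot [tau + 1], the newest, with
    index [L - 2], in slot [tau - 1]. *)
Definition slot_index theta tau := (theta + (L - tau).-1) %% L.

Lemma modn_shift_neq a d : 0 < d -> d < L -> (a + d) %% L != a %% L.
Proof.
move=> d0 dL; rewrite -[X in _ != X %% L]addn0 eqn_modDl mod0n modn_small //.
by rewrite -lt0n.
Qed.

Lemma succ_mod v : v < L -> succ v = v.+1 %% L.
Proof.
rewrite /succ /cyc_succ; case: eqP => [->|ne] vL; first by rewrite modnn.
by rewrite modn_small //; lia.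
Qed.

Lemma slot_indexK tau e : tau < L -> e < L -> slot_index ((tau + e.+1) %% L) tau = e.
Proof.
move=> tL eL; rewrite /slot_index modnDml (_ : _ + _ = e + L); last by lia.
by rewrite modnDr modn_small.
Qed.

Lemma slot_index_mod tau theta : tau < L -> theta < L -> (tau + (slot_index theta tau).+1) %% L = theta.
Proof.
move=> tL thL; rewrite -addSnnS /slot_index modnDmr (_ : _ + _ = theta + L); last by lia.
by rewrite modnDr modn_small.
Qed.

Lemma slot_index_lt tau theta : tau < L -> theta < L -> theta != tau -> slot_index theta tau < L.-1.
Proof.
move=> tL thL ne; have L0 : 0 < L by apply: ltn_trans L3.
have lt : slot_index theta tau < L by rewrite /slot_index ltn_pmod.
suff : slot_index theta tau != L.-1 by lia.
apply: contra_neq ne => e; have := slot_index_mod tL thL.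
by rewrite e prednK // modnDr modn_small.
Qed.

Lemma slot_lt rho : rho < M -> ((rho - 3)./2 %/ L).-1 %/ q < L.
Proof.
move=> rM; rewrite ltn_divLR //; suff : (rho - 3)./2 %/ L < (L * q).+1 by lia.
by rewrite ltn_divLR; [move: rM; rewrite /M /cell_height /cell_data; lia | lia].
Qed.

Lemma cell_agree tau sigma sigma' rho : agree tau sigma sigma' -> rho < M ->
  cell tau sigma rho = cell tau sigma' rho.
Proof.
move=> ag rM; rewrite /cell /cell_row; case: ifP => // _; case: ifP => // _.
congr (c (_ + _)); rewrite /logical_row; case: eqP => // r0.
have lt := slot_lt rM.
by have [->|ne] := eqVneq (((rho - 3)./2 %/ L).-1 %/ q) tau; [rewrite !if_same | rewrite ag].
Qed.

(** * Decoding a window into a strip of tiles *)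

Section Window.
Variables (X : nat -> int -> A) (n : nat).
Hypothesis X_column : forall i, i <= n -> exists r tau sigma, column (X i) r tau sigma.
Hypothesis X_edge : forall i j, i < n -> E (X i j) (X i.+1 j).

(** [t i] counts the ticks before column [i], which shows the tiles from [t i] to [t i + (L - 2)].
    As [L > 2], any two neighbouring tiles are visible together in some column, where [hc] is
    checked. *)
Lemma window_decode : exists r tau (t : nat -> nat) (y : nat -> int -> nat),
  [/\ r < M /\ tau < L,
      t 0 = 0 /\ forall i, i < n -> t i.+1 = t i \/ t i.+1 = (t i).+1,
      forall s J, s <= t n + (L - 2) -> y s J < q /\ vc (y s J) (y s (J + 1)%R),
      forall s J, s < t n + (L - 2) -> hc (y s J) (y s.+1 J) &
      forall i J rho, i <= n -> rho < M -> X i (M%:Z * J + rho%:Z - r%:Z)%R =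
        cell ((tau + t i) %% L) (fun theta => y (t i + slot_index theta ((tau + t i) %% L)) J) rho].
Proof.
have L0 : 0 < L by lia.
pose P i (p : nat * nat * (int -> nat -> nat)) := i <= n -> column (X i) p.1.1 p.1.2 p.2.
have [p pP] : {p & forall i, P i (p i)}.
  apply: choice => i; rewrite /P; have [le|lt] := leqP i n; last by exists (0, 0, fun _ _ => 0).
  by have [r [tau [sigma col]]] := X_column le; exists (r, tau, sigma).
pose r := (p 0).1.1; pose tau i := (p i).1.2; pose sigma i := (p i).2.
have rE i : i <= n -> (p i).1.1 = r.
  elim: i => // i IH lt; rewrite -IH ?(ltnW lt) //; apply/esym.
  by apply: column_align (pP _ (ltnW lt)) (pP _ lt) _ => k; apply: X_edge.
have col i : i <= n -> column (X i) r (tau i) (sigma i) by move=> le; rewrite -(rE i le); apply: pP.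
have step i J : i < n -> (tau i.+1 = tau i /\ agree (tau i) (sigma i J) (sigma i.+1 J)) \/
  (tau i.+1 = succ (tau i) /\ forall theta, theta < L -> theta != tau i -> theta != succ (tau i) ->
     sigma i J theta = sigma i.+1 J theta).
  move=> lt; have [_ t1 ok1 _ x1] := col i (ltnW lt); have [_ t2 ok2 _ x2] := col i.+1 lt.
  by apply: cell_step (ok1 J) (ok2 J) _ => // rho rM; rewrite -x1 // -x2 //; apply: X_edge.
pose t i := \sum_(k < i) (tau k.+1 != tau k : nat).
have tS i : t i.+1 = t i + (tau i.+1 != tau i) by rewrite /t big_ord_recr.
have tauL i : i <= n -> tau i < L by move=> le; have [] := col i le.
have tauE i : i <= n -> tau i = (tau 0 + t i) %% L.
  elim: i => [|i IH] lt; first by rewrite /t big_ord0 addn0 modn_small ?tauL.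
  rewrite tS addnA; have [[e _]|[e _]] := step i 0%R lt; first by rewrite e eqxx addn0 -IH // ltnW.
  have ne : tau i.+1 != tau i.
    by rewrite e succ_mod ?tauL ?(ltnW lt) // -addn1 -[X in _ != X](modn_small (tauL _ (ltnW lt)));
      apply: modn_shift_neq => //; lia.
  by rewrite ne addn1 e succ_mod ?tauL ?(ltnW lt) // {1}IH ?(ltnW lt) // -addn1 modnDml addn1.
have tmono i j : i <= j -> t i <= t j.
  move=> /subnK <-; elim: (j - i) => // d IH; apply: leq_trans IH _.
  by rewrite addSn tS leq_addr.
pose th s := (tau 0 + s.+1) %% L.
have thL s : th s < L by rewrite ltn_mod.
have th_ne i s : i <= n -> t i <= s <= t i + (L - 2) -> th s != tau i.
  move=> le /andP[h1 h2]; rewrite tauE // /th (_ : tau 0 + s.+1 = tau 0 + t i + (s - t i).+1); last by lia.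
  by apply: modn_shift_neq => //; lia.
(* The first column that shows tile [s]; [yE] below proves that all columns showing it agree. *)
pose idx s := find (fun i => s <= t i + (L - 2)) (iota 0 n.+1).
pose y s J := sigma (idx s) J (th s).
have idxP s : s <= t n + (L - 2) -> idx s <= n /\ s <= t (idx s) + (L - 2).
  move=> le; have hs : has (fun i => s <= t i + (L - 2)) (iota 0 n.+1).
    by apply/hasP; exists n; rewrite // mem_iota leq0n add0n ltnSn.
  have lt : idx s < n.+1 by rewrite /idx -[X in _ < X](size_iota 0 n.+1) -has_find.
  by split=> //; have := nth_find 0 hs; rewrite nth_iota.
have idx_min s i : i < idx s -> i <= n -> t i + (L - 2) < s.
  move=> lt le; have := before_find 0 lt; rewrite nth_iota // add0n => /negbT.
  by rewrite -ltnNge.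
have idx_t s : s <= t n + (L - 2) -> t (idx s) <= s.
  move=> le; have [ln ls] := idxP _ le; case e : (idx s) ln ls => [|k] ln ls.
    by rewrite /t big_ord0.
  have := idx_min s k; rewrite e ltnSn => /(_ isT (ltnW ln)).
  by rewrite tS in ls *; case: (_ != _) ls; lia.
have yE i s J : i <= n -> t i <= s <= t i + (L - 2) -> sigma i J (th s) = y s J.
  elim: i => [|i IH] le /andP[h1 h2].
    rewrite /y; suff -> : idx s = 0 by [].
    apply/eqP; rewrite -leqn0 leqNgt; apply/negP => lt.
    by have := idx_min s 0 lt (leq0n _); lia.
  have [lt|ge] := ltnP i (idx s).
    have le2 : s <= t n + (L - 2) by rewrite (leq_trans h2) // leq_add2r tmono.
    have [ln ls] := idxP _ le2; suff e : idx s = i.+1 by rewrite /y e.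
    apply/eqP; rewrite eqn_leq lt andbT leqNgt; apply/negP => lt2.
    by have := idx_min s i.+1 lt2 le; lia.
  have ti : t i <= s by apply: leq_trans h1; apply: tmono.
  have le2 : s <= t n + (L - 2) by rewrite (leq_trans h2) // leq_add2r tmono.
  have [ln ls] := idxP _ le2.
  have si : s <= t i + (L - 2) by apply: leq_trans ls _; rewrite leq_add2r tmono.
  have n1 : th s != tau i by apply: th_ne; rewrite ?ti // ltnW.
  have n2 : th s != tau i.+1 by apply: th_ne; rewrite ?h1.
  rewrite -IH ?ti ?(ltnW le) //; have [[_ ag]|[e ag]] := step i J le.
    by rewrite -ag.
  by rewrite -ag // -e.
exists r, (tau 0), t, y; split.
- by have [] := col 0 (leq0n n).
- split=> [|i lt]; first by rewrite /t big_ord0.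
  by rewrite tS; case: (_ != _); rewrite ?addn1 ?addn0; [right | left].
- move=> s J le; have [ln ls] := idxP _ le; have [_ _ ok st _] := col _ ln.
  have ne : th s != tau (idx s) by apply: th_ne; rewrite ?idx_t.
  split; first by have /state_okP/(_ _ (thL s) ne)[] := ok J.
  by have /stack_okP/(_ _ (thL s) ne) := st J.
- move=> s J lt; have [ln ls] := idxP _ lt; have [_ _ ok _ _] := col _ ln.
  have ts : t (idx s.+1) <= s.
    case e : (idx s.+1) ln ls => [|k] ln ls; first by rewrite /t big_ord0.
    have := idx_min s.+1 k; rewrite e ltnSn => /(_ isT (ltnW ln)).
    by rewrite tS in ls *; case: (_ != _) ls; lia.
  have ne : th s != tau (idx s.+1) by apply: th_ne; rewrite // ts (leq_trans (leqnSn s)).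
  have ne2 : th s.+1 != tau (idx s.+1) by apply: th_ne; rewrite // ls (leq_trans ts).
  have eS : succ (th s) = th s.+1 by rewrite succ_mod // /th -addn1 modnDml -addnA addn1.
  have /state_okP/(_ _ (thL s) ne)[_] := ok J; rewrite -/succ eS => /(_ ne2).
  by rewrite !yE // ?ts ?ls ?(leq_trans (leqnSn s)) // (leq_trans ts).
- move=> i J rho le rM; have [_ _ _ _ xE] := col i le; rewrite xE // -tauE //.
  apply: cell_agree => // theta thl ne.
  have lt := slot_index_lt (tauL _ le) thl ne.
  rewrite -(yE i) ?leq_addr //=; last by rewrite leq_add2l; lia.
  congr (sigma i J _); rewrite /th -addnS addnA -modnDml -tauE //.
  by rewrite slot_index_mod // tauL.
Qed.
End Window.

(** * Encoding a tiling of the plane *)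

Section Encode.
Variable y : int -> int -> nat.
Hypothesis y_lt : forall i J, y i J < q.
Hypothesis y_hc : forall i J, hc (y i J) (y (i + 1)%R J).
Hypothesis y_vc : forall i J, vc (y i J) (y i (J + 1)%R).

Definition clock (i : int) := `|(i %% L%:Z)%Z|%N.
Definition slots (i J : int) theta := y (i + (slot_index theta (clock i))%:Z)%R J.
Definition encode (i j : int) := cell (clock i) (slots i (j %/ M%:Z)%Z) `|(j %% M%:Z)%Z|.

Lemma encodeE i J rho : rho < M ->
  encode i (M%:Z * J + rho%:Z)%R = cell (clock i) (slots i J) rho.
Proof.
move=> rM; rewrite /encode.
have -> : ((M%:Z * J + rho%:Z) %/ M%:Z = J)%Z by rewrite mulrC divzMDl ?divz_small ?addr0; lia.
by have -> : ((M%:Z * J + rho%:Z) %% M%:Z = rho%:Z)%Z by rewrite mulrC modzMDl modz_small; lia.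
Qed.

Lemma clock_lt i : clock i < L.
Proof.
have L0 : (0 < L%:Z)%R by lia.
by have := ltz_pmod i L0; have := modz_ge0 i (lt0r_neq0 L0); rewrite /clock; lia.
Qed.

Lemma clockS i : clock (i + 1)%R = succ (clock i).
Proof.
have L0 : (0 < L%:Z)%R by lia.
have e1 : ((clock i)%:Z = i %% L%:Z)%Z by rewrite /clock abszE ger0_norm // modz_ge0 // lt0r_neq0.
have e2 : ((clock (i + 1)%R)%:Z = (i + 1) %% L%:Z)%Z.
  by rewrite /clock abszE ger0_norm // modz_ge0 // lt0r_neq0.
have e3 : ((i + 1) %% L%:Z = ((clock i).+1 %% L)%:Z)%Z.
  by rewrite -modz_nat -modzDml -e1; congr (_ %% _)%Z; lia.
by rewrite succ_mod ?clock_lt //; apply/eqP; rewrite -eqz_nat e2 e3.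
Qed.

Lemma slot_index_succ theta tau : theta < L -> tau < L -> succ theta != tau ->
  theta != tau -> slot_index (succ theta) tau = (slot_index theta tau).+1.
Proof.
move=> thL tL ne ne'; have lt := slot_index_lt tL thL ne'.
rewrite succ_mod // /slot_index modnDml addSn -addn1 -modnDml -/(slot_index theta tau) addn1.
by rewrite modn_small; lia.
Qed.

Lemma slot_index_next theta tau : theta < L -> tau < L -> theta != tau -> theta != succ tau ->
  slot_index theta tau = (slot_index theta (succ tau)).+1.
Proof.
move=> thL tL ne ne'; have sL := succ_lt tL.
have lt := slot_index_lt sL thL ne'.
have e := slot_index_mod sL thL.
rewrite -{1}e succ_mod // modnDml.
rewrite (_ : _ + _.+1 = tau + (slot_index theta (tau.+1 %% L)).+2) ?slot_indexK //; last by lia.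
by rewrite -succ_mod //; lia.
Qed.

Lemma encode_state i J : state_ok L q hc (clock i) (slots i J).
Proof.
apply/state_okP => theta thL ne; split; first exact: y_lt.
move=> ne'; rewrite /slots slot_index_succ ?clock_lt //.
by rewrite (_ : (i + _.+1%:Z = i + (slot_index theta (clock i))%:Z + 1)%R); [apply: y_hc | lia].
Qed.

Lemma encode_column i : column (encode i) 0 (clock i) (slots i).
Proof.
have M0 := M_gt2; split.
- by apply: ltn_trans M0.
- exact: clock_lt.
- exact: encode_state.
- by move=> J; apply/stack_okP => theta _ _; apply: y_vc.
by move=> J rho rM; rewrite subr0 encodeE.
Qed.

Lemma E_rows v v' k : v < L -> v' = v \/ v' = succ v -> E (c (v + k)) (c (v' + k)).
Proof. by move=> vL [->|->] //; rewrite c_succ. Qed.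

Lemma encode_edge i j : E (encode i j) (encode (i + 1)%R j).
Proof.
have rM : `|(j %% M%:Z)%Z| < M.
  have M0 : (0 < M%:Z)%R by have := M_gt2; lia.
  by have := ltz_pmod j M0; have := modz_ge0 j (lt0r_neq0 M0); lia.
have := slot_lt rM; rewrite /encode; move: (j %/ _)%Z `|_|%N => J rho; rewrite /cell /cell_row.
case: ifP => // _; case: ifP => // _; move: ((rho - 3)./2 %/ L) (_ %% L) => r k thL.
rewrite /logical_row; case: eqP => [_|r0].
  by apply: E_rows; [exact: clock_lt | right; exact: clockS].
move: (r.-1 %/ q) (r.-1 %% q) thL => theta a thL; apply: E_rows; first by case: ifP; rewrite ?clock_lt.
rewrite clockS; have [e|ne] := eqVneq theta (clock i).
  by rewrite e !if_same; case: ifP; [left | right].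
have [e|ne'] := eqVneq theta (succ (clock i)).
  by rewrite e !if_same; case: ifP; [left | right].
rewrite /slots clockS (slot_index_next thL (clock_lt i)) //.
rewrite (_ : (i + _.+1%:Z = i + 1 + (slot_index theta (succ (clock i)))%:Z)%R); last by lia.
by case: ifP; [left | right].
Qed.
End Encode.

Lemma encode_inj y y' i J : (forall i J, y i J < q) -> (forall i J, y' i J < q) ->
  (forall i J, hc (y i J) (y (i + 1)%R J)) -> (forall i J, hc (y' i J) (y' (i + 1)%R J)) ->
  (forall rho, rho < M -> encode y i (M%:Z * J + rho%:Z)%R = encode y' i (M%:Z * J + rho%:Z)%R) ->
  y i J = y' i J.
Proof.
move=> lt lt' yh yh' e.
have M0 := M_gt2.
have [_ ag] : clock i = clock i /\ agree (clock i) (slots y i J) (slots y' i J).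
  apply: cell_inj; rewrite ?clock_lt //; [exact: encode_state | exact: encode_state | move=> rho rM].
  by have := e rho rM; rewrite !encodeE.
have cL := clock_lt i.
have := ag ((clock i + 1) %% L); rewrite /slots slot_indexK //; last by lia.
rewrite addr0; apply; first by rewrite ltn_mod; lia.
by rewrite -[X in _ != X](modn_small cL); apply: modn_shift_neq; lia.
Qed.
End Cells.

(** * Counting patterns *)

Section TileCount.
Variables (label : finType) (hor ver : rel label) (lok bot diag reward : pred label).
Hypothesis reward_diag : forall x, reward x -> diag x.

Notation tile := (tile label).
Notation tile_ok := (tile_ok hor ver lok bot diag reward).
Notation hierarchical := (hierarchical hor ver lok bot diag reward).

Variables (N0 N : nat) (D : pred nat).
Hypothesis N0N : N0 < N.
Hypothesis sound : forall f, octant_ok hor ver lok bot diag N.-1 f ->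
  forall k, k < N0 -> reward (f k k.+1) -> D k.

Let P := 2 ^ N0.+1.

Lemma P_gt0 : 0 < P. Proof. by rewrite expn_gt0. Qed.

(* Rows carrying free bits are those at distance [2 ^ k * (4 * b + 3)] from a
   corner, with [D k] if [k < N0], and possibly those at distance divisible by
   [2 ^ N0]; modulo [2 ^ N0.+1] these are [reward_weight + 2] residues. *)
Definition reward_weight := \sum_(k < N0) D k * 2 ^ (N0 - k.+1).

Definition reward_residues (o : nat) : seq nat :=
  [seq z %% P | z <- flatten [seq [seq o + 3 * 2 ^ k + 2 ^ k.+2 * b |
     b <- iota 0 (2 ^ (N0 - k.+1))] | k <- [seq k <- iota 0 N0 | D k]]
     ++ [:: o; o + 2 ^ N0]].

Lemma size_reward_residues o : size (reward_residues o) = reward_weight + 2.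
Proof.
rewrite size_map size_cat /=; congr (_ + 2).
rewrite size_flatten /shape -map_comp sumnE big_map big_filter.
rewrite /reward_weight -(big_mkord predT (fun k => D k * 2 ^ (N0 - k.+1))) /index_iota subn0.
rewrite big_mkcond; apply: eq_bigr => k _ /=; rewrite size_map size_iota.
by case: (D k); rewrite ?mul1n.
Qed.

Lemma modn_posz (j a : nat) m : 0 < m -> (exists c : int, j%:Z = a%:Z + m%:Z * c)%R -> j %% m = a %% m.
Proof.
move=> m0 [c e]; have [c0|c0] := leP 0%R c.
  by have -> : j = `|c|%N * m + a by [nia]; rewrite modnMDl.
by have -> : a = `|c|%N * m + j by [nia]; rewrite modnMDl.
Qed.

Section Valid.
Variables (y : nat -> int -> tile) (w : nat).

Definition valid_strip := [/\ forall i j, i <= w -> tile_ok (y i j),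
  forall i j, i < w -> hmatch (y i j) (y i.+1 j) &
  forall i j, i <= w -> vmatch (y i j) (y i (j + 1)%R)].

Lemma reward_row ox (o j : nat) : valid_strip -> hierarchical y w N ox o -> 2 ^ N.+3 <= w ->
  reward (rowlab (y 0 j)) -> j %% P \in reward_residues o.
Proof.
move=> [ok hr vr] hier wN rw.
have oct := hierarchical_octant ok hr vr hier wN.
rewrite /reward_residues map_cat mem_cat.
have far (c : int) : (j%:Z = o%:Z + (2 ^ N0)%:Z * c)%R -> j %% P \in [:: o %% P; (o + 2 ^ N0) %% P].
  move=> e; have [c' cE] := oddzP c; rewrite !inE; case oc : (oddz c) cE => cE.
    apply/orP; right; apply/eqP; apply: modn_posz P_gt0 _; exists c'.
    by rewrite e cE /P expnS; lia.
  apply/orP; left; apply/eqP; apply: modn_posz P_gt0 _; exists c'.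
  by rewrite e cE /P expnS; lia.
have [[k [b [kN [jE lE]]]]|[b jE]] := hierarchical_diag hr vr hier wN (reward_diag rw); last first.
  apply/orP; right; apply: (far ((2 ^ (N.-1 - N0))%:Z * b)%R).
  by rewrite jE mulrA -PoszM -expnD subnKC //; lia.
have [k0|k0] := leqP N0 k.
  apply/orP; right; apply: (far ((2 ^ (k - N0))%:Z * (4 * b + 3))%R).
  by rewrite jE !mulrA -PoszM -expnD subnKC.
apply/orP; left; pose q := 2 ^ (N0 - k.+1); have q0 : 0 < q by rewrite expn_gt0.
have PE : P = 2 ^ k.+2 * q by rewrite /P /q -expnD; congr (2 ^ _); lia.
pose b' := `|(b %% q%:Z)%Z|%N.
have b'E : (b'%:Z = b %% q%:Z)%Z by rewrite /b' abszE ger0_norm // modz_ge0 //; lia.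
have b'q : b' < q by have := ltz_pmod b (_ : 0 < q%:Z)%R; rewrite -b'E; lia.
have -> : j %% P = (o + 3 * 2 ^ k + 2 ^ k.+2 * b') %% P.
  apply: modn_posz P_gt0 _; exists (b %/ q%:Z)%Z; rewrite jE {1}(divz_eq b q%:Z) -b'E PE !expnS.
  by move: (b %/ _)%Z (2 ^ k) => c z; lia.
apply: map_f; apply/flattenP; exists [seq o + 3 * 2 ^ k + 2 ^ k.+2 * b0 | b0 <- iota 0 q].
  apply: (map_f (fun k => [seq o + 3 * 2 ^ k + 2 ^ k.+2 * b0 | b0 <- iota 0 (2 ^ (N0 - k.+1))])).
  by rewrite mem_filter mem_iota add0n k0 /= andbT; apply: (sound oct k0); rewrite -lE.
by apply: map_f; rewrite mem_iota.
Qed.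
End Valid.

Section Data.
Variables (G Wm : nat).

Let m0 := (2 ^ N.+3).+1.
Let hN := reward_weight + 2.

(** The corner of the hierarchy, the columns to its left and near the right border, the bottom row,
    the kinds at the corners of level [N], and the bits of the rows that may be rewarded. [G] bounds
    the height and [Wm] the width. *)
Definition strip_data : finType :=
  ('I_(2 ^ N.+2).+1 * 'I_(2 ^ N.+2).+1 * {ffun 'I_m0 * 'I_G -> tile} *
   {ffun 'I_(2 ^ N) * 'I_G -> tile} * {ffun 'I_Wm -> tile} *
   {ffun 'I_(Wm %/ 2 ^ N).+1 * 'I_(G %/ 2 ^ N).+1 -> option bool} *
   {ffun 'I_Wm * 'I_(G %/ P).+1 * 'I_hN -> bool})%type.

Definition data_of (y : nat -> int -> tile) (w ox oy : nat) : strip_data :=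
  (inord ox, inord oy, [ffun p : 'I_m0 * 'I_G => y p.1 (p.2 : nat)],
   [ffun p : 'I_(2 ^ N) * 'I_G => y (w - p.1) (p.2 : nat)], [ffun i : 'I_Wm => y i 0%R],
   [ffun p : 'I_(Wm %/ 2 ^ N).+1 * 'I_(G %/ 2 ^ N).+1 =>
      kind (y (ox + 2 ^ N * p.1) (2 ^ N * p.2 + oy %% 2 ^ N)%N)],
   [ffun p : 'I_Wm * 'I_(G %/ P).+1 * 'I_hN =>
      bit (y p.1.1 (P * p.1.2 + nth 0 (reward_residues oy) p.2)%N)]).

Lemma tile_eq (t t' : tile) : kind t = kind t' -> west t = west t' -> south t = south t' ->
  rowlab t = rowlab t' -> collab t = collab t' -> xpar t = xpar t' -> ypar t = ypar t' ->
  bit t = bit t' -> t = t'.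
Proof.
case: t t' => [[[[k h] v] [a b]] [[p p'] f]] [[[[k1 h1] v1] [a1 b1]] [[p1 p1'] f1]].
rewrite /kind /west /south /rowlab /collab /xpar /ypar /bit /=.
by move=> -> -> -> -> -> -> -> ->.
Qed.

(** A tile is determined by its kind, its bit and its western and southern neighbours, so the strip
    is rebuilt column by column, each one upwards. Kinds come from [hierarchical_kind] except at the
    stored corners, and bits vanish on rows without reward. *)
Lemma data_unique y y' w (ox oy ox' oy' : nat) : w < Wm -> valid_strip y w -> valid_strip y' w ->
  hierarchical y w N ox oy -> hierarchical y' w N ox' oy' ->
  data_of y w ox oy = data_of y' w ox' oy' ->
  forall i j, i <= w -> j < G -> y i j = y' i j.
Proof.
move=> wW v v' hier hier' [e1 e2 e3 e4 e5 e6 e7].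
have [[oxN oyN] _ _ _] := hier; have [[oxN' oyN'] _ _ _] := hier'.
have oxE : ox = ox' by move/(congr1 val): e1; rewrite /= !inordK.
have oyE : oy = oy' by move/(congr1 val): e2; rewrite /= !inordK //; lia.
subst ox' oy' => {e1 e2}.
have left i j : i < m0 -> j < G -> y i j = y' i j.
  by move=> im jG; move/ffunP: e3 => /(_ (Ordinal im, Ordinal jG)); rewrite !ffunE.
(* A clock that ticks rarely gives a narrow strip, in which no hierarchy need be visible; it lies
   within the stored left columns. *)
move=> i j; have [wm|wm] := ltnP w m0; first by move=> iw; apply: left; apply: leq_ltn_trans wm.
have right : i <= w -> w < i + 2 ^ N -> j < G -> y i j = y' i j.
  move=> iw im jG; have lt : w - i < 2 ^ N by lia.
  by move/ffunP: e4 => /(_ (Ordinal lt, Ordinal jG)); rewrite !ffunE /= subKn.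
have bottom k : k <= w -> y k 0%R = y' k 0%R.
  by move=> kw; move/ffunP: e5 => /(_ (Ordinal (leq_ltn_trans kw wW))); rewrite !ffunE.
have wN : 2 ^ N.+3 <= w by apply: ltnW.
have [ok hr vr] := v; have [ok' hr' vr'] := v'.
have kindE x k : ox + x + 2 ^ N <= w -> k < G -> kind (y (ox + x) k) = kind (y' (ox + x) k).
  move=> xw kG.
  have kE : (Posz k = oy%:Z + (k%:Z - oy%:Z))%R by lia.
  have N2 : 0 < 2 ^ N by rewrite expn_gt0.
  have corner : (exists a (b : int), x = 2 ^ N * a /\ (k%:Z - oy%:Z = (2 ^ N)%:Z * b)%R) ->
      kind (y (ox + x) k) = kind (y' (ox + x) k).
    move=> [a [b [aE bE]]]; have kM : k %% 2 ^ N = oy %% 2 ^ N.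
      by apply: modn_posz => //; exists b; lia.
    have aW : a < (Wm %/ 2 ^ N).+1 by rewrite ltnS leq_divRL //; lia.
    have bG : k %/ 2 ^ N < (G %/ 2 ^ N).+1 by rewrite ltnS leq_div2r // ltnW.
    move/ffunP: e6 => /(_ (Ordinal aW, Ordinal bG)); rewrite !ffunE /= -aE.
    by rewrite -kM mulnC -divn_eq.
  have := @hierarchical_kind _ _ _ _ _ _ _ _ _ _ _ _ hier wN x (k%:Z - oy%:Z)%R xw.
  have := @hierarchical_kind _ _ _ _ _ _ _ _ _ _ _ _ hier' wN x (k%:Z - oy%:Z)%R xw.
  rewrite -kE => -[h'|/corner-> //] [h|/corner//]; by rewrite h h'.
have main x k : ox + x + 2 ^ N <= w -> k < G -> y (ox + x) k = y' (ox + x) k.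
  elim: x k => [|x IH] k xw kG.
    by apply: left; rewrite // addn0; move: oxN; rewrite /m0 !expnS; lia.
  have rl r : r < G -> rowlab (y (ox + x.+1) r) = rowlab (y' (ox + x.+1) r).
    move=> rG; rewrite addnS; have lt : ox + x < w by lia.
    case/and4P: (hr _ r lt) => _ /eqP-> _ _; case/and4P: (hr' _ r lt) => _ /eqP-> _ _.
    by rewrite IH //; lia.
  have bitE r : r < G -> bit (y (ox + x.+1) r) = bit (y' (ox + x.+1) r).
    move=> rG; have le : ox + x.+1 <= w by lia.
    case/and5P: (ok _ r le) => _ _ _ _ /and3P[_ _]; case/and5P: (ok' _ r le) => _ _ _ _ /and3P[_ _].
    rewrite -rl //; case rw : (reward _); last first.
      by rewrite !implybF => /negPf-> /negPf->.
    move=> _ _; have inr : r %% P \in reward_residues oy.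
      by apply: reward_row v hier wN _; rewrite -(rowlabE hr _ le).
    have aW := leq_ltn_trans le wW.
    have bG : r %/ P < (G %/ P).+1 by rewrite ltnS leq_div2r // ltnW.
    have cR : index (r %% P) (reward_residues oy) < hN by rewrite /hN -(size_reward_residues oy) index_mem.
    move/ffunP: e7 => /(_ (Ordinal aW, Ordinal bG, Ordinal cR)); rewrite !ffunE /= nth_index //.
    by rewrite mulnC -divn_eq.
  elim: k kG => [|k IHk] kG; first by apply: bottom; lia.
  have lt : ox + x < w by lia.
  have le : ox + x.+1 <= w by lia.
  have eW : y (ox + x) k.+1 = y' (ox + x) k.+1 by apply: IH => //; lia.
  have eS := IHk (ltnW kG).
  have := hr _ k.+1 lt; have := hr' _ k.+1 lt; rewrite -!addnS.
  case/and4P=> /eqP w1 _ /eqP w2 /eqP w3 /and4P[/eqP w1' _ /eqP w2' /eqP w3'].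
  have := vr _ k le; have := vr' _ k le; rewrite (_ : (k%:Z + 1)%R = k.+1); last by lia.
  case/and4P=> /eqP s1 /eqP s2 _ _ /and4P[/eqP s1' /eqP s2' _ _].
  apply: tile_eq; first exact: kindE.
  - by rewrite w1 w1' eW.
  - by rewrite s1 s1' eS.
  - exact: rl.
  - by rewrite s2 s2' eS.
  - by rewrite w2 w2' eW.
  - by rewrite w3 w3' eW.
  - exact: bitE.
move=> iw jG; have [lt|ge] := ltnP w (i + 2 ^ N); first exact: right.
have [le|lt] := leqP i ox; first by apply: left => //; move: oxN; rewrite /m0 !expnS; lia.
by rewrite -(subnKC (ltnW lt)); apply: main => //; lia.
Qed.
End Data.
End TileCount.

(** Codes are given by a relation because the decodings come from existence statements. *)
Lemma card_le_code (T D : finType) (S : {set T}) (Q : T -> D -> Prop) :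
  (forall x, x \in S -> exists d, Q x d) -> (forall x x' d, Q x d -> Q x' d -> x = x') ->
  #|S| <= #|D|.
Proof.
move=> ex un; have [d0|noD] := pickP (fun _ : D => true); last first.
  by have [->|[x /ex[d]]] := set_0Vmem S; [rewrite cards0 | have := noD d].
pose f x := if pselect (exists d, Q x d) is left h then projT1 (cid h) else d0.
have fP x : x \in S -> Q x (f x).
  by move=> xS; rewrite /f; case: pselect => [h|/(_ (ex x xS))//]; case: cid.
have inj : {in S &, injective f}.
  by move=> x x' xS xS' e; apply: un (fP _ xS) _; rewrite e; apply: fP.
by rewrite -(card_in_imset inj) max_card.
Qed.

Lemma expn_le_exp2 m k : m ^ k <= 2 ^ (m * k).
Proof.
by rewrite expnM; case: k => [//|k]; rewrite leq_exp2r // ltnW // ltn_expl.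
Qed.

Lemma card_product (T : finType) n1 n2 m1 m2 m3 a b d e G :
  #|{: 'I_n1 * 'I_n2 * {ffun 'I_m1 * 'I_G -> T} * {ffun 'I_m2 * 'I_G -> T} * {ffun 'I_m3 -> T} *
     {ffun 'I_a * 'I_b -> option bool} * {ffun 'I_m3 * 'I_d * 'I_e -> bool}}| <=
  n1 * n2 * 2 ^ (#|T| * ((m1 + m2) * G + m3) + 2 * (a * b) + m3 * d * e).
Proof.
rewrite !card_prod !card_ffun !card_prod !card_ord card_bool card_option card_bool.
have p3 k : 3 ^ k <= 2 ^ (2 * k) by rewrite expnM; case: k => [//|k]; rewrite leq_exp2r.
rewrite expnD (expnD _ (_ * (_ + m3))) !mulnA; apply: leq_mul => //; apply: leq_mul; last first.
  by rewrite -mulnA p3.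
rewrite -!mulnA; do 2!apply: leq_mul => //.
by rewrite !mulnA -!expnD -!mulnDl expn_le_exp2.
Qed.

Lemma card_strip_data (label : finType) N0 N D G Wm : #|{: strip_data label N0 N D G Wm}| <=
  2 ^ (2 * N.+3) * 2 ^ (#|{: tile label}| * (((2 ^ N.+3).+1 + 2 ^ N) * G + Wm) +
       2 * ((Wm %/ 2 ^ N).+1 * (G %/ 2 ^ N).+1) + Wm * (G %/ 2 ^ N0.+1).+1 * (reward_weight N0 D + 2)).
Proof.
apply: leq_trans (card_product _ _ _ _ _ _ _ _ _ _ _) _; apply: leq_mul => //.
have : (2 ^ N.+2).+1 <= 2 ^ N.+3 by rewrite [2 ^ N.+3]expnS; have := expn_gt0 2 N.+2; lia.
by move=> p2; rewrite mul2n -addnn expnD leq_mul.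
Qed.

(** * Upper bound for the number of patterns *)

Section PatternCount.
Variables (label : finType) (hor ver : rel label) (lok bot diag reward : pred label).
Variable t0 : tile label.

Let q := #|{: tile label}|.
Let tile_of a := nth t0 (enum {: tile label}) a.

Definition tile_code (t : tile label) : nat := enum_rank t.
(** Validity of single tiles is part of horizontal matching; every tile of a decoded strip has a
    neighbour, so it is tested. *)
Definition hcode a b := [&& tile_ok hor ver lok bot diag reward (tile_of a),
  tile_ok hor ver lok bot diag reward (tile_of b) & hmatch (tile_of a) (tile_of b)].
Definition vcode a b := vmatch (tile_of a) (tile_of b).

Lemma tile_codeK t : tile_of (tile_code t) = t.
Proof. exact: nth_enum_rank. Qed.

Lemma tile_code_lt t : tile_code t < q.
Proof. exact: ltn_ord. Qed.

Lemma tile_of_inj a b : a < q -> b < q -> tile_of a = tile_of b -> a = b.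
Proof.
move=> aq bq /eqP; rewrite nth_uniq -?cardE ?enum_uniq //; exact: eqP.
Qed.

Variables (A : finType) (E : rel A) (L : nat) (c : nat -> A).
Hypothesis L3 : 2 < L.
Hypothesis c_periodic : forall k, c (k + L) = c k.
Hypothesis rigid : forall d, 1 < d < L -> ~~ E (c 0) (c d).

Let M := cell_height L q.
Notation cell := (fun tau sigma rho => c (cell_row L q tau sigma rho)).
Notation column := (column L q c hcode vcode).

Let q0 : 0 < q.
Proof. by apply/card_gt0P; exists t0. Qed.

Section Upper.
Hypothesis reward_diag : forall x, reward x -> diag x.
Variables (N0 N : nat) (D : pred nat).
Hypothesis N0N : N0 < N.
Hypothesis sound : forall f, octant_ok hor ver lok bot diag N.-1 f ->
  forall k, k < N0 -> reward (f k k.+1) -> D k.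

(** A pattern is determined by the offset, the initial time, the [n] bits that tell when the clock
    ticks, and the data of its strip. *)
Lemma pattern_upper n (S : {set {ffun 'I_n.+1 * 'I_n.+1 -> A}}) :
  (forall p, p \in S -> exists X : nat -> int -> A,
    [/\ forall i, i <= n -> exists r tau sigma, column (X i) r tau sigma,
        forall i j, i < n -> E (X i j) (X i.+1 j) &
        forall k l : 'I_n.+1, p (k, l) = X k (l : nat)]) ->
  #|S| <= M * L * 2 ^ n * #|{: strip_data label N0 N D (n %/ M).+2 (n + L)}|.
Proof.
move=> pS; pose code : finType := ('I_M * 'I_L * {ffun 'I_n -> bool} *
  strip_data label N0 N D (n %/ M).+2 (n + L))%type.
suff : #|S| <= #|{: code}| by rewrite !card_prod card_ffun !card_ord card_bool.
pose w (t : nat -> nat) := t n + (L - 2).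
pose T (y : nat -> int -> nat) s J := tile_of (y s J).
pose window (p : {ffun 'I_n.+1 * 'I_n.+1 -> A}) r tau (t : nat -> nat) (y : nat -> int -> nat) :=
  [/\ [/\ r < M, tau < L & t 0 = 0], forall i, i < n -> t i.+1 = t i \/ t i.+1 = (t i).+1,
    forall s J, s <= w t -> y s J < q, valid_strip hor ver lok bot diag reward (T y) (w t) &
    forall i l : 'I_n.+1, p (i, l) = cell ((tau + t i) %% L)
      (fun theta => y (t i + slot_index L theta ((tau + t i) %% L)) ((l + r) %/ M)) ((l + r) %% M)].
pose Q (p : {ffun 'I_n.+1 * 'I_n.+1 -> A}) (d : code) := exists r tau t y ox (oy : nat), [/\ window p r tau t y,
  hierarchical hor ver lok bot diag reward (T y) (w t) N ox oy,
  r = d.1.1.1 /\ tau = d.1.1.2, d.1.2 = [ffun i : 'I_n => t i.+1 != t i] &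
  d.2 = data_of N0 N D (n %/ M).+2 (n + L) (T y) (w t) ox oy].
have M0 : 0 < M by rewrite /M /cell_height addn3.
have w_lt t : t 0 = 0 -> (forall i, i < n -> t i.+1 = t i \/ t i.+1 = (t i).+1) -> w t < n + L.
  move=> t00 ts; have : t n <= n; last by rewrite /w; lia.
  have : forall i, i <= n -> t i <= i; last exact.
  by elim=> [|i IH] lt; [rewrite t00 | have := IH (ltnW lt); case: (ts i lt) => ->; lia].
apply: (card_le_code (Q := Q)) => [p /pS[X [Xc Xe pX]]|p p' d].
  have [r [tau [t [y [[rM tL] [t00 ts] yv yh yX]]]]] := window_decode L3 q0 c_periodic rigid Xc Xe.
  have v : valid_strip hor ver lok bot diag reward (T y) (w t).
    have w1 : 0 < w t by rewrite /w; lia.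
    split=> i j iw.
    - move: iw; rewrite leq_eqVlt => /predU1P[->|iw].
        by have := yh (w t).-1 j; rewrite prednK // leqnn => /(_ isT)/and3P[].
      by have /and3P[] := yh i j iw.
    - by have /and3P[] := yh i j iw.
    - by have [_] := yv i j iw.
  have [ok hr vr] := v.
  have [ox [oy hier]] := hierarchicalP ok hr vr N.
  have [[_ oyN] _ _ _] := hier.
  have oyE : oy = `|oy|%N by lia.
  rewrite oyE in hier.
  exists (Ordinal rM, Ordinal tL, [ffun i : 'I_n => t i.+1 != t i],
     data_of N0 N D (n %/ M).+2 (n + L) (T y) (w t) ox `|oy|%N).
  exists r, tau, t, y, ox, `|oy|%N; split=> //; split=> //.
    by move=> s J sw; case: (yv s J sw).
  move=> i l; rewrite pX -(yX i _ _ (ltn_ord i)) ?ltn_pmod //; congr (X i _).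
  by have := divn_eq (l + r) M; move: (_ %/ M) (_ %% M) => a b; rewrite mulrC -PoszM; lia.
move=> [r [tau [t [y [ox [oy [[[rM tL t00] ts yq v pE] hier [rE tE] bE dE]]]]]]].
move=> [r' [tau' [t' [y' [ox' [oy' [[[rM' tL' t00'] ts' yq' v' pE'] hier' [rE' tE'] bE' dE']]]]]]].
have {rE'} er : r' = r by rewrite rE rE'.
have {tE'} et : tau' = tau by rewrite tE tE'.
subst r' tau'.
have tt i : i <= n -> t' i = t i.
  elim: i => [|i IH] lt; first by rewrite t00 t00'.
  have := IH (ltnW lt); rewrite bE in bE'; move/ffunP: bE' => /(_ (Ordinal lt)); rewrite !ffunE /=.
  by case: (ts i lt) => ->; case: (ts' i lt) => -> + -> //; rewrite eqxx gtn_eqF.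
have wE : w t' = w t by rewrite /w tt.
rewrite wE in v' hier' dE' yq'; rewrite dE in dE'.
have wl := w_lt t t00 ts.
have yE s J : s <= w t -> J < (n %/ M).+2 -> y s J = y' s J.
  move=> sw JG; apply: tile_of_inj; [exact: yq | exact: yq' |].
  exact: (data_unique reward_diag N0N sound wl v v' hier hier' dE' sw JG).
apply/ffunP => -[i l]; rewrite pE pE' tt; last by rewrite -ltnS.
apply: cell_agree => //; last by rewrite ltn_pmod.
move=> theta thL ne; apply: yE.
  have lt := slot_index_lt L3 q0 (ltn_pmod _ (ltnW (ltnW L3))) thL ne.
  have : t i <= t n; last by rewrite /w; lia.
  have : forall d, i + d <= n -> t i <= t (i + d); last first.
    have le : i <= n by rewrite -ltnS.
    by move=> mono; have := mono (n - i); rewrite (subnKC le); apply.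
  elim=> [|d' IH] le; first by rewrite addn0.
  rewrite addnS in le *; have := IH (ltnW le); move: (t i) => ti.
  by case: (ts _ le) => -> // h; apply: leqW.
rewrite ltnS; have := ltn_ord l; rewrite ltnS => ln.
have : l + r < (n %/ M).+2 * M; last by rewrite -ltn_divLR.
by have := ltn_ceil n M0; rewrite [(n %/ M).+2 * M]mulSn; lia.
Qed.
End Upper.
End PatternCount.

(** * Lower bound for the number of patterns *)

Section RewardRows.
Variables (label : finType) (lam : nat -> nat -> label) (reward : pred label).
Variables (N0 : nat) (D : pred nat).
Hypothesis D_reward : forall k, D k -> reward (lam k k.+1).

Lemma line_rewards g k : D k ->
  g %/ 2 ^ k.+2 <= #|[set j : 'I_g | reward (line_label lam j) & odo_val j == k]|.
Proof.
move=> Dk; have blk (b : 'I_(g %/ 2 ^ k.+2)) : exists j : 'I_g,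
    [/\ odo_val j = k, reward (line_label lam j) & j %/ 2 ^ k.+2 = b].
  have [t [tlt [vt nt]]] := odometer_block (2 ^ k.+2 * b)%N k.
  have jg : 2 ^ k.+2 * b + t < g.
    have := ltn_ord b; have := leq_divM g (2 ^ k.+2); nia.
  exists (Ordinal jg); rewrite /line_label /= PoszD vt nt D_reward //; split=> //.
  by rewrite mulnC divnMDl ?expn_gt0 // (divn_small tlt) addn0.
have {blk} [f fP] := choice blk.
have inj : injective f.
  by move=> b b' e; apply: val_inj; rewrite /=; have [_ _ h] := fP b; have [_ _ <-] := fP b'; rewrite -e h.
rewrite -[X in X <= _]card_ord -(card_imset _ inj); apply/subset_leq_card/fintype.subsetP => j.
by case/imsetP=> b _ ->; have [e r _] := fP b; rewrite inE r e eqxx.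
Qed.

Lemma reward_rows g : \sum_(k < N0) D k * (g %/ 2 ^ k.+2) <= #|[set j : 'I_g | reward (line_label lam j)]|.
Proof.
apply: (@leq_trans (\sum_(k < N0) #|[set j : 'I_g | reward (line_label lam j) & odo_val j == k]|)).
  by apply: leq_sum => k _; case Dk : (D k); rewrite ?mul0n // mul1n line_rewards.
under eq_bigr do rewrite -sum1dep_card big_mkcondr.
rewrite exchange_big /= -sum1dep_card; apply: leq_sum => j _.
have [lt|ge] := ltnP (odo_val j) N0; last first.
  by rewrite big1 // => k _; case: eqP => // e; move: ge; rewrite e leqNgt ltn_ord.
rewrite (bigD1 (Ordinal lt)) //= eqxx big1 // => k ne; case: eqP => // e.
by case/eqP: ne; apply: val_inj; rewrite /= e.
Qed.
End RewardRows.

Section PatternLower.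
Variables (label : finType) (hor ver : rel label) (lok bot diag reward : pred label).
Variable lam : nat -> nat -> label.
Hypothesis lamP : forall N, octant_ok hor ver lok bot diag N lam.

Let q := #|{: tile label}|.

Let t0 := odo_tile lam (fun _ _ => false) 0 0.

Notation hcode := (hcode hor ver lok bot diag reward t0).
Notation vcode := (vcode t0).

Definition odo_code free (i j : int) := tile_code (odo_tile lam free i j).

Section Free.
Variable free : int -> int -> bool.
Hypothesis freeP : forall i j, free i j -> reward (line_label lam j).

Lemma odo_code_lt i j : odo_code free i j < q.
Proof. exact: tile_code_lt. Qed.

Lemma odo_code_hor i j : hcode (odo_code free i j) (odo_code free (i + 1)%R j).
Proof.
by rewrite /hcode /odo_code !tile_codeK !(odo_tile_ok lamP freeP) odo_tile_hmatch.
Qed.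

Lemma odo_code_ver i j : vcode (odo_code free i j) (odo_code free i (j + 1)%R).
Proof. by rewrite /vcode /odo_code !tile_codeK odo_tile_vmatch. Qed.
End Free.

Variables (A : finType) (E : rel A) (L : nat) (c : nat -> A).
Hypothesis L3 : 2 < L.
Hypothesis c_periodic : forall k, c (k + L) = c k.
Hypothesis E_refl : forall k, E (c k) (c k).
Hypothesis rigid : forall d, 1 < d < L -> ~~ E (c 0) (c d).

Let M := cell_height L q.

(** The bits of the rewarded rows of cells entirely inside the window are independent, one per
    column, and [encode_inj] reads them off the pattern. *)
Lemma pattern_lower n (S : {set {ffun 'I_n * 'I_n -> A}}) :
  (forall free : int -> int -> bool, (forall i j, free i j -> reward (line_label lam j)) ->
    [ffun p : 'I_n * 'I_n => encode L q c (odo_code free) (p.1 : nat) (p.2 : nat)] \in S) ->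
  2 ^ (n * #|[set j : 'I_(n %/ M) | reward (line_label lam j)]|) <= #|S|.
Proof.
move=> inS; pose rows := [set j : 'I_(n %/ M) | reward (line_label lam j)].
pose free (B : {set 'I_n * 'I_(n %/ M)}) (i j : int) :=
  [exists p in B, (i == p.1) && (j == p.2)] && reward (line_label lam j).
have fP B i j : free B i j -> reward (line_label lam j) by case/andP.
pose pat B := [ffun p : 'I_n * 'I_n => encode L q c (odo_code (free B)) (p.1 : nat) (p.2 : nat)].
have q0 : 0 < q by apply/card_gt0P; exists t0.
have M0 : 0 < M by rewrite /M /cell_height addn3.
have freeE (B : {set _}) (p : 'I_n * 'I_(n %/ M)) : reward (line_label lam p.2) ->
    free B p.1 p.2 = (p \in B).
  move=> r; rewrite /free r andbT; apply/existsP/idP => [[[a b] /and3P[inB /eqP e1 /eqP e2]]|inB].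
    have -> : p = (a, b) by case: p e1 e2 {r} => a' b' /= [e1] [e2]; congr pair; apply: val_inj.
    by [].
  by exists p; rewrite inB !eqxx.
have inj : {in powerset (finset.setX [set: 'I_n] rows) &, injective pat}.
  have key B B' : pat B = pat B' -> B \in powerset (finset.setX [set: 'I_n] rows) ->
      forall p, p \in B -> p \in B'.
    move=> e; rewrite inE => /fintype.subsetP Bs [i J] inB.
    have := Bs _ inB; rewrite !inE /= => r.
    rewrite -(freeE B' (i, J)) // -(freeE B (i, J)) // in inB *.
    have : odo_code (free B) i (J : nat) = odo_code (free B') i (J : nat).
      apply: (encode_inj L3 q0 c_periodic E_refl rigid (hc := hcode)).
      - by move=> *; apply: odo_code_lt.
      - by move=> *; apply: odo_code_lt.
      - by move=> *; apply: odo_code_hor (fP B) _ _.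
      - by move=> *; apply: odo_code_hor (fP B') _ _.
      move=> rho rM; have lt : M * J + rho < n.
        by have := ltn_ord J; have := leq_divM n M; nia.
      by move/ffunP: e => /(_ (i, Ordinal lt)); rewrite !ffunE.
    by move/(congr1 (nth t0 (enum {: tile label}))); rewrite !tile_codeK => /(congr1 (@bit label)); rewrite /bit /= => <-.
  move=> B B' hB hB' e; apply/finset.setP => p; apply/idP/idP; exact: key.
rewrite -[X in n * X]/(#|rows|) -[X in X * _]card_ord -finset.cardsT -finset.cardsX -card_powerset -(card_in_imset inj).
apply/subset_leq_card/fintype.subsetP => p /imsetP[B _ ->]; exact: inS (fP B).
Qed.
End PatternLower.

(** * Quadratic terms of the two bounds *)

Section Growth.
Variables (M L T N0 : nat) (D : pred nat).
Hypothesis M0 : 0 < M.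

Let P := 2 ^ N0.+1.
Let H := reward_weight N0 D.

Lemma lower_growth n :
  n * H <= M * P * (\sum_(k < N0) D k * (n %/ M %/ 2 ^ k.+2)) + H * (M * P).
Proof.
rewrite /H /reward_weight mulnC big_distrl big_distrr /= [(\sum_(k < N0) _) * (M * P)]big_distrl -big_split /=.
apply: leq_sum => k _; case: (D k); rewrite ?mul0n ?muln0 // !mul1n.
have PE : P = 2 ^ k.+2 * 2 ^ (N0 - k.+1) by rewrite /P -expnD; congr (2 ^ _); have := ltn_ord k; lia.
rewrite -divnMA; set m := M * 2 ^ k.+2; have m0 : 0 < m by rewrite muln_gt0 M0 expn_gt0.
have -> : M * P = m * 2 ^ (N0 - k.+1) by rewrite PE mulnA.
have r0 : 0 < 2 ^ (N0 - k.+1) by rewrite expn_gt0.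
have := ltn_ceil n m0; move: (2 ^ (N0 - k.+1)) r0 (n %/ m) => r r0 d lt.
have : n <= m * d + m * r by nia.
by nia.
Qed.

(** The excess 3 over the weight [H] comes from the two residues of undetermined rows in
    [reward_residues] and from the kinds at the corners of level [N], which contribute at most 1
    because [2 * (M * P) <= 4 ^ N]. All other terms are linear in [n]. *)
Lemma upper_growth N : 2 * (M * P) <= 2 ^ N * 2 ^ N -> exists C, forall n,
  M * P * (M * L + n + 2 * N.+3 + T * (((2 ^ N.+3).+1 + 2 ^ N) * (n %/ M).+2 + (n + L)) +
       2 * (((n + L) %/ 2 ^ N).+1 * ((n %/ M).+2 %/ 2 ^ N).+1) +
       (n + L) * ((n %/ M).+2 %/ P).+1 * (H + 2)) <= n * n * (H + 3) + C * n.+1.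
Proof.
move=> big; have P0 : 0 < P by rewrite expn_gt0.
move: H (2 ^ N.+3).+1 (2 * N.+3) => h s x; have N2 : 0 < 2 ^ N by rewrite expn_gt0.
move: (2 ^ N) N2 big => z z0 big; move: P P0 big => p p0 big.
pose K := 2 * M + M * p; pose A := T * (s + z); pose A' := A + T + 1.
exists (M * p * (M * L + x + T * L + A * 2 + A') + (L + z) * (2 + z) + (L + z + 2 + z) + (h + 2) * (L * K + L + K)) => n.
have g1 : n %/ M <= n by apply: leq_div.
have g2 : n %/ M * M <= n by apply: leq_divM.
have term1 : M * p * (M * L + n + x + T * ((s + z) * (n %/ M).+2 + (n + L))) <=
    M * p * (M * L + x + T * L + A * 2 + A') * n.+1.
  rewrite -[X in _ <= X]mulnA leq_mul2l; apply/orP; right.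
  have -> : T * ((s + z) * (n %/ M).+2 + (n + L)) = A * (n %/ M) + A * 2 + T * n + T * L.
    by rewrite /A; lia.
  have : A * (n %/ M) <= A * n by rewrite leq_mul2l g1 orbT.
  have := leq0n ((M * L + x + T * L + A * 2) * n); rewrite /A'; lia.
have u1 : ((n + L) %/ z).+1 * z <= n + L + z by rewrite mulSn; have := leq_divM (n + L) z; lia.
have v1 : ((n %/ M).+2 %/ z).+1 * z <= n + 2 + z.
  by rewrite mulSn; have := leq_divM (n %/ M).+2 z; lia.
have term2 : M * p * (2 * (((n + L) %/ z).+1 * ((n %/ M).+2 %/ z).+1)) <=
    n * n + ((L + z) * (2 + z) + (L + z + 2 + z)) * n.+1.
  move: (_ %/ z).+1 (_ %/ z).+1 u1 v1 => u v u1 v1.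
  apply: (@leq_trans ((n + L + z) * (n + 2 + z))); last first.
    by have := leq0n ((L + z) * (2 + z) * n); lia.
  have := leq_mul u1 v1; have := leq_mul big (leqnn (u * v)).
  by move: (n + L + z) (n + 2 + z) => a b; lia.
have w1 : M * p * ((n %/ M).+2 %/ p).+1 <= n + K.
  have := leq_divM (n %/ M).+2 p; move: (_ %/ p) => e; move: (n %/ M) g2 => d g2 e1.
  have : M * (e * p) <= M * d.+2 by rewrite leq_mul2l e1 orbT.
  by rewrite /K; lia.
have term3 : M * p * ((n + L) * ((n %/ M).+2 %/ p).+1 * (h + 2)) <=
    n * n * (h + 2) + (h + 2) * (L * K + L + K) * n.+1.
  move: (_ %/ p).+1 w1 => e w1.
  apply: (@leq_trans ((n + L) * (n + K) * (h + 2))).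
    have : (n + L) * (h + 2) * (M * p * e) <= (n + L) * (h + 2) * (n + K).
      by rewrite leq_mul2l w1 orbT.
    by lia.
  have : (n + L) * (n + K) <= n * n + (L * K + L + K) * n.+1.
    by have := leq0n (L * K * n); lia.
  by move/(leq_mul (leqnn (h + 2))); lia.
by rewrite !mulnDr in term1 term2 term3 *; lia.
Qed.
End Growth.

(** * Entropy *)

Section Limits.
Local Open Scope ring_scope.

Lemma exists_div_lt (R : realType) (C e : R) : 0 < e ->
  exists N, forall n, (N < n)%N -> `|C| / n%:R < e.
Proof.
move=> e0; have h := archi_boundP (divr_ge0 (normr_ge0 C) (ltW e0)).
exists (Num.Def.archi_bound (`|C| / e)) => n lt.
have n0 : 0 < n%:R :> R by rewrite ltr0n; apply: leq_ltn_trans lt.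
rewrite ltr_pdivrMr // mulrC -ltr_pdivrMr //; apply: (lt_trans h).
by rewrite ltr_nat.
Qed.

Lemma le_of_div_le (R : realType) (x y C : R) :
  (forall n, (0 < n)%N -> x <= y + C / n%:R) -> x <= y.
Proof.
move=> h; rewrite leNgt; apply/negP => yx.
have [N NP] := exists_div_lt C (e := x - y) ltac:(lra).
have := NP N.+1 (ltnSn N); have := h N.+1 isT.
have : C / N.+1%:R <= `|C| / N.+1%:R by rewrite ler_pM2r ?invr_gt0 ?ltr0n // ler_norm.
by move: (C / _) (`|C| / _) => b b'; lra.
Qed.

(** Letting [n] grow in the bounds for two indices shows that each [v m] is at most
    [v m' + K / 2 ^+ m']; the limit is the supremum of the [v m]. *)
Lemma window_limit (R : realType) (u v : nat -> R) (K : R) : 0 < K ->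
  (forall m, exists C : R, forall n, (0 < n)%N ->
    v m - C / n%:R <= u n <= v m + K / 2 ^+ m + C / n%:R) ->
  exists l, (u @ \oo --> l)%classic /\ forall m, v m <= l <= v m + K / 2 ^+ m.
Proof.
move=> K0 h; have vv m m' : v m <= v m' + K / 2 ^+ m'.
  have [C hC] := h m; have [C' hC'] := h m'; apply: (@le_of_div_le _ _ _ (C + C')) => n n0.
  have /andP[h1 _] := hC n n0; have /andP[_ h2] := hC' n n0.
  by move: h1 h2; rewrite mulrDl; move: (C / _) (C' / _) (K / _) => b b' k; lra.
pose S := [set v m | m in [set: nat]]%classic; pose l := sup S.
have supS : has_sup S.
  split; first by exists (v 0%N), 0%N.
  by exists (v 0%N + K / 2 ^+ 0) => _ [m _ <-].
have lP m : v m <= l <= v m + K / 2 ^+ m.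
  apply/andP; split; first by apply: sup_upper_bound => //; exists m.
  by apply: ge_sup; [case: supS | move=> _ [k _ <-]].
exists l; split=> //; apply/cvgrPdist_le => e e0.
have e2 : 0 < e / 2 by lra.
have [m mP] := exists_div_lt K e2.
have Km : K / 2 ^+ m.+1 < e / 2.
  apply: le_lt_trans (mP _ (ltnSn m)); rewrite (gtr0_norm K0) ler_pM2l //.
  rewrite lef_pV2 ?posrE ?ltr0n ?exprn_gt0 // -natrX ler_nat; exact/ltnW/ltn_expl.
have [C hC] := h m.+1; have [N NP] := exists_div_lt C e2.
exists N.+1 => // n /= Nn; have n0 : (0 < n)%N by apply: leq_ltn_trans Nn.
have := NP n Nn; have /andP[] := hC n n0; have /andP[] := lP m.+1.
have : C / n%:R <= `|C| / n%:R by rewrite ler_pM2r ?invr_gt0 ?ltr0n // ler_norm.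
by move: (C / _) (`|C| / _) => b b'; rewrite ler_norml; lra.
Qed.

Lemma log2_expn (R : realType) k : ln (2 ^ k)%:R / ln 2 = k%:R :> R.
Proof.
by rewrite natrX lnXn ?ltr0n // -[_ *+ k]mulr_natl mulfK // gt_eqF // ln_gt0 // ltr1n.
Qed.

Lemma log2_le (R : realType) a b : (0 < a)%N -> (a <= b)%N ->
  ln a%:R / ln 2 <= ln b%:R / ln 2 :> R.
Proof.
move=> a0 ab; rewrite ler_pM2r ?invr_gt0 ?ln_gt0 ?ltr1n //.
by rewrite ler_ln ?posrE ?ltr0n ?ler_nat // (leq_trans a0).
Qed.

Section Entropy.
Variables (R : realType) (a : nat -> nat) (M L T : nat) (D : pred nat).
Hypothesis M0 : (0 < M)%N.
Hypothesis a_lower : forall n N0, (2 ^ (n * \sum_(k < N0) D k * (n %/ M %/ 2 ^ k.+2)) <= a n)%N.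
Hypothesis a_upper : forall N0, exists N1, forall N n, (N0 < N)%N -> (N1 <= N)%N ->
  (a n.+1 <= 2 ^ (M * L + n + 2 * N.+3 + T * (((2 ^ N.+3).+1 + 2 ^ N) * (n %/ M).+2 + (n + L)) +
       2 * (((n + L) %/ 2 ^ N).+1 * ((n %/ M).+2 %/ 2 ^ N).+1) +
       (n + L) * ((n %/ M).+2 %/ 2 ^ N0.+1).+1 * (reward_weight N0 D + 2)))%N.

Lemma entropy_limit : exists l : R,
  ((fun n => ln (a n)%:R / ln 2 / n%:R ^+ 2 : R) @ \oo --> l)%classic /\
  forall N0, (reward_weight N0 D)%:R <= l * (M * 2 ^ N0.+1)%:R <= (reward_weight N0 D)%:R + 3%:R.
Proof.
have [Q QE] : exists Q : nat -> R, forall N0, Q N0 = (M * 2 ^ N0.+1)%:R by eexists.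
have Q0 N0 : 0 < Q N0 by rewrite QE ltr0n muln_gt0 M0 expn_gt0.
have M0R : 0 < M%:R :> R by rewrite ltr0n.
pose v N0 : R := (reward_weight N0 D)%:R / Q N0.
have [K [K0 KE]] : exists K : R, 0 < K /\ forall N0, K / 2 ^+ N0 = 3 / Q N0.
  exists (3 / 2 / M%:R); split=> [|N0]; first by rewrite !divr_gt0.
  by rewrite QE natrM natrX exprS; field; rewrite ?gt_eqF ?exprn_gt0 ?ltr0n.
have [|l [cv lP]] := @window_limit R (fun n => ln (a n)%:R / ln 2 / n%:R ^+ 2) v K K0.
  move=> N0; have [N1 N1P] := a_upper N0.
  (* The three terms serve, in this order, the condition [N0 < N], the bound [a_upper], and the
     inequality of [upper_growth]. *)
  pose N := maxn N0.+1 (maxn N1 (M * 2 ^ N0.+1)).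
  have big : (2 * (M * 2 ^ N0.+1) <= 2 ^ N * 2 ^ N)%N.
    have lt : (M * 2 ^ N0.+1 < 2 ^ N)%N.
      by apply: leq_ltn_trans (ltn_expl N _) => //; rewrite !leq_max leqnn !orbT.
    have : (2 <= 2 ^ N)%N by apply: leq_trans lt; rewrite ltnS muln_gt0 M0 expn_gt0.
    by move/leq_mul; apply; apply: ltnW.
  have [C CP] := upper_growth L T D M0 big.
  exists ((reward_weight N0 D)%:R + C%:R / Q N0) => n n0.
  have n0R : 0 < n%:R :> R by rewrite ltr0n.
  set x := ln (a n)%:R / ln 2.
  have nn : n%:R != 0 :> R by rewrite gt_eqF.
  have Qn : Q N0 != 0 by rewrite gt_eqF.
  have lower : n%:R * n%:R * (reward_weight N0 D)%:R <=
      Q N0 * x + n%:R * (reward_weight N0 D)%:R * Q N0.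
    have := log2_le R (expn_gt0 2 _ : (0 < 2 ^ _)%N) (a_lower n N0); rewrite log2_expn -/x.
    have := lower_growth N0 D M0 n; set s := \sum_(k < N0) _ => h1 h2.
    have h3 : n%:R * (reward_weight N0 D)%:R <= Q N0 * s%:R + (reward_weight N0 D)%:R * Q N0.
      by rewrite QE -!natrM -natrD ler_nat.
    have h4 : Q N0 * (n%:R * s%:R) <= Q N0 * x by rewrite -natrM ler_pM2l.
    by move: h3; rewrite -(ler_pM2l n0R); lra.
  have upper : Q N0 * x <= n%:R * n%:R * ((reward_weight N0 D)%:R + 3) + C%:R * n%:R.
    case: n n0 @x n0R nn lower => // n _ x n0R nn _.
    have := log2_le R _ (N1P N n _ _); rewrite log2_expn -/x.
    have an : (0 < a n.+1)%N by apply: leq_trans (a_lower n.+1 N0); rewrite expn_gt0.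
    have lt1 : (N0 < N)%N by rewrite /N leq_max leqnn.
    have lt2 : (N1 <= N)%N by rewrite /N !leq_max leqnn orbT.
    move=> /(_ an lt1 lt2) h1.
    have := CP n; rewrite -(ler_nat R) natrM -QE.
    set B := (_ + _)%:R in h1 *; rewrite -(ler_pM2l (Q0 N0)) in h1.
    move=> h2; apply: (le_trans h1); apply: (le_trans h2).
    rewrite !natrD !natrM !natrD; have : n%:R <= n.+1%:R :> R by rewrite ler_nat.
    have : 0 <= n%:R :> R by [].
    have : 0 <= (reward_weight N0 D)%:R :> R by [].
    move: n%:R n.+1%:R (reward_weight N0 D)%:R C%:R => y z w C' w0 y0 yz.
    rewrite lerD2r ler_pM //; [exact: mulr_ge0 | by lra | exact: ler_pM].
  have HE : n%:R ^+ 2 * v N0 * Q N0 = n%:R * n%:R * (reward_weight N0 D)%:R.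
    by rewrite /v; field.
  rewrite -/x KE; apply/andP; split.
    rewrite ler_pdivlMr ?exprn_gt0 // -(ler_pM2r (Q0 N0)).
    have : 0 <= C%:R / Q N0 / n%:R * n%:R ^+ 2 * Q N0.
      by rewrite !mulr_ge0 // ?invr_ge0 ?ltW // ?exprn_gt0.
    have -> : (v N0 - ((reward_weight N0 D)%:R + C%:R / Q N0) / n%:R) * n%:R ^+ 2 * Q N0 =
       n%:R ^+ 2 * v N0 * Q N0 - n%:R * (reward_weight N0 D)%:R * Q N0 - C%:R / Q N0 / n%:R * n%:R ^+ 2 * Q N0.
      by field; rewrite ?Qn ?nn.
    by rewrite HE; lra.
  rewrite ler_pdivrMr ?exprn_gt0 // -(ler_pM2r (Q0 N0)).
  have -> : (v N0 + 3 / Q N0 + ((reward_weight N0 D)%:R + C%:R / Q N0) / n%:R) * n%:R ^+ 2 * Q N0 =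
     n%:R ^+ 2 * v N0 * Q N0 + 3 * (n%:R * n%:R) + n%:R * (reward_weight N0 D)%:R * Q N0 + C%:R * n%:R.
    by field; rewrite ?Qn ?nn.
  have : 0 <= n%:R * (reward_weight N0 D)%:R * Q N0 by rewrite !mulr_ge0 // ltW.
  by rewrite HE; lra.
exists l; split=> // N0; have := lP N0; rewrite KE /v -mulrDl -QE.
by rewrite ler_pdivrMr // ler_pdivlMr.
Qed.
End Entropy.
End Limits.

(** * Reading the digits of the entropy *)

Section NotComputable.
Variables (R : realType) (M : nat) (l : R) (D : pred nat).
Hypothesis M0 : 0 < M.
Hypothesis l_window : forall N0,
  ((reward_weight N0 D)%:R <= l * (M * 2 ^ N0.+1)%:R <= (reward_weight N0 D)%:R + 3%:R)%R.
Hypothesis D4 : forall j, ~~ (4 %| j) -> ~~ D j.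

Lemma mul_exp2_le m k : m * 2 ^ k <= 2 ^ (m + k).
Proof. by rewrite expnD leq_mul2r; apply/orP; right; apply/ltnW/ltn_expl. Qed.

(** The places of weight 4, 2 and 1 belong to the three numbers after [4 * k], where [D]
    vanishes. *)
Lemma reward_weight_digit k : exists A, reward_weight (4 * k).+4 D = 16 * A + 8 * D (4 * k).
Proof.
have Dn i : 0 < i < 4 -> D (4 * k + i) = false by move=> lt; apply/negbTE/D4; lia.
rewrite /reward_weight !big_ord_recr /= -(addn3 (4 * k)) -(addn2 (4 * k)) -(addn1 (4 * k)) !Dn //.
rewrite !mul0n !addn0 (_ : _ - (4 * k + 1) = 3); last by lia.
exists (\sum_(j < 4 * k) D j * 2 ^ (4 * k - j.+1)); rewrite big_distrr [8 * _]mulnC /=; congr (_ + _ * _).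
apply: eq_bigr => j _; rewrite mulnCA; congr (_ * _).
by rewrite -[16]/(2 ^ 4) -expnD; congr (2 ^ _); have := ltn_ord j; lia.
Qed.

Lemma recursive_computable_fun f : computable_fun f -> recursive 1 (fun e => f (e 0)).
Proof.
move=> [c cP]; exists c => x; have := cP (nth 0 x 0); congr (computes c _ _).
by apply: val_inj; case: x => -[|a []].
Qed.

Lemma digit_recursive : computable_real l ->
  exists d, recursive 1 (fun e => d (e 0)) /\ forall k, d k = D (4 * k).
Proof.
move=> [s [a [b [/recursive_computable_fun rs /recursive_computable_fun ra /recursive_computable_fun rb ab]]]].
(* The weight is a multiple of 8 and the window for the entropy has length 3, so
   an approximation up to 1 determines the binary digit [D (4 * k)] of weight 8. *)
pose prec k := M + (4 * k + 5).
(* As [l] is nonnegative, a negative approximation may be replaced by 0. After scaling by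
   [M * 2 ^ (4 * k + 5)], at most [2 ^ prec k], the error is at most 1, so the quotient lies between
   [H - 1] and [H + 4] for the weight [H]; adding 2 keeps it in the same block of 8 as [H]. *)
pose d k := ((if odd (s (prec k)) then 0 else
  (M * 2 ^ (4 * k + 5) * a (prec k)) %/ (b (prec k)).+1) + 2) %/ 8 %% 2.
exists d; split.
  have rp : recursive 1 (fun e => prec (e 0)) by rewrite /prec; rec'.
  have rs' := recursive_comp1 rs rp; have ra' := recursive_comp1 ra rp; have rb' := recursive_comp1 rb rp.
  rewrite /d; apply: recursive_mod; last exact: recursive_const.
  apply: recursive_div; last exact: recursive_const.
  apply: recursive_add; last exact: recursive_const.
  apply: (recursive_if (P := fun e => odd (s (prec (e 0))))); last 2 first.
  - exact: recursive_const.
  - by apply: recursive_div; [apply: recursive_mul; [rec' | exact: ra'] | apply: recursive_succ].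
  apply: (@recursive_ext _ (fun e => s (prec (e 0)) %% 2)) => [e|]; first by rewrite modn2.
  by apply: recursive_mod; [exact: rs' | exact: recursive_const].
move=> k; have [A HE] := reward_weight_digit k.
have := l_window (4 * k).+4; rewrite HE; set H := 16 * A + _.
have QE : M * 2 ^ (4 * k).+4.+1 = M * 2 ^ (4 * k + 5) by congr (_ * 2 ^ _); lia.
rewrite QE; have := ab (prec k).
pose a' := if odd (s (prec k)) then 0 else a (prec k); pose b' := (b (prec k)).+1.
set Q := M * 2 ^ _; have Q0 : 0 < Q by rewrite muln_gt0 M0 expn_gt0.
have b0 : (0 < b'%:R :> R)%R by rewrite ltr0n.
have Q0R : (0 < Q%:R :> R)%R by rewrite ltr0n.
move=> h1 /andP[h2 h3].
have l0 : (0 <= l)%R by rewrite -(pmulr_lge0 _ Q0R); apply: le_trans h2; rewrite ler0n.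
have Qprec : (Q%:R <= 2 ^+ prec k :> R)%R by rewrite -natrX ler_nat; apply: mul_exp2_le.
have {h1} h1 : (`|l - a'%:R / b'%:R| <= 2 ^- prec k)%R.
  move: h1; rewrite /a' -signr_odd; case: (odd _); last by rewrite expr0 mul1r.
  rewrite expr1 mulN1r mul0r subr0 mulNr opprK (ger0_norm l0).
  have c0 : (0 <= (a (prec k))%:R / b'%:R :> R)%R by rewrite divr_ge0.
  by apply: le_trans; rewrite ger0_norm ?lerDl // addr_ge0.
have {h1} : (`|l * Q%:R - (Q * a')%:R / b'%:R| <= 1)%R.
  rewrite natrM mulrC -mulrA -mulrBr normrM (gtr0_norm Q0R).
  apply: (@le_trans _ _ (Q%:R * 2 ^- prec k)%R); first by rewrite ler_pM2l.
  by rewrite ler_pdivrMr ?exprn_gt0 // mul1r.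
have dE : d k = ((Q * a') %/ b' + 2) %/ 8 %% 2.
  by rewrite /d /a'; case: ifP => // _; rewrite muln0 div0n.
rewrite dE ler_distlC => /andP[h4 h5].
set z := ((Q * a')%:R / b'%:R : R)%R in h4 h5; pose t := (Q * a') %/ b'.
have t1 : (t%:R <= z)%R by rewrite /z ler_pdivlMr // -natrM ler_nat leq_divM.
have t2 : (z < t.+1%:R)%R by rewrite /z ltr_pdivrMr // -natrM ltr_nat ltn_ceil.
rewrite -/t.
have t3 : t <= H + 4 by rewrite -(ler_nat R) natrD; lra.
have t4 : H < t + 2 by rewrite -(ltr_nat R) natrD; move: t2; rewrite -natr1; lra.
move: t3 t4; rewrite /H; clearbody t; clear; move: (D _) => dk.
by case: dk; lia.
Qed.
End NotComputable.

(** * The algorithm *)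

Lemma recursive_subst2 n P a :
  recursive n.+1 (fun e => P (e 0) (fun i => e i.+1)) -> recursive n.+2 a ->
  recursive n.+2 (fun e => P (a e) (fun i => e i.+2)).
Proof.
move=> [c cP] [ca caP].
exists (RComp c (fun i : 'I_n.+1 => if unlift ord0 i is Some j then RProj (lift ord0 (lift ord0 j)) else ca)) => x.
case: x (caP x) => -[//|a0 [//|b s]] sz ax.
have sz' : size (a (nth 0 (a0 :: b :: s)) :: s) == n.+1 by exact: sz.
exists (Tuple sz'); split=> [i|]; last exact: (cP (Tuple sz')).
by rewrite !(tnth_nth 0) /=; case: unliftP => [j|] -> //=; rewrite (tnth_nth 0).
Qed.

(** Codes grow at the head, so the recursion visits the indices from the last to the first. *)
Lemma recursive_code_filter n P f k :
  recursive n.+1 (fun e => (P (e 0) (fun i => e i.+1) : bool)) ->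
  recursive n.+1 (fun e => f (e 0) (fun i => e i.+1)) -> recursive n k ->
  recursive n (fun e => CodeSeq.code [seq f i e | i <- iota 0 (k e) & P i e]).
Proof.
move=> rP rf rk; apply: (@recursive_ext _ (fun e => nat_rect (fun=> nat) 0
  (fun j s => (fun j s e => if P (k e - j.+1) e then 2 ^ f (k e - j.+1) e * s.*2.+1 else s) j s e) (k e))) => [e|].
  have : forall j, j <= k e -> nat_rect (fun=> nat) 0
    (fun j s => if P (k e - j.+1) e then 2 ^ f (k e - j.+1) e * s.*2.+1 else s) j =
      CodeSeq.code [seq f i e | i <- iota (k e - j) j & P i e].
    elim=> // j IH lt; rewrite [LHS]/= IH ?(ltnW lt) //.
    have -> : iota (k e - j.+1) j.+1 = (k e - j.+1) :: iota (k e - j) j.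
      by rewrite /=; congr (_ :: iota _ _); lia.
    by rewrite /=; case: ifP.
  by move/(_ _ (leqnn _)); rewrite subnn.
have rk2 : recursive n.+2 (fun e => k (fun i => e i.+2) - (e 0).+1).
  by apply: recursive_sub; [exact: (recursive_shift (recursive_shift rk)) | rec].
apply: recursive_prec => //; first exact: recursive_const.
apply: (recursive_if (P := fun e => P (k (fun i => e i.+2) - (e 0).+1) (fun i => e i.+2))).
- exact: (recursive_subst2 (P := P)).
- by apply: recursive_code_cons; [exact: (recursive_subst2 (P := f)) | rec].
- exact: recursive_var.
Qed.

Lemma recursive_code_map n f k :
  recursive n.+1 (fun e => f (e 0) (fun i => e i.+1)) -> recursive n k ->
  recursive n (fun e => CodeSeq.code [seq f i e | i <- iota 0 (k e)]).
Proof.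
move=> rf rk; have := recursive_code_filter (P := fun _ _ => true) (recursive_const _ 1) rf rk.
by apply: recursive_ext => e; rewrite filter_predT.
Qed.

(** The search returns the least witness, which may differ from the given one; the conclusion is
    therefore about some [u']. *)
Lemma recursive_mu P out : recursive 2 (fun e => (P (e 0) (e 1) : bool)) ->
  recursive 2 (fun e => out (e 0) (e 1)) -> exists algo : recfun 1, forall x u,
    P u x -> exists2 u', P u' x & computes algo [tuple x] (out u' x).
Proof.
move=> rP [co coP]; have [c cP] := recursive_neg rP.
exists (RComp co (fun i : 'I_2 => if i == ord0 then RMu c else RProj ord0)) => x u Pu.
have ex : exists u, P u x by exists u.
case: (ex_minnP ex) => u' Pu' min; exists u' => //; exists [tuple u'; x]; split; last exact: (coP [tuple u'; x]).
move=> i; case: eqP => [->|ne]; last first.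
  have -> : i = lift ord0 ord0 by case: i ne => -[|[|//]] // lt ne; [case: ne|]; apply: val_inj.
  by rewrite !(tnth_nth 0).
rewrite (tnth_nth 0) /=; split.
  by have := cP [tuple u'; x]; rewrite /= Pu'; congr computes; apply: val_inj.
move=> k lt; exists 0; have := cP [tuple k; x]; rewrite /=.
have -> : P k x = false by apply/negP => /min; rewrite leqNgt lt.
by congr computes; apply: val_inj.
Qed.

Lemma recursive_odd n a : recursive n a -> recursive n (fun e => odd (a e)).
Proof.
move=> ra; have : recursive n (fun e => a e %% 2) by rec.
by apply: recursive_ext => e; rewrite modn2.
Qed.

Lemma recursive_double n a : recursive n a -> recursive n (fun e => (a e).*2).
Proof.
move=> ra; have : recursive n (fun e => a e + a e) by rec.
by apply: recursive_ext => e; rewrite addnn.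
Qed.

(** The tile rules are fixed relations on a finite range, hence finite tables; their definitions
    need not be analysed. *)
Lemma recursive_table (f : nat -> nat -> bool) q n a b :
  (forall e, a e < q) -> (forall e, b e < q) ->
  recursive n a -> recursive n b -> recursive n (fun e => f (a e) (b e)).
Proof.
move=> aq bq ra rb; pose s := [seq p <- [seq (i, j) | i <- iota 0 q, j <- iota 0 q] | f p.1 p.2].
apply: (@recursive_ext _ (fun e => has (fun p => (a e == p.1) && (b e == p.2)) s)) => [e|].
  congr nat_of_bool; apply/hasP/idP => [[p] | fab].
    by rewrite mem_filter => /andP[fp _] /andP[/eqP-> /eqP->].
  exists (a e, b e); rewrite /= ?eqxx // mem_filter fab.
  by apply: allpairs_f; rewrite mem_iota add0n ?aq ?bq.
elim: s => [|p s IH]; first exact: recursive_const.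
by apply: (recursive_or (P := fun e => (a e == p.1) && (b e == p.2)) _ IH); rec.
Qed.

Definition digit b t k := t %/ b ^ k %% b.

Opaque code_nth.

(** * Finding a cycle and listing the forbidden words *)

Section Program.
Variables (q : nat) (hc vc : nat -> nat -> bool).
Hypothesis q0 : 0 < q.

Definition letters x := code_nth x 0.
(** The number [x] bounds the length of the sequence it codes, so it can bound the search. *)
Definition forbidden x a b := has (fun i => code_nth x i.+1 == CodeSeq.code [:: a; b]) (iota 0 x).
Definition separated x a b := forbidden x a b && (a != b).

Definition cycle_len u := code_nth u 0.
Definition cycle_vertex u k := code_nth u (k %% cycle_len u).+1.

(** This inspects the forbidden words and not the Rauzy graph: by [allowed_cycle_edge], an allowed
    pair of vertices of a cycle of allowed words is an edge. *)
Definition cycle_ok u x :=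
  [&& 2 < cycle_len u,
      all (fun k => cycle_vertex u k < letters x) (iota 0 (cycle_len u)),
      all (fun k => ~~ forbidden x (cycle_vertex u k) (cycle_vertex u k.+1)) (iota 0 (cycle_len u)) &
      all (fun d => (1 < d) ==> separated x (cycle_vertex u 0) (cycle_vertex u d)) (iota 0 (cycle_len u))].

(** The decidable form of [good_word]: the word is given by the digits of [t], and the three states
    by the base-[q] digits of numbers below [q ^ L]. *)
Definition good_code u x t :=
  let L := cycle_len u in
  has (fun r => has (fun tau => has (fun s0 => has (fun s1 => has (fun s2 =>
    state_ok L q hc tau (digit q s0) && state_ok L q hc tau (digit q s1) &&
    state_ok L q hc tau (digit q s2) && stack_ok L vc tau (digit q s0) (digit q s1) &&
    stack_ok L vc tau (digit q s1) (digit q s2) &&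
    all (fun k => digit (letters x) t k == cycle_vertex u (cell_row L q tau
      (digit q (let i := (r + k) %/ cell_height L q in if i == 0 then s0 else if i == 1 then s1 else s2))
      ((r + k) %% cell_height L q))) (iota 0 (cell_height L q).*2))
    (iota 0 (q ^ L))) (iota 0 (q ^ L))) (iota 0 (q ^ L))) (iota 0 L)) (iota 0 (cell_height L q)).

Definition word_code u x t :=
  CodeSeq.code [seq digit (letters x) t k | k <- iota 0 (cell_height (cycle_len u) q).*2].

Definition output u x := CodeSeq.code (letters x ::
  [seq word_code u x t | t <- iota 0 (letters x ^ (cell_height (cycle_len u) q).*2) & ~~ good_code u x t]).

Lemma digit_lt s k : digit q s k < q.
Proof. by rewrite ltn_mod. Qed.

Lemma recursive_forbidden n x a b : recursive n x -> recursive n a -> recursive n b ->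
  recursive n (fun e => forbidden (x e) (a e) (b e)).
Proof.
move=> rx ra rb; apply: (recursive_comp3 (F := forbidden)) => //; rewrite /forbidden /=.
apply: (recursive_has (P := fun i e => code_nth (e 0) i.+1 == _)); last exact: recursive_var.
apply: recursive_eq; first by rec'.
by do 2![apply: recursive_code_cons; first exact: recursive_var]; exact: recursive_const.
Qed.

Ltac rec1'' :=
  match goal with
  | |- recursive _ (fun e => (@?a e)./2) => apply: (recursive_half (a := a))
  | |- recursive _ (fun e => (@?a e).*2) => apply: (recursive_double (a := a))
  | |- recursive _ (fun e => nat_of_bool (odd (@?a e))) => apply: (recursive_odd (a := a))
  | |- recursive _ (fun e => nat_of_bool (hc (@?a e) (@?b e))) =>
      apply: (@recursive_table hc q _ a b) => [?|?||]; try exact: digit_lt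
  | |- recursive _ (fun e => nat_of_bool (vc (@?a e) (@?b e))) =>
      apply: (@recursive_table vc q _ a b) => [?|?||]; try exact: digit_lt
  | |- recursive _ (fun e => digit (@?a e) (@?b e) (@?c e)) => rewrite /digit
  | |- recursive _ (fun e => nat_of_bool (forbidden (@?x e) (@?a e) (@?b e))) =>
      apply: (recursive_forbidden (x := x) (a := a) (b := b))
  | |- _ => rec1'
  end.
Ltac rec'' := repeat (cbv beta; rec1'').

Lemma recursive_cycle_ok : recursive 2 (fun e => cycle_ok (e 0) (e 1)).
Proof.
rewrite /cycle_ok /separated /cycle_vertex /letters /cycle_len.
by rec''.
Qed.

Lemma recursive_good_code : recursive 3 (fun e => good_code (e 1) (e 2) (e 0)).
Proof.
rewrite /good_code /state_ok /stack_ok /cell_row /cyc_succ /cell_height /cell_data /logical_row.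
rewrite /cycle_vertex /letters /cycle_len; cbv zeta.
by rec''.
Qed.

Lemma recursive_output : recursive 2 (fun e => output (e 0) (e 1)).
Proof.
have rh n u : recursive n u -> recursive n (fun e => (cell_height (cycle_len (u e)) q).*2).
  by move=> ru; rewrite /cell_height /cell_data /cycle_len; rec''.
have rw : recursive 3 (fun e => word_code (e 1) (e 2) (e 0)).
  apply: (recursive_code_map (f := fun k e => digit (letters (e 2)) (e 0) k) (k := fun e => (cell_height (cycle_len (e 1)) q).*2)).
    by rewrite /letters; rec''.
  by apply: rh; rec''.
apply: recursive_code_cons; first by rewrite /letters; rec''.
apply: (recursive_code_filter (P := fun t e => ~~ good_code (e 0) (e 1) t) (f := fun t e => word_code (e 0) (e 1) t)
  (k := fun e => letters (e 1) ^ (cell_height (cycle_len (e 0)) q).*2)) => //.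
  by apply: recursive_neg; exact: recursive_good_code.
apply: recursive_exp; first by rewrite /letters; rec''.
by apply: rh; rec''.
Qed.

Lemma program_exists : exists algo : recfun 1, forall x u, cycle_ok u x ->
  exists2 u', cycle_ok u' x & computes algo [tuple x] (output u' x).
Proof. exact: recursive_mu recursive_cycle_ok recursive_output. Qed.
End Program.

Lemma size_code s : size s <= CodeSeq.code s.
Proof.
elim: s => //= x s IH; rewrite /CodeSeq.code /= -/(CodeSeq.code s).
by have := expn_gt0 2 x; move: (2 ^ x) (CodeSeq.code s) IH => a b IH a0; nia.
Qed.

Lemma digits_exist b n (s : nat -> nat) : 0 < b -> exists2 t, t < b ^ n &
  forall k, k < n -> digit b t k = s k %% b.
Proof.
move=> b0; elim: n s => [|n IH] s; first by exists 0.
have [t tn tP] := IH (fun k => s k.+1); exists (s 0 %% b + b * t).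
  by rewrite expnS; have := ltn_pmod (s 0) b0; nia.
case=> [_|k lt]; rewrite /digit.
  by rewrite expn0 divn1 addnC mulnC modnMDl modn_mod.
by rewrite -tP // /digit expnS divnMA addnC [b * t]mulnC divnMDl // (divn_small (ltn_pmod _ b0)) addn0.
Qed.

(** * The output as a subshift of finite type *)

Section Words.
Variables (A : finType) (a0 : A) (F : seq (seq A)).

Let x := code_sft F.

Definition letter a := nth a0 (enum A) a.

Lemma letter_rank a : letter (enum_rank a) = a.
Proof. exact: nth_enum_rank. Qed.

Lemma rank_letter a : a < #|A| -> enum_rank (letter a) = a :> nat.
Proof.
move=> lt; have -> : a = enum_rank (enum_val (Ordinal lt)) by rewrite enum_valK.
by rewrite letter_rank.
Qed.

Lemma letter_inj a b : a < #|A| -> b < #|A| -> letter a = letter b -> a = b.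
Proof. by move=> al bl e; rewrite -(rank_letter al) e rank_letter. Qed.

Lemma letters_code : letters x = #|A|.
Proof. by rewrite /letters /x /code_sft code_nth_code. Qed.

Lemma forbidden_code a b : a < #|A| -> b < #|A| ->
  forbidden x a b = ([:: letter a; letter b] \in F).
Proof.
move=> al bl; have nthE i : code_nth x i.+1 = nth 0 (code_words F) i by rewrite /x /code_sft code_nth_code.
apply/hasP/idP => [[i _]|inF]; last first.
  have iF := inF; rewrite -index_mem in iF; exists (index [:: letter a; letter b] F).
    rewrite mem_iota add0n; apply: leq_trans (size_code _); rewrite /= size_map.
    exact: ltnW.
  rewrite nthE /code_words (nth_map [::]) // nth_index //=.
  by rewrite !rank_letter.
rewrite nthE /code_words; have [iF|iF] := ltnP i (size F); last first.
  rewrite nth_default ?size_map // eq_sym => /eqP/(congr1 CodeSeq.decode).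
  by rewrite CodeSeq.codeK.
rewrite (nth_map [::]) // => /eqP/(can_inj CodeSeq.codeK) e.
have := mem_nth [::] iF; move: (nth _ _ _) e => w; case: w => [|c [|d [|? ?]]] //= [<- <-].
by rewrite !letter_rank.
Qed.

Section Output.
Variable u : nat.
Hypothesis ok : cycle_ok u x.

Let L := cycle_len u.
Let L3 : 2 < L. Proof. by case/and4P: ok. Qed.

Lemma vertex_lt k : cycle_vertex u k < #|A|.
Proof.
case/and4P: ok => _ /allP h _ _; rewrite -letters_code /cycle_vertex -modn_mod.
by apply: h; rewrite mem_iota add0n ltn_mod -/L; have := L3; lia.
Qed.

Variables (q : nat) (hc vc : nat -> nat -> bool).
Hypothesis q0 : 0 < q.
Let M := cell_height L q.
Let c k := letter (cycle_vertex u k).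

Lemma state_ok_agree tau s s' : agree L tau s s' -> state_ok L q hc tau s -> state_ok L q hc tau s'.
Proof.
move=> ag /state_okP h; apply/state_okP => theta thL ne; have [h1 h2] := h theta thL ne.
rewrite -ag //; split=> // ne'; rewrite -ag //; first exact: h2.
by rewrite /cyc_succ; case: (theta.+1 =P L) => ?; have := L3; lia.
Qed.

Lemma stack_ok_agree tau s1 s1' s2 s2' : agree L tau s1 s1' -> agree L tau s2 s2' ->
  stack_ok L vc tau s1 s2 -> stack_ok L vc tau s1' s2'.
Proof.
move=> ag1 ag2 /stack_okP h; apply/stack_okP => theta thL ne.
by rewrite -ag1 // -ag2 //; apply: h.
Qed.

Lemma state_digits tau s : state_ok L q hc tau s ->
  exists2 t, t < q ^ L & agree L tau s (digit q t).
Proof.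
move=> /state_okP h; have [t tL tP] := digits_exist L s q0; exists t => // theta thL ne.
by rewrite tP // modn_small //; have [] := h theta thL ne.
Qed.

Lemma good_code_word t : good_code q hc vc u x t <->
  good_word L q c hc vc (fun k => letter (digit #|A| t k)).
Proof.
have A0 : 0 < #|A| by apply/card_gt0P; exists a0.
have M0 : 0 < M by rewrite /M /cell_height addn3.
rewrite /good_code letters_code -/L -/M; split.
  case/hasP=> r; rewrite mem_iota add0n => rM /hasP[tau]; rewrite mem_iota add0n => tL.
  case/hasP=> s0 _ /hasP[s1 _ /hasP[s2 _ /andP[/andP[/andP[/andP[/andP[h0 h1] h2] h3] h4] /allP h5]]].
  exists r, tau, (digit q s0), (digit q s1), (digit q s2); split=> // k kM.
  have := h5 k; rewrite mem_iota add0n kM => /(_ isT)/eqP->.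
  have : (r + k) %/ M < 3 by rewrite ltn_divLR //; lia.
  by rewrite /c; case: (_ %/ M) => [|[|[|?]]].
case=> r [tau [s0 [s1 [s2 [[rM tL] [h0 h1 h2] st0 st1 e]]]]].
have [t0 t0L g0] := state_digits h0; have [t1 t1L g1] := state_digits h1; have [t2 t2L g2] := state_digits h2.
apply/hasP; exists r; rewrite ?mem_iota //; apply/hasP; exists tau; rewrite ?mem_iota //.
apply/hasP; exists t0; rewrite ?mem_iota //; apply/hasP; exists t1; rewrite ?mem_iota //.
apply/hasP; exists t2; rewrite ?mem_iota //.
rewrite (state_ok_agree g0 h0) (state_ok_agree g1 h1) (state_ok_agree g2 h2).
rewrite (stack_ok_agree g0 g1 st0) (stack_ok_agree g1 g2 st1) /=.
apply/allP => k; rewrite mem_iota add0n => kM; apply/eqP.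
apply: letter_inj; [by rewrite ltn_mod | exact: vertex_lt |].
rewrite e // -/(c _).
have lt3 : (r + k) %/ M < 3 by rewrite ltn_divLR //; lia.
have rk : (r + k) %% M < M by rewrite ltn_mod.
move: lt3; case: (_ %/ M) => [|[|[|//]]] _ /=; by apply: cell_agree.
Qed.

Definition word t := [seq letter (digit #|A| t k) | k <- iota 0 M.*2].
Definition bad_words := [seq word t | t <- iota 0 (#|A| ^ M.*2) & ~~ good_code q hc vc u x t].

Lemma output_code : output q hc vc u x = code_sft bad_words.
Proof.
have A0 : 0 < #|A| by apply/card_gt0P; exists a0.
rewrite /output /code_sft letters_code -/L -/M /bad_words /code_words -map_comp.
congr (CodeSeq.code (_ :: _)); apply: eq_map => t; rewrite /word_code letters_code -/L -/M /=.
by congr CodeSeq.code; rewrite -map_comp; apply: eq_map => k /=; rewrite rank_letter // ltn_mod.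
Qed.

Lemma sft_bad_words z : sft bad_words z <-> forall i, good_word L q c hc vc (fun k => z (i + k%:Z)%R).
Proof.
have A0 : 0 < #|A| by apply/card_gt0P; exists a0.
have ext (w w' : nat -> A) : (forall k, k < M.*2 -> w k = w' k) ->
    good_word L q c hc vc w -> good_word L q c hc vc w'.
  move=> e [r [tau [s0 [s1 [s2 [h1 h2 h3 h4 h5]]]]]]; exists r, tau, s0, s1, s2; split=> // k kM.
  by rewrite -e // h5.
split=> [zW i|good w].
  have [t tM tP] := digits_exist M.*2 (fun k => enum_rank (z (i + k%:Z)%R)) A0.
  have zE k : k < M.*2 -> letter (digit #|A| t k) = z (i + k%:Z)%R.
    by move=> kM; rewrite tP // modn_small ?letter_rank // ltn_ord.
  apply: (ext _ _ zE); apply/good_code_word/negPn/negP => bad.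
  apply: (zW (word t)); first by apply: map_f; rewrite mem_filter bad mem_iota.
  exists i; rewrite /word size_map size_iota /mkseq; apply/eq_in_map => k.
  by rewrite mem_iota add0n => kM; rewrite zE.
case/mapP=> t; rewrite mem_filter => /andP[bad _] -> [i e]; case/negP: bad.
apply/good_code_word; apply: ext (good i) => k kM.
have := congr1 (fun s => nth a0 s k) e.
by rewrite nth_mkseq ?size_map ?size_iota // (nth_map 0) ?size_iota // nth_iota.
Qed.
End Output.
End Words.

(** * Graphs violating condition D *)

Section Graph.
Variables (A : finType) (F : seq (seq A)).
Hypothesis nnF : nearest_neighbor F.

Let G := rauzy (sft F).

Lemma sft_pairs z : sft F z <-> forall i, [:: z i; z (i + 1)%R] \notin F.
Proof.
split=> [zF i|h w wF [i e]].
  by apply/negP => /zF; apply; exists i; rewrite /mkseq /= addr0.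
have := nnF wF; move: w wF e => [|a [|b [|? ?]]] //= wF [e1 e2] _.
by have := h i; rewrite -e1 -e2 addr0 in wF *; rewrite wF.
Qed.

Lemma rauzy_edge a b : edge G a b -> [/\ a \in vertex G, b \in vertex G & [:: a; b] \notin F].
Proof.
move=> /asboolP[z zF [i [e1 e2]]]; split.
- by rewrite inE; apply/asboolP; exists z => //; exists i; rewrite /mkseq /= e1.
- by rewrite inE; apply/asboolP; exists z => //; exists (i + 1)%R; rewrite /mkseq /= addr0 e2.
- by have := sft_pairs z => -[/(_ zF) h _]; have := h i; rewrite -[in X in X -> _](addr0 i) e1 addr0 e2.
Qed.

Lemma not_symmetric : ~ condition_D G -> exists v w,
  [/\ v != w, edge G v w, ~~ edge G w v & connect (edge G) w v].
Proof.
move=> nD; apply: contrapT => no; apply: nD; apply: Or32 => S /andP[_ /maxsetp/andP[_ /forall_inP S_reach]].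
move=> v w vS wS vw evw; apply/negPn/negP => ewv; apply: no; exists v, w; split=> //.
have /forall_inP/(_ v vS)/existsP[z /andP[ez cz]] := S_reach w wS.
exact: connect_trans (connect1 ez) cz.
Qed.

(** On a shortest path, an edge from the first vertex to a later one, or a return to it, would be a
    shortcut. *)
Lemma geodesic (e : rel A) v w : connect e w v -> exists p, [/\ path e w p, last w p = v &
  forall d, 1 < d <= size p -> ~~ e w (nth w (w :: p) d) /\ w != nth w (w :: p) d].
Proof.
move=> /connectP wv; pose P n := [exists p : n.-tuple A, path e w p && (last w p == v)].
have ex : exists n, P n.
  by have [p pp vE] := wv; exists (size p); apply/existsP; exists (in_tuple p); rewrite pp -vE eqxx.
case: (ex_minnP ex) => n /existsP[p /andP[pp /eqP pv]] min; exists p; split=> // d /andP[d1 dn].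
have lE : nth w (w :: p) d = last w (take d p).
  by rewrite -nth_last size_takel // -[d]prednK ?(ltnW d1) //= nth_take // prednK ?(ltnW d1).
have [pd1 pd2] : path e w (take d p) /\ path e (nth w (w :: p) d) (drop d p).
  by apply/andP; rewrite lE -cat_path cat_take_drop.
have ld : last (nth w (w :: p) d) (drop d p) = v by rewrite lE -last_cat cat_take_drop.
rewrite size_tuple in dn; split.
  apply/negP => ed; have : n <= (size (nth w (w :: p) d :: drop d p)).
    apply: min; apply/existsP; exists (in_tuple (nth w (w :: p) d :: drop d p)).
    by rewrite /= ed pd2 ld eqxx.
  by rewrite /= size_drop size_tuple; lia.
apply/eqP => wE; have : n <= size (drop d p).
  by apply: min; apply/existsP; exists (in_tuple (drop d p)); rewrite wE pd2 ld eqxx.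
by rewrite size_drop size_tuple; lia.
Qed.

(** The configuration follows the cycle up to [c i], jumps to [c j] and follows the cycle again. *)
Lemma allowed_cycle_edge L (c : nat -> A) i j : 0 < L -> (forall k, c (k %% L) = c k) ->
  (forall k, [:: c k; c k.+1] \notin F) -> [:: c i; c j] \notin F -> edge G (c i) (c j).
Proof.
(* With natural indices, a step back along the cycle is made by adding [L.-1]. *)
move=> L0 cL cF ij; pose z (n : int) := if (n <= 0)%R then c (i + `|n| * L.-1)%N else c (j + `|n|.-1)%N.
apply/asboolP; exists z; last first.
  by exists 0%R; rewrite /mkseq /= /z /= mul0n !addn0.
apply/sft_pairs => n; rewrite /z; have [n0|n0] := leP (n + 1)%R 0%R.
  have -> : (n <= 0)%R by lia.
  have -> : absz n = (absz (n + 1)%R).+1 by lia.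
  move: (absz _) => k; rewrite -(cL (i + k * _)).
  have -> : (i + k * L.-1) %% L = (i + k.+1 * L.-1).+1 %% L.
    by rewrite mulSn addnCA -addSn prednK // modnDl.
  by rewrite cL.
have [n1|n1] := leP n 0%R.
  have -> : n = 0%R by lia.
  by rewrite mul0n !addn0.
have -> : (absz (n + 1)%R).-1 = (absz n).-1.+1 by lia.
by rewrite addnS.
Qed.

Lemma cycle_exists : ~ condition_D G -> exists u, cycle_ok u (code_sft F).
Proof.
move=> /not_symmetric[v [w [vw evw ewv cwv]]].
have [p [pp pv geo]] := geodesic cwv.
have a0 := v.
have p2 : 1 < size p.
  case: p pp pv {geo} => [|a [|b p]] //=; first by move=> _ e; rewrite e eqxx in vw.
  by rewrite andbT => ea e; move: ewv; rewrite -e => /negP[]; exact: ea.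
pose L := (size p).+1; pose c k := nth w (w :: p) (k %% L).
pose u := CodeSeq.code (L :: [seq (enum_rank a : nat) | a <- w :: p]).
have cE k : cycle_vertex u k = enum_rank (c k).
  have nthE s j : nth 0 (L :: s) j.+1 = nth 0 s j by [].
  rewrite /cycle_vertex /cycle_len /u !code_nth_code nthE; apply: (nth_map w).
  by rewrite /= ltn_mod.
have cN k : cycle_vertex u k < #|A| by rewrite cE ltn_ord.
have lc k : letter a0 (cycle_vertex u k) = c k by rewrite cE letter_rank.
have LE : cycle_len u = L by rewrite /cycle_len /u code_nth_code.
have c_edge k : edge G (c k) (c k.+1).
  rewrite /c; have kL : k %% L < L by rewrite ltn_mod.
  rewrite -addn1 -modnDml addn1; move: (k %% L) kL => {}k; rewrite ltnS leq_eqVlt => /predU1P[->|lt].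
    have -> : nth w (w :: p) (size p) = v by rewrite -pv -[RHS]/(last w (w :: p)) -nth_last.
    by rewrite -/L modnn.
  rewrite modn_small ?ltnS //.
  by have /(pathP w)/(_ k lt) := pp.
have cF k : [:: c k; c k.+1] \notin F by have [] := rauzy_edge (c_edge k).
have sep d : 1 < d < L -> separated (code_sft F) (cycle_vertex u 0) (cycle_vertex u d).
  move=> /andP[d1 dL]; have [ne nw] := geo d ltac:(lia).
  have c0 : c 0 = w by rewrite /c mod0n.
  have cd : c d = nth w (w :: p) d by rewrite /c modn_small.
  apply/andP; split; last by rewrite !cE c0 cd; apply: contra_neq nw => /val_inj/enum_rank_inj.
  rewrite (forbidden_code a0 F) ?cN // !lc; apply/negPn/negP => nF.
  have := allowed_cycle_edge (L := L) isT _ cF nF; rewrite c0 cd; move/negP: ne => ne h; apply: ne; apply: h.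
  by move=> k; rewrite /c modn_mod.
exists u; rewrite /cycle_ok LE; apply/and4P; split=> //.
- by apply/allP => k _; rewrite (letters_code F).
- by apply/allP => k _; rewrite (forbidden_code a0 F) ?cN // !lc.
- apply/allP => d; rewrite mem_iota add0n => dL; apply/implyP => d1.
  by apply: sep; rewrite d1.
Qed.

(** The constant configuration at a vertex is now a path, so all vertices have loops in the new
    Rauzy graph. *)
Lemma condition_D_loops : condition_D (rauzy (path_shift (add_loops G))).
Proof.
apply: Or31 => S /andP[_ /maxsetp/andP[/fintype.subsetP SV _]] v vS.
have := SV v vS; rewrite inE => /asboolP[z zH [i [e]]].
have vG : v \in vertex G by rewrite -e; have [] := zH (i + 0)%R.
apply/asboolP; exists (fun=> v); last by exists 0%R.
by move=> j; split=> //=; rewrite eqxx vG orbT.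
Qed.
End Graph.

(** * The theorem *)

Section Simulation.
Variables (A : finType) (F : seq (seq A)) (a0 : A) (u : nat).
Hypothesis nnF : nearest_neighbor F.
Hypothesis ok : cycle_ok u (code_sft F).

Let G := rauzy (sft F).
Let Htilde := path_shift (add_loops G).
Let E := edge (add_loops G).
Let L := cycle_len u.
Let c k := letter a0 (cycle_vertex u k).

Lemma cycle_len_gt2 : 2 < L. Proof. by case/and4P: ok. Qed.

Lemma cycle_modn k : c (k %% L) = c k.
Proof. by rewrite /c /cycle_vertex modn_mod. Qed.

Lemma cycle_periodic k : c (k + L) = c k.
Proof. by rewrite -[LHS]cycle_modn modnDr; apply: cycle_modn. Qed.

Lemma cycle_allowed k : [:: c k; c k.+1] \notin F.
Proof.
case/and4P: ok => L3 _ /allP h _; have kL : k %% L < L by rewrite ltn_mod; apply: ltn_trans L3.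
have := h (k %% L); rewrite mem_iota add0n kL => /(_ isT).
rewrite (forbidden_code a0) ?(vertex_lt ok) //.
have e : c (k %% L).+1 = c k.+1 by rewrite -[LHS]cycle_modn -addn1 modnDml addn1; apply: cycle_modn.
by rewrite -(cycle_modn k) -e.
Qed.

Lemma cycle_edge k : edge G (c k) (c k.+1).
Proof.
have L3 := cycle_len_gt2; apply: (allowed_cycle_edge nnF (L := L)); first by lia.
- exact: cycle_modn.
- exact: cycle_allowed.
- exact: cycle_allowed.
Qed.

Lemma cycle_in_vertex k : c k \in vertex G.
Proof. by have [] := rauzy_edge nnF (cycle_edge k). Qed.

Lemma cycle_refl k : E (c k) (c k).
Proof. by rewrite /E /= eqxx cycle_in_vertex orbT. Qed.

Lemma cycle_succ k : E (c k) (c k.+1).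
Proof. by rewrite /E /=; have := cycle_edge k; rewrite /G /= => ->. Qed.

Lemma separated_edge i j : separated (code_sft F) (cycle_vertex u i) (cycle_vertex u j) ->
  ~~ E (c i) (c j).
Proof.
case/andP; rewrite (forbidden_code a0) ?(vertex_lt ok) // -/(c _) -/(c _) => ij ne.
apply/negP => /orP[e|/andP[/eqP e _]].
  by have [_ _] := rauzy_edge nnF e; rewrite ij.
by move/negP: ne; apply; apply/eqP; apply: (letter_inj (a0 := a0)) => //; apply: vertex_lt ok _.
Qed.

Lemma cycle_rigid d : 1 < d < L -> ~~ E (c 0) (c d).
Proof.
case/andP=> d1 dL; case/and4P: ok => _ _ _ /allP h.
by have := h d; rewrite mem_iota add0n dL d1 => /(_ isT); apply: separated_edge.
Qed.

Variables (lab : finType) (hor ver : rel lab) (lok bot diag reward : pred lab).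
Variables (lam : nat -> nat -> lab) (D : pred nat).
Hypothesis lamP : forall N, octant_ok hor ver lok bot diag N lam.
Hypothesis reward_diag : forall x, reward x -> diag x.
Hypothesis D_reward : forall k, D k -> reward (lam k k.+1).
Hypothesis sound : forall N0, exists N1, forall N, N1 <= N -> forall f,
  octant_ok hor ver lok bot diag N.-1 f -> forall k, k < N0 -> reward (f k k.+1) -> D k.

Let t0 := odo_tile lam (fun _ _ => false) 0 0.
Let q := #|{: tile lab}|.
Let hc := hcode hor ver lok bot diag reward t0.
Let vc := vcode t0.
Let M := cell_height L q.
Let X := combined Htilde (sft (bad_words a0 F u q hc vc)).

Lemma tiles_gt0 : 0 < q.
Proof. by apply/card_gt0P; exists t0. Qed.

Lemma encode_combined (free : int -> int -> bool) : (forall i j, free i j -> reward (line_label lam j)) ->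
  X (fun p => encode L q c (odo_code lam free) p.1 p.2).
Proof.
move=> fP i j; split=> [k|].
  split; first exact: cycle_in_vertex.
  exact: (encode_edge cycle_len_gt2 tiles_gt0 cycle_periodic cycle_refl cycle_succ).
have [_] := sft_bad_words a0 ok hc vc tiles_gt0 (encode L q c (odo_code lam free) i).
apply=> l; apply: (column_good (c := c) (hc := hc) (vc := vc) cycle_len_gt2 tiles_gt0 l).
apply: (@encode_column A L q c hc vc cycle_len_gt2 tiles_gt0).
- by move=> *; apply: odo_code_lt.
- by move=> *; apply: odo_code_hor fP _ _.
- by move=> *; apply: odo_code_ver.
Qed.

Lemma combined_nonempty : (X !=set0)%classic.
Proof. by eexists; apply: (@encode_combined (fun _ _ => false)). Qed.

Lemma num_patterns_lower n N0 :
  2 ^ (n * \sum_(k < N0) D k * (n %/ M %/ 2 ^ k.+2)) <= num_patterns X n.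
Proof.
apply: leq_trans (pattern_lower lamP cycle_len_gt2 cycle_periodic cycle_refl cycle_rigid (n := n) _).
  by rewrite leq_exp2l // leq_mul2l; apply/orP; right; apply: reward_rows; exact: D_reward.
move=> free fP; rewrite inE; apply/asboolP; exists (fun p => encode L q c (odo_code lam free) p.1 p.2).
  exact: encode_combined.
by exists 0%R, 0%R => k l; rewrite ffunE !add0r.
Qed.

Lemma num_patterns_upper N0 N n : N0 < N ->
  (forall f, octant_ok hor ver lok bot diag N.-1 f -> forall k, k < N0 -> reward (f k k.+1) -> D k) ->
  num_patterns X n.+1 <= M * L * 2 ^ n * #|{: strip_data lab N0 N D (n %/ M).+2 (n + L)}|.
Proof.
move=> N0N snd; apply: (pattern_upper (t0 := t0) cycle_len_gt2 cycle_periodic cycle_rigid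
  reward_diag N0N snd) => p.
rewrite inE => /asboolP[x xX [i [j xE]]]; exists (fun a b => x (i + a%:Z, j + b)%R); split.
- move=> a _; have [_] := xX (i + a%:Z)%R 0%R.
  have [h _] := sft_bad_words a0 ok hc vc tiles_gt0 (fun b => x (i + a%:Z, b)%R).
  move/h => good.
  apply: (column_decode cycle_len_gt2 tiles_gt0 cycle_periodic cycle_refl cycle_rigid) => b.
  by have := good (j + b)%R; congr good_word; apply/funext => k; rewrite addrA.
- move=> a b _; have [/(_ (i + a%:Z)%R)[_ e] _] := xX 0%R (j + b)%R.
  by move: e; rewrite -addrA -PoszD addn1.
- by move=> k l; rewrite xE.
Qed.

Lemma entropy_window (R : realType) : exists l : R, entropy R X = l /\ forall N0,
  ((reward_weight N0 D)%:R <= l * (M * 2 ^ N0.+1)%:R <= (reward_weight N0 D)%:R + 3%:R)%R.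
Proof.
have M0 : 0 < M by rewrite /M /cell_height addn3.
have [||l [cv lP]] := @entropy_limit R (num_patterns X) M L q D M0.
- by move=> n N0; apply: num_patterns_lower.
- move=> N0; have [N1 N1P] := sound N0; exists N1 => N n N0N N1N.
  apply: leq_trans (num_patterns_upper n N0N (N1P N N1N)) _.
  apply: leq_trans (leq_mul (leqnn _) (card_strip_data _ _ _ _ _ _)) _.
  have ML : M * L <= 2 ^ (M * L) by apply/ltnW/ltn_expl.
  apply: leq_trans (leq_mul (leq_mul ML (leqnn _)) (leqnn _)) _.
  by rewrite -!expnD !addnA.
by exists l; split=> //; apply: (cvg_lim _ cv).
Qed.
End Simulation.

Local Open Scope classical_set_scope.

Theorem proposition6p4 (R : realType) :
  exists algo : recfun 1,
  forall (A : finType) (F : seq (seq A)),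
    nearest_neighbor F ->
    let G := rauzy (sft F) in
    ~ condition_D G ->
    (forall v, ~ attractive G v /\ ~ almost_attractive G v) \/
    (forall v, ~ repulsive G v /\ ~ almost_repulsive G v) ->
    let Htilde := path_shift (add_loops G) in
    condition_D (rauzy Htilde) /\
    exists W : seq (seq A),
      let X := combined Htilde (sft W) in
      [/\ computes algo [tuple code_sft F] (code_sft W),
          X !=set0
        & ~ computable_real (entropy R X)].
Proof.
have [enum [[c cP0] enum4 undec]] := undecidable_enumeration.
have cP n : computes c [tuple n] (enum n) by have := cP0 [tuple n].
(* The levels that carry free bits are those never enumerated. *)
pose D k := ~~ `[< exists n, enum n = k >].
have Denum n : ~~ D (enum n) by rewrite negbK; apply/asboolP; exists n.
pose lam := run_label cP D.
have lamP N : octant_ok (@hor c) (@ver c) (@label_ok c) (@bot c) (@diag c) N lam.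
  exact: (octant_complete cP Denum).
have reward_diag (x : label c) : reward x -> diag x by case/andP.
have D_reward k : D k -> reward (lam k k.+1) by rewrite run_label_reward.
(* A single size of octant must refute all enumerated numbers below [N0]; the maximum of finitely
   many sizes from [octant_sound] does. *)
have sound N0 : exists N1, forall N, N1 <= N -> forall f,
    octant_ok (@hor c) (@ver c) (@label_ok c) (@bot c) (@diag c) N.-1 f ->
    forall k, k < N0 -> reward (f k k.+1) -> D k.
  elim: N0 => [|N0 [N1 N1P]]; first by exists 0.
  have [[n nE]|no] := pselect (exists n, enum n = N0); last first.
    exists N1 => N le f fok k; rewrite ltnS leq_eqVlt => /predU1P[->|]; last exact: (N1P N le f fok).
    by move=> _; apply/negP => /asboolP.
  have [N2 [_ N2P]] := octant_sound cP n.
  exists (maxn N1 N2.+1) => N; rewrite geq_max => /andP[le1 le2] f fok k.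
  rewrite ltnS leq_eqVlt => /predU1P[->|]; last exact: (N1P N le1 f fok).
  move=> rw; have := N2P f; rewrite nE rw => h; exfalso; apply: (notF (h _)).
  move=> m L' /andP[mL LN]; have [|h1 h2 h3 h4 h5] := fok m L'; first by lia.
  by split=> // lt; apply: h5; lia.
pose t0 := odo_tile lam (fun _ _ => false) 0 0.
pose q := #|{: tile (label c)}|.
have q0 : 0 < q by apply/card_gt0P; exists t0.
pose hc := hcode (@hor c) (@ver c) (@label_ok c) (@bot c) (@diag c) (@reward c) t0.
(* Tiles and their rules depend only on [c], so the algorithm is fixed before [A] and [F] are given;
   only the cycle is read off the input. *)
have [algo algoP] := program_exists hc (vcode t0) q0.
exists algo => A F nnF G nD _ Htilde; split; first exact: condition_D_loops.
have [u0 ok0] := cycle_exists nnF nD.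
have [u ok cu] := algoP _ _ ok0.
have A0 : 0 < #|A| by exact: leq_ltn_trans (leq0n _) (vertex_lt ok 0).
pose a0 := enum_val (Ordinal A0).
exists (bad_words a0 F u q hc (vcode t0)).
move=> X; split.
- by rewrite -output_code.
- rewrite /X /Htilde /G; have := @combined_nonempty A F a0 u nnF ok _ _ _ _ _ _ (@reward c) _ lamP; apply.
have [l [-> lP]] := entropy_window a0 nnF ok lamP reward_diag D_reward sound R.
move=> comp; have M0 : 0 < cell_height (cycle_len u) q by rewrite /cell_height addn3.
have D4 j : ~~ (4 %| j) -> ~~ D j by move=> /enum4; rewrite negbK => h; apply/asboolP.
have [d [rd dE]] := digit_recursive M0 lP D4 comp.
apply: (undec d rd) => k; rewrite dE /D; split=> [h|].
  by have -> : `[< exists n, enum n = 4 * k >] = true by apply/asboolP.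
by case: asboolP.
Qed.
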